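(* Let $\varphi(z)=\tfrac12z^2+\tfrac12$. Then for every $\psi\in H^\infty$ continuous at $1$, $$\sigma(W_{\psi,\varphi})=\{\psi(1)e^{-t/2}: t\ge0\}\cup\{0\},$$ with $W_{\psi,\varphi}$ acting on $H^2$.
   Context: $H^2$ is the Hardy space of analytic $f(z)=\sum a_nz^n$ on the open unit disk $\mathbb{D}$ with $\sum|a_n|^2<\infty$; $H^\infty$ is the space of bounded analytic functions on $\mathbb{D}$. $W_{\psi,\varphi}f=\psi\cdot(f\circ\varphi)$ is the weighted composition operator. ''$\psi$ continuous at $1$'' means $\psi$ extends continuously to $\mathbb{D}\cup\{1\}$. $\sigma(T)$ denotes the spectrum of the operator $T$. *)

(* Defs.v *)
From HB Require Import structures.
From mathcomp Require Import all_boot all_order all_algebra.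
From mathcomp Require Import all_classical all_reals all_analysis.
From mathcomp Require Import complex.
Set Implicit Arguments. Unset Strict Implicit. Unset Printing Implicit Defensive.
Import Order.TTheory GRing.Theory Num.Theory ComplexField.
Import numFieldNormedType.Exports.
Local Open Scope classical_set_scope.
Local Open Scope ring_scope.

(* Equip R[i] with its canonical (normed-field) topology and normed-module
   structure, exactly as mathcomp-analysis does for generic numFieldTypes. *)
#[non_forgetful_inheritance]
HB.instance Definition _ (R : realType) :=
  PseudoPointedMetric.copy (complex R) (complex R)^o.
#[non_forgetful_inheritance]
HB.instance Definition _ (R : realType) :=
  GRing.ComAlgebra.copy (complex R) (complex R)^o.
#[non_forgetful_inheritance]
HB.instance Definition _ (R : realType) := Vector.copy (complex R) (complex R)^o.
#[non_forgetful_inheritance]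
HB.instance Definition _ (R : realType) :=
  NormedModule.copy (complex R) (complex R)^o.

Section Defs.
Variable R : realType.
Local Notation C := R[i].

Definition disk : set C := [set z | `|z| < 1].

Definition is_taylor (a : nat -> C) (f : C -> C) : Prop :=
  forall z, `|z| < 1 -> [series a k * z ^+ k]_k @ \oo --> f z.

Definition H2bound (f : C -> C) (M : C) : Prop :=
  0 <= M /\ exists a : nat -> C, is_taylor a f /\
    forall n, \sum_(k < n) `|a k| ^+ 2 <= M ^+ 2.

Definition inH2 (f : C -> C) : Prop := exists M, H2bound f M.

(* equality as elements of H^2: equality on the disk *)
Definition eqD (f g : C -> C) : Prop := forall z, `|z| < 1 -> f z = g z.

Definition holomorphic_disk (f : C -> C) : Prop :=
  forall z, `|z| < 1 -> derivable f z 1.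

Definition Hinf (f : C -> C) : Prop :=
  holomorphic_disk f /\ exists M : C, forall z, `|z| < 1 -> `|f z| <= M.

Definition bounded_op (T : (C -> C) -> (C -> C)) : Prop :=
  [/\ forall f, inH2 f -> inH2 (T f),
      forall f g c, inH2 f -> inH2 g ->
        eqD (T (fun z => c * f z + g z)) (fun z => c * T f z + T g z)
    & exists K : C, 0 <= K /\ forall f M, H2bound f M -> H2bound (T f) (K * M)].

Definition invertible_op (T : (C -> C) -> (C -> C)) : Prop :=
  bounded_op T /\ exists S, bounded_op S /\
    forall f, inH2 f -> eqD (S (T f)) f /\ eqD (T (S f)) f.

Definition spectrum (T : (C -> C) -> (C -> C)) : set C :=
  [set lam | ~ invertible_op (fun f z => T f z - lam * f z)].

Definition Wco (psi phi : C -> C) (f : C -> C) : C -> C :=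
  fun z => psi z * f (phi z).

Definition phi8 (z : C) : C := z ^+ 2 / 2 + 1 / 2.

End Defs.

(* Main.v *)
Require Import Defs.
From HB Require Import structures.
From mathcomp Require Import all_boot all_order all_algebra.
From mathcomp Require Import all_classical all_reals all_analysis.
From mathcomp Require Import complex.
From mathcomp Require Import ring lra zify.
Import Order.TTheory GRing.Theory Num.Theory ComplexField.
Import numFieldNormedType.Exports.
Local Open Scope classical_set_scope.
Local Open Scope ring_scope.
Set Implicit Arguments. Unset Strict Implicit. Unset Printing Implicit Defensive.

(** Upper inclusion. The restriction of W to the disk internally tangent at 1 of
    radius s is T_s f(z) = psi(1 - s(1 - z)) f(z + (s/2)(1 - z)^2), with T_1 = W.
    There are bounded A, B with T_s = BA and T_(s(1 - s/2)) = AB, so the nonzero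
    spectrum of T_s is the same along a sequence of radii tending to 0. As s
    tends to 0 the weight tends uniformly to psi(1), and the composition operator
    with symbol Phi(z) = z + a(1 - z)^2, a = s/2, comes close in norm to the positive
    contraction P f(z) = u(z) f(xi(z)), where u(z) = 1/(1 + a(1 - z)) and
    1 - xi = (1 - z) u. Indeed the coefficients of Phi^n and u xi^n are probability
    distributions, Phi - xi = a^2 (1 - z)^3 u, and summing
    Phi^j (Phi - xi) xi^(n-1-j) with the smoothing estimate
    |(1 - z)^3 Phi^j|_1 = O((ja)^(-3/2)) bounds their distance by O(sqrt a)
    uniformly in n; the Schur test does the rest. Since
    |P - c| <= max(|c|, |1 - c|), a Neumann series around a suitable c inverts
    T_s - lam for every lam outside psi(1)[0, 1].

    Lower inclusion. 0 is in the spectrum because the range of W consists of psi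
    times even functions. For lam = psi(1) exp(-t/4), the functions
    f_r = exp(-t/(1 - z)) / (1 - r z) satisfy |(T_(1/2) - lam) f_r| <= eta |f_r| + C_eta
    on the disk for every eta > 0, uniformly in r < 1. If T_(1/2) - lam were
    bounded below, the f_r would be bounded in H^2, hence
    exp(-t/(1 - z)) / (1 - z) would be in H^2, which its size on the horocycle
    1/(1 - z) = 1 + iy excludes.

    The function theory on the disk is discrete: averages over the 2^k-th roots of
    unity replace integrals, both in Parseval's identity and in Goursat's
    theorem. *)

(** The coordinate w = 1/(1 - z) explains the constructions. In it xi is the translation w + a, so
    exp(-t w) is an eigenfunction of composition with xi for the eigenvalue exp(-ta), while Phi is w
    + a + O(1/w), a perturbation that is negligible only near 1. No norm limit of T_s can serve as s
    tends to 0: Phi tends to the identity, yet the spectrum stays a whole segment when psi(1) is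
    nonzero. The comparison operator P therefore has to vary with a. The factor u is what makes P
    positive: P is sg times C*C, where C is composition with the affine map bb + sg z, whose adjoint
    carries a Szego kernel. Only the two ends of [0, 1] then matter in bounding P - c. The lower
    inclusion is proved at radius 1/2 because phi(-1) = 1: at radius 1 the function f_r composed
    with phi is not bounded uniformly in r near -1, whereas f_r is, so that f_r is no approximate
    eigenfunction. At radius 1/2 one has 1 - Phi = (1 - z)(3 + z)/4, which vanishes on the closed
    disk only at 1. *)

Notation normc := Normc.normc.

(** * Power series and H^2 norms *)

Section Basics.
Variable R : realType.
Local Notation C := R[i].
Implicit Types (z w : C) (a b : nat -> C) (f g : C -> C) (q r e M : R).

Lemma normcE z : `|z| = (normc z)%:C%C.
Proof. by []. Qed.

Lemma normc_ge0 z : 0 <= normc z.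
Proof. by rewrite -ler0c -normcE. Qed.

Lemma normc0 : normc (0 : C) = 0.
Proof. exact: Normc.normc0. Qed.

Lemma normc1 : normc (1 : C) = 1.
Proof. exact: Normc.normc1. Qed.

Lemma normcX z n : normc (z ^+ n) = normc z ^+ n.
Proof.
elim: n => [|n IH]; first by rewrite !expr0 normc1.
by rewrite !exprS Normc.normcM IH.
Qed.

Lemma normc_eq0 z : (normc z == 0) = (z == 0).
Proof.
apply/eqP/eqP => [/Normc.eq0_normc//|->]; exact: normc0.
Qed.

Lemma normc_gt0 z : (0 < normc z) = (z != 0).
Proof. by rewrite lt0r normc_ge0 normc_eq0 andbT. Qed.

Lemma normc_real (x : R) : normc (x%:C%C) = `|x|.
Proof. by rewrite /Normc.normc /= expr0n /= addr0 sqrtr_sqr. Qed.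

Lemma normc_sum (I : Type) (s : seq I) (P : pred I) (F : I -> C) :
  normc (\sum_(i <- s | P i) F i) <= \sum_(i <- s | P i) normc (F i).
Proof.
elim/big_rec2: _ => [|i y x _ H]; first by rewrite normc0.
by apply: (le_trans (le_normcD _ _)); rewrite lerD2l.
Qed.

Lemma normc_distC z w : normc (z - w) = normc (w - z).
Proof. by rewrite -normcN opprB. Qed.

Lemma normc_triangle z w v : normc (z - v) <= normc (z - w) + normc (w - v).
Proof. by have := le_normcD (z - w) (w - v); rewrite addrA subrK. Qed.

Lemma normc_sub_ge z w : normc z - normc w <= normc (z - w).
Proof. by have := le_normcD (z - w) w; rewrite subrK; lra. Qed.

Lemma expr_small r e : 0 <= r < 1 -> 0 < e -> exists N, forall n, (N <= n)%N -> r ^+ n < e.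
Proof.
move=> /andP[r0 r1] e0.
have /cvgrPdist_lt/(_ _ e0)[N _ H] : (fun n => r ^+ n) @ \oo --> 0.
  by apply: cvg_expr; rewrite ger0_norm.
by exists N => n Nn; have := H n Nn; rewrite /= sub0r normrN ger0_norm ?exprn_ge0.
Qed.

Lemma geom_tail r n m : 0 <= r < 1 -> \sum_(n <= k < n + m) r ^+ k <= r ^+ n / (1 - r).
Proof.
move=> /andP[r0 r1]; have r1' : 0 < 1 - r by lra.
rewrite ler_pdivlMr //.
have -> : (\sum_(n <= k < n + m) r ^+ k) * (1 - r) = r ^+ n - r ^+ (n + m).
  elim: m => [|m IH]; first by rewrite addn0 big_geq // mul0r subrr.
  by rewrite addnS big_nat_recr ?leq_addr //= mulrDl IH exprS; ring.
by rewrite gerBl exprn_ge0.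
Qed.

Definition psum a z n := \sum_(k < n) a k * z ^+ k.

(* [v] is the sum of the power series [a] at [z]. Norms live in [R], not in the
   partially ordered [R[i]]. *)
Definition tay a z v :=
  forall e, 0 < e -> exists N, forall n, (N <= n)%N -> normc (psum a z n - v) < e.

(* [q] bounds the square of the H^2 norm, while [H2bound] bounds the norm. *)
Definition Hq f q := exists a : nat -> C,
  (forall z, normc z < 1 -> tay a z (f z)) /\ forall n, \sum_(k < n) normc (a k) ^+ 2 <= q.

Lemma eps_le (x y : R) : (forall e, 0 < e -> x <= y + e) -> x <= y.
Proof.
move=> H; rewrite leNgt; apply/negP => yx.
by have := H ((x - y) / 2); lra.
Qed.

Lemma tay_le a z v (c : R) N :
  (forall n, (N <= n)%N -> normc (psum a z n) <= c) -> tay a z v -> normc v <= c.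
Proof.
move=> H T; apply: eps_le => e /T[N1 H1].
have /= := H1 (maxn N N1) (leq_maxr _ _); have := H (maxn N N1) (leq_maxl _ _).
set p := psum _ _ _; have := normc_sub_ge v p; rewrite normc_distC; lra.
Qed.

Lemma psum_split a z n m :
  psum a z (n + m) = psum a z n + \sum_(n <= k < n + m) a k * z ^+ k.
Proof. by rewrite /psum -!(big_mkord xpredT (fun k => a k * z ^+ k)) (big_cat_nat (n := n)) //= leq_addr. Qed.

Lemma psum_diff_le a z M n m : (forall k, normc (a k) <= M) -> normc z < 1 ->
  normc (psum a z (n + m) - psum a z n) <= M * (normc z ^+ n / (1 - normc z)).
Proof.
move=> Ha z1; rewrite psum_split addrC addKr.
apply: (le_trans (normc_sum _ _ _)).
have M0 : 0 <= M by apply: le_trans (Ha 0%N); exact: normc_ge0.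
apply: (@le_trans _ _ (M * \sum_(n <= k < n + m) normc z ^+ k)).
  rewrite mulr_sumr; apply: ler_sum => i _.
  by rewrite Normc.normcM normcX ler_wpM2r // exprn_ge0 // normc_ge0.
by rewrite ler_wpM2l // geom_tail // normc_ge0.
Qed.

Lemma tay_tail a z v M n : (forall k, normc (a k) <= M) -> normc z < 1 -> tay a z v ->
  normc (v - psum a z n) <= M * (normc z ^+ n / (1 - normc z)).
Proof.
move=> Ha z1 T; apply: eps_le => e /T[N H].
have := H (n + N)%N (leq_addl _ _); have := psum_diff_le n N Ha z1.
set p := psum a z (n + N); set s := psum a z n.
have := normc_triangle v p s; rewrite (normc_distC v p); lra.
Qed.

Lemma Hq_ge0 f q : Hq f q -> 0 <= q.
Proof. by case=> a [_ /(_ 0%N)]; rewrite big_ord0. Qed.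

Lemma coef_le a q k : (forall n, \sum_(k < n) normc (a k) ^+ 2 <= q) -> normc (a k) <= Num.sqrt q.
Proof.
move=> H; have q0 : 0 <= q by have := H 0%N; rewrite big_ord0.
have := H k.+1; rewrite big_ord_recr /= => Hk.
rewrite -[leLHS](ger0_norm (normc_ge0 _)) -sqrtr_sqr ler_sqrt //.
by apply: le_trans Hk; rewrite lerDr sumr_ge0 // => i _; rewrite sqr_ge0.
Qed.

Lemma Hq_le f q q' : q <= q' -> Hq f q -> Hq f q'.
Proof. by move=> qq [a [H1 H2]]; exists a; split => // n; exact: le_trans (H2 n) qq. Qed.

Lemma Hq_eq f g q : (forall z, normc z < 1 -> f z = g z) -> Hq f q -> Hq g q.
Proof. by move=> fg [a [H1 H2]]; exists a; split => // z z1; rewrite -fg //; exact: H1. Qed.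

(** The right side exceeds (|z| + |w|)^2 by t (|z| - |w|/t)^2. Since [Hq] bounds squared norms, this
    replaces the triangle inequality; a small t keeps the constant of the first summand close to
    1. *)
Lemma sqr_normcD_le z w (t : R) : 0 < t ->
  normc (z + w) ^+ 2 <= (1 + t) * normc z ^+ 2 + (1 + t^-1) * normc w ^+ 2.
Proof.
move=> t0; have ti : 0 < t^-1 by rewrite invr_gt0.
have := le_normcD z w; have := normc_ge0 (z + w); have := normc_ge0 z; have := normc_ge0 w.
set x := normc z; set y := normc w => y0 x0 n0 nle.
apply: (@le_trans _ _ ((x + y) ^+ 2)); first by rewrite lerXn2r // nnegrE; lra.
have -> : (1 + t) * x ^+ 2 + (1 + t^-1) * y ^+ 2 = (x + y) ^+ 2 + t * (x - t^-1 * y) ^+ 2.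
  by field; lra.
by rewrite lerDl mulr_ge0 ?sqr_ge0 // ltW.
Qed.

Lemma tayD a b z v w : tay a z v -> tay b z w -> tay (fun k => a k + b k) z (v + w).
Proof.
move=> H1 H2 e e0; have e2 : 0 < e / 2 by lra.
have [N1 K1] := H1 _ e2; have [N2 K2] := H2 _ e2.
exists (maxn N1 N2) => n; rewrite geq_max => /andP[/K1 L1 /K2 L2].
have -> : psum (fun k => a k + b k) z n = psum a z n + psum b z n.
  by rewrite /psum -big_split; apply: eq_bigr => i _; rewrite mulrDl.
rewrite opprD addrACA; apply: le_lt_trans (le_normcD _ _) _; lra.
Qed.

Lemma tayZ a z v (c : C) : tay a z v -> tay (fun k => c * a k) z (c * v).
Proof.
move=> H e e0.
have [->|c0] := eqVneq c 0.
  exists 0%N => n _; rewrite /psum big1 ?mul0r ?subr0 ?normc0 // => i _.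
  by rewrite !mul0r.
have n0 : 0 < normc c by rewrite normc_gt0.
have [N K] := H (e / normc c) (divr_gt0 e0 n0); exists N => n /K L.
have -> : psum (fun k => c * a k) z n = c * psum a z n.
  by rewrite /psum mulr_sumr; apply: eq_bigr => i _; rewrite mulrA.
by rewrite -mulrBr Normc.normcM mulrC -ltr_pdivlMr.
Qed.

Lemma HqD f g q1 q2 (t : R) : 0 < t -> Hq f q1 -> Hq g q2 ->
  Hq (fun z => f z + g z) ((1 + t) * q1 + (1 + t^-1) * q2).
Proof.
move=> t0 [a [H1 H2]] [b [K1 K2]]; exists (fun k => a k + b k); split.
  by move=> z z1; apply: tayD; [exact: H1|exact: K1].
move=> n; apply: (@le_trans _ _ (\sum_(k < n) ((1 + t) * normc (a k) ^+ 2 + (1 + t^-1) * normc (b k) ^+ 2))).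
  by apply: ler_sum => i _; exact: sqr_normcD_le.
have ti : 0 < t^-1 by rewrite invr_gt0.
rewrite big_split /= -!mulr_sumr; by apply: lerD; apply: ler_wpM2l; rewrite ?H2 ?K2 //; lra.
Qed.

Lemma HqZ f q (c : C) : Hq f q -> Hq (fun z => c * f z) (normc c ^+ 2 * q).
Proof.
move=> [a [H1 H2]]; exists (fun k => c * a k); split.
  by move=> z z1; apply: tayZ; exact: H1.
move=> n; under eq_bigr do rewrite Normc.normcM exprMn.
by rewrite -mulr_sumr ler_wpM2l ?sqr_ge0.
Qed.

Lemma Hq_eval f q z : Hq f q -> normc z < 1 -> normc (f z) <= Num.sqrt q / (1 - normc z).
Proof.
move=> [a [H1 H2]] z1.
have := tay_tail 0 (fun k => coef_le k H2) z1 (H1 _ z1).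
by rewrite /psum big_ord0 subr0 expr0 mul1r.
Qed.

Lemma tay_poly (p : {poly C}) z : tay (fun k => p`_k) z p.[z].
Proof.
move=> e e0; exists (size p) => n /subnKC <-.
rewrite psum_split horner_coef addrC addKr big_nat_cond big1 ?normc0 // => i.
by case/andP => /andP[h _] _; rewrite nth_default // mul0r.
Qed.

Lemma Hq_poly (p : {poly C}) q :
  (forall n, \sum_(k < n) normc (p`_k) ^+ 2 <= q) -> Hq (fun z => p.[z]) q.
Proof. by move=> H; exists (fun k => p`_k); split => // z _; exact: tay_poly. Qed.

End Basics.

(** * Limits of power series and of their coefficients *)

Section Limits.
Variable R : realType.
Local Notation C := R[i].
Implicit Types (z w : C) (a b : nat -> C) (f g : C -> C) (q r e M : R).

Lemma normc_Re z : `|complex.Re z| <= normc z.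
Proof. by rewrite -lecR -normcE normc_ge_Re. Qed.

Lemma normc_Im z : `|complex.Im z| <= normc z.
Proof.
case: z => x y; rewrite /Normc.normc /= -(sqrtr_sqr y) ler_sqrt ?addr_ge0 ?sqr_ge0 //.
by rewrite lerDr sqr_ge0.
Qed.

Lemma normc_le_ReIm z : normc z <= `|complex.Re z| + `|complex.Im z|.
Proof.
have H : normc ('i%C : C) = 1 by rewrite /Normc.normc /= expr0n /= add0r expr1n sqrtr1.
rewrite {1}(complexE z); apply: le_trans (le_normcD _ _) _.
by rewrite Normc.normcM !normc_real H mul1r.
Qed.

Definition seq_cauchy (u : nat -> C) :=
  forall e, 0 < e -> exists N, forall n m, (N <= n)%N -> (N <= m)%N -> normc (u n - u m) < e.
Definition seq_lim (u : nat -> C) (l : C) :=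
  forall e, 0 < e -> exists N, forall n, (N <= n)%N -> normc (u n - l) < e.

Lemma real_cauchy_lim (u : nat -> R) :
  (forall e, 0 < e -> exists N, forall n m, (N <= n)%N -> (N <= m)%N -> `|u n - u m| < e) ->
  exists l, forall e, 0 < e -> exists N, forall n, (N <= n)%N -> `|u n - l| < e.
Proof.
move=> H; have cu : cvgn u.
  apply: cauchy_cvg; apply: cauchy_exP => e e0; have [N K] := H e e0.
  by exists (u N); exists N => // n /= Nn; rewrite /ball /=; apply: K.
exists (limn u) => e e0; have /cvgrPdist_lt/(_ _ e0)[N _ K] := cu.
by exists N => n Nn; rewrite distrC; exact: K.
Qed.

Lemma seq_cauchy_lim u : seq_cauchy u -> exists l, seq_lim u l.
Proof.
move=> H.
have [x Hx] : exists l, forall e, 0 < e -> exists N, forall n, (N <= n)%N -> `|complex.Re (u n) - l| < e.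
  apply: real_cauchy_lim => e /H[N K]; exists N => n m Nn Nm.
  by rewrite -raddfB; apply: le_lt_trans (normc_Re _) (K _ _ Nn Nm).
have [y Hy] : exists l, forall e, 0 < e -> exists N, forall n, (N <= n)%N -> `|complex.Im (u n) - l| < e.
  apply: real_cauchy_lim => e /H[N K]; exists N => n m Nn Nm.
  by rewrite -raddfB; apply: le_lt_trans (normc_Im _) (K _ _ Nn Nm).
exists (x +i* y)%C => e e0; have e2 : 0 < e / 2 by lra.
have [N1 K1] := Hx _ e2; have [N2 K2] := Hy _ e2.
exists (maxn N1 N2) => n; rewrite geq_max => /andP[/K1 L1 /K2 L2].
by apply: (le_lt_trans (normc_le_ReIm _)); rewrite !raddfB /=; lra.
Qed.

Lemma seq_lim_cauchy u l : seq_lim u l -> seq_cauchy u.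
Proof.
move=> H e e0; have /H[N K] : 0 < e / 2 by lra.
exists N => n m /K L1 /K L2; have := normc_triangle (u n) l (u m).
by rewrite (normc_distC l); lra.
Qed.

Lemma psumS a z n : psum a z n.+1 = a 0%N + z * psum (fun i => a i.+1) z n.
Proof.
rewrite /psum big_ord_recl /= expr0 mulr1 mulr_sumr; congr (_ + _).
by apply: eq_bigr => i _; rewrite exprS; ring.
Qed.

Lemma tay_shift a z v : z != 0 -> tay a z v -> tay (fun i => a i.+1) z ((v - a 0%N) / z).
Proof.
move=> z0 H e e0; have n0 : 0 < normc z by rewrite normc_gt0.
have [N K] := H (e * normc z) (mulr_gt0 e0 n0); exists N => n Nn.
have := K n.+1 (leqW Nn); rewrite psumS => L.
rewrite -(ltr_pM2r n0) -Normc.normcM.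
suff -> : (psum (fun i => a i.+1) z n - (v - a 0%N) / z) * z
  = a 0%N + z * psum (fun i => a i.+1) z n - v by [].
by field.
Qed.

(** At a point of modulus x <= 1/2 the terms after the constant one add up to at most 2 M x, so a
    small fixed x reads the constant coefficients off the values. The origin is excluded so that
    [coef_cauchy] can apply this to difference quotients. *)
Lemma coef0_cauchy M (a : nat -> nat -> C) (g : nat -> C -> C) :
  (forall N i, normc (a N i) <= M) ->
  (forall N z, 0 < normc z < 1 -> tay (a N) z (g N z)) ->
  (forall z, 0 < normc z < 1 -> seq_cauchy (fun N => g N z)) ->
  seq_cauchy (fun N => a N 0%N).
Proof.
move=> aM aT gC.
move=> e e0; have M0 : 0 <= M by apply: le_trans (aM 0%N 0%N); exact: normc_ge0.
(* This choice gives x <= 1/2 and 2 M x < e/4; two errors of that size and the e/2 obtained from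
   [gC] add up to less than e. *)
pose x := e / (8 * M + 8 + 2 * e).
have D0 : 0 < 8 * M + 8 + 2 * e by lra.
have x0 : 0 < x by rewrite divr_gt0.
have x2 : x <= 1 / 2 by rewrite ler_pdivrMr //; lra.
have Dx : 8 * M * x + 8 * x + 2 * e * x = e.
  by rewrite /x; field; lra.
clearbody x.
have ex0 : 0 < e * x by rewrite mulr_gt0.
have nx : normc (x%:C%C : C) = x by rewrite normc_real gtr0_norm.
have xr : 0 < normc (x%:C%C : C) < 1 by rewrite nx; lra.
have e2 : 0 < e / 2 by lra.
have [N K] := gC _ xr _ e2; exists N => n m Nn Nm.
have B i : normc (g i x%:C%C - a i 0%N) <= M * (2 * x).
  have /(_ 1%N) := tay_tail _ (aM i) _ (aT i _ xr).
  rewrite nx /psum big_ord1 expr0 mulr1 expr1 => H; apply: le_trans (H _) _; first lra.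
  rewrite ler_wpM2l // ler_pdivrMr; last lra.
  have x3 : 0 <= 1 / 2 - x by lra.
  by have := mulr_ge0 (ltW x0) x3; lra.
have := K n m Nn Nm; have := B n; have := B m.
have := normc_triangle (a n 0%N) (g n x%:C%C) (a m 0%N).
have := normc_triangle (g n x%:C%C) (g m x%:C%C) (a m 0%N).
rewrite (normc_distC (a n 0%N) (g n _)); lra.
Qed.

Lemma coef_cauchy M k (a : nat -> nat -> C) (g : nat -> C -> C) :
  (forall N i, normc (a N i) <= M) ->
  (forall N z, 0 < normc z < 1 -> tay (a N) z (g N z)) ->
  (forall z, 0 < normc z < 1 -> seq_cauchy (fun N => g N z)) ->
  seq_cauchy (fun N => a N k).
Proof.
elim: k a g => [|k IH] a g aM aT gC; first exact: coef0_cauchy aM aT gC.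
have C0 := coef0_cauchy aM aT gC.
(* Removing the constant coefficient and dividing by z shifts the coefficients down by one. *)
apply: (IH (fun N i => a N i.+1) (fun N z => (g N z - a N 0%N) / z)) => [N i|N z zr|z zr].
- exact: aM.
- by apply: tay_shift; [rewrite -normc_gt0; case/andP: zr|exact: aT].
move=> e e0; case/andP: (zr) => z0 _; have h : 0 < e * normc z / 2 by rewrite divr_gt0 ?mulr_gt0.
have [N1 K1] := gC _ zr _ h; have [N2 K2] := C0 _ h.
exists (maxn N1 N2) => n m; rewrite !geq_max => /andP[n1 n2] /andP[m1 m2].
rewrite -(ltr_pM2r z0) -Normc.normcM.
have -> : ((g n z - a n 0%N) / z - (g m z - a m 0%N) / z) * z = (g n z - g m z) - (a n 0%N - a m 0%N).
  by field; rewrite -normc_gt0.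
have := K1 _ _ n1 m1; have := K2 _ _ n2 m2; have := le_normcD (g n z - g m z) (- (a n 0%N - a m 0%N)).
rewrite normcN; lra.
Qed.

Lemma seq_lim_norm u l : seq_lim u l -> forall e, 0 < e -> exists N, forall n, (N <= n)%N ->
  normc l <= normc (u n) + e.
Proof.
move=> H e /H[N K]; exists N => n /K L; have := normc_sub_ge l (u n).
by rewrite normc_distC; lra.
Qed.

Lemma seq_limD u v l m : seq_lim u l -> seq_lim v m -> seq_lim (fun n => u n + v n) (l + m).
Proof.
move=> H K e e0; have e2 : 0 < e / 2 by lra.
have [N1 L1] := H _ e2; have [N2 L2] := K _ e2.
exists (maxn N1 N2) => n; rewrite geq_max => /andP[/L1 A /L2 B].
by rewrite opprD addrACA; apply: le_lt_trans (le_normcD _ _) _; lra.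
Qed.

Lemma seq_limZ (c : C) u l : seq_lim u l -> seq_lim (fun n => c * u n) (c * l).
Proof.
move=> H e e0; have [->|c0] := eqVneq c 0.
  by exists 0%N => n _; rewrite !mul0r subr0 normc0.
have n0 : 0 < normc c by rewrite normc_gt0.
have [N K] := H (e / normc c) (divr_gt0 e0 n0); exists N => n /K L.
by rewrite -mulrBr Normc.normcM mulrC -ltr_pdivlMr.
Qed.

Lemma seq_lim_sum (I : Type) (s : seq I) (u : I -> nat -> C) (l : I -> C) :
  (forall i, seq_lim (u i) (l i)) -> seq_lim (fun n => \sum_(i <- s) u i n) (\sum_(i <- s) l i).
Proof.
move=> H; elim: s => [|i s IH].
  by move=> e e0; exists 0%N => n _; rewrite !big_nil subrr normc0.
move=> e e0; rewrite big_cons; have [N K] := seq_limD (H i) IH e0.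
by exists N => n Nn; rewrite big_cons; exact: K.
Qed.

(* Weak compactness of the balls of H^2. *)
Lemma Hq_lim (g : nat -> C -> C) f q : (forall N, Hq (g N) q) ->
  (forall z, normc z < 1 -> seq_lim (fun N => g N z) (f z)) -> Hq f q.
Proof.
move=> gH gl; have {gH} [a Ha] := choice gH.
have aT N z : normc z < 1 -> tay (a N) z (g N z) by case: (Ha N) => H _; exact: H.
have aq N n : \sum_(k < n) normc (a N k) ^+ 2 <= q by case: (Ha N).
have aM N k : normc (a N k) <= Num.sqrt q by apply: coef_le.
have q0 : 0 <= q by have := aq 0%N 0%N; rewrite big_ord0.
have aC k : exists l, seq_lim (fun N => a N k) l.
  apply/seq_cauchy_lim/(@coef_cauchy (Num.sqrt q) k a g) => // [N z|z] /andP[_ z1].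
    exact: aT.
  exact/seq_lim_cauchy/gl.
have {aC} [b Hb] := choice aC.
exists b; split => [z z1 e e0|n].
  have z0 := normc_ge0 z.
  have D0 : 0 < 1 - normc z by lra.
  have S0 : 0 <= Num.sqrt q := sqrtr_ge0 q.
  have S1 : 0 < Num.sqrt q + 1 by lra.
  have h : 0 < e / 2 * (1 - normc z) / (Num.sqrt q + 1).
    by rewrite divr_gt0 // ?mulr_gt0 //; lra.
  have zr : 0 <= normc z < 1 by rewrite z0 z1.
  have [N K] := expr_small zr h; exists N => n /K L.
  have L' : Num.sqrt q * (normc z ^+ n / (1 - normc z)) <= e / 2.
    rewrite mulrA ler_pdivrMr //.
    move: L; rewrite ltr_pdivlMr // => L.
    have := exprn_ge0 n z0; lra.
  (* The tails beyond n are at most e/2 for all members of the sequence at once, so only the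
     convergence of the first n coefficients is needed. *)
  apply: (@le_lt_trans _ _ (e / 2)); last lra.
  apply: eps_le => d d0; have d2 : 0 < d / 2 by lra.
  have [N1 K1] := gl z z1 _ d2.
  have [N2 K2] : exists N, forall m, (N <= m)%N -> normc (psum (a m) z n - psum b z n) < d / 2.
    apply: (@seq_lim_sum _ _ (fun i m => a m (i : 'I_n) * z ^+ i) (fun i => b i * z ^+ i)) => // i.
    move=> e1 e10; have [N2 K2] := seq_limZ (z ^+ i) (Hb i) e10.
    by exists N2 => m /K2; rewrite ![z ^+ i * _]mulrC.
  pose m := maxn N1 N2.
  have := K1 m (leq_maxl _ _); have := K2 m (leq_maxr _ _).
  have := tay_tail n (aM m) z1 (aT m z z1).
  have := normc_triangle (psum b z n) (psum (a m) z n) (f z).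
  have := normc_triangle (psum (a m) z n) (g m z) (f z).
  rewrite (normc_distC (psum b z n) (psum (a m) z n)) (normc_distC (psum (a m) z n) (g m z)); lra.
apply: eps_le => d d0.
pose T := \sum_(k < n) (2 * Num.sqrt q + 1) + 1.
have S0 : 0 <= Num.sqrt q := sqrtr_ge0 q.
have T0 : 0 < T.
  by rewrite /T ltr_wpDl // sumr_ge0 // => i _; lra.
have [e [e0 e1 eT]] : exists e, [/\ 0 < e, e <= 1 & e * T <= d].
  exists (Num.min 1 (d / T)); split.
  - by rewrite lt_min ltr01 divr_gt0.
  - by rewrite ge_min lexx.
  - by rewrite -ler_pdivlMr // ge_min lexx orbT.
have [N K] : exists N, forall k, (k < n)%N -> normc (b k) <= normc (a N k) + e.
  have /choice[Nk HN] : forall k, exists N, forall m, (N <= m)%N -> normc (b k) <= normc (a m k) + e.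
    by move=> k; exact: seq_lim_norm (Hb k) _ e0.
  exists (\max_(k < n) Nk k) => k kn; apply: HN.
  exact: (@leq_bigmax _ (fun k : 'I_n => Nk k) (Ordinal kn)).
apply: le_trans (lerD (aq N n) eT).
apply: (@le_trans _ _ (\sum_(k < n) (normc (a N k) ^+ 2 + e * (2 * Num.sqrt q + 1)))).
  apply: ler_sum => i _; have := K i (ltn_ord i); have := aM N i.
  have := normc_ge0 (b i); have := normc_ge0 (a N i).
  set x := normc (a N i); set y := normc (b i) => x0 y0 xq yx.
  apply: (@le_trans _ _ ((x + e) ^+ 2)); first by rewrite lerXn2r // nnegrE; lra.
  have -> : (x + e) ^+ 2 = x ^+ 2 + e * (2 * x + e) by ring.
  by rewrite lerD2l ler_wpM2l //; lra.
rewrite big_split /= lerD2l -mulr_sumr ler_wpM2l ?(ltW e0) // /T; lra.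
Qed.
End Limits.

(** * Total variation of generating functions *)

Section PolyL1.
Variable R : realType.
Implicit Types (p q r : {poly R}).

(** Only the first M coefficients are seen: power series such as u xi^n are represented by
    polynomials modulo X^M, with bounds uniform in M. *)
Definition l1 M p : R := \sum_(i < M) `|p`_i|.
Definition eqm M p q := forall i, (i < M)%N -> p`_i = q`_i.
Definition pnn p := forall i, 0 <= p`_i.

Lemma l1_ge0 M p : 0 <= l1 M p.
Proof. by rewrite sumr_ge0 // => i _; exact: normr_ge0. Qed.

Lemma l1_eqm M p q : eqm M p q -> l1 M p = l1 M q.
Proof. by move=> H; apply: eq_bigr => i _; rewrite H. Qed.

Lemma l1D M p q : l1 M (p + q) <= l1 M p + l1 M q.
Proof. by rewrite /l1 -big_split; apply: ler_sum => i _; rewrite coefD; exact: ler_normD. Qed.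

Lemma l1Z M (c : R) p : l1 M (c *: p) = `|c| * l1 M p.
Proof. by rewrite /l1 mulr_sumr; apply: eq_bigr => i _; rewrite coefZ normrM. Qed.

Lemma l1_sum M (I : Type) (s : seq I) (F : I -> {poly R}) :
  l1 M (\sum_(i <- s) F i) <= \sum_(i <- s) l1 M (F i).
Proof.
elim: s => [|i s IH]; last by rewrite !big_cons; apply: le_trans (l1D _ _ _) _; rewrite lerD2l.
by rewrite !big_nil /l1 big1 // => i _; rewrite coef0 normr0.
Qed.

Lemma pnn_sum_le M p : pnn p -> \sum_(i < M) p`_i <= p.[1].
Proof.
move=> H; rewrite horner_coef; under [leRHS]eq_bigr do rewrite expr1n mulr1.
have [h|h] := leqP M (size p).
  rewrite -!(big_mkord xpredT (fun i => p`_i)) (big_cat_nat (leq0n _) h) //=.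
  by rewrite lerDl sumr_ge0.
rewrite -!(big_mkord xpredT (fun i => p`_i)) (big_cat_nat (leq0n _) (ltnW h)) //=.
rewrite gerDl big_nat_cond big1 // => i /andP[/andP[h1 _] _].
by rewrite nth_default.
Qed.

Lemma pnnM p q : pnn p -> pnn q -> pnn (p * q).
Proof. by move=> H K i; rewrite coefM sumr_ge0 // => j _; exact: mulr_ge0. Qed.

Lemma pnnX p n : pnn p -> pnn (p ^+ n).
Proof.
move=> H; elim: n => [|n IH]; last by rewrite exprS; exact: pnnM.
by move=> i; rewrite expr0 coef1; case: (i == 0%N).
Qed.

Lemma pnn_l1 M p : pnn p -> l1 M p = \sum_(i < M) p`_i.
Proof. by move=> H; apply: eq_bigr => i _; rewrite ger0_norm. Qed.

Lemma l1M M p q : l1 M (p * q) <= l1 M p * l1 M q.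
Proof.
pose P := \poly_(i < M) `|p`_i|; pose Q := \poly_(i < M) `|q`_i|.
have PN (s : {poly R}) : pnn (\poly_(i < M) `|s`_i| : {poly R}).
  by move=> i; rewrite coef_poly; case: ifP.
have P1 (s : {poly R}) : (\poly_(i < M) `|s`_i| : {poly R}).[1] = l1 M s.
  by rewrite horner_poly; apply: eq_bigr => i _; rewrite expr1n mulr1.
rewrite -(P1 p) -(P1 q) -hornerM /l1; apply: le_trans (pnn_sum_le M (pnnM (PN p) (PN q))).
apply: ler_sum => i _; rewrite !coefM; apply: (le_trans (ler_norm_sum _ _ _)).
apply: ler_sum => j _; rewrite !coef_poly normrM.
have iM := ltn_ord i; have ji := ltn_ord j.
have -> : (j < M)%N by lia.
by have -> : (i - j < M)%N by lia.
Qed.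

Lemma eqmM M p p' q q' : eqm M p p' -> eqm M q q' -> eqm M (p * q) (p' * q').
Proof.
move=> H K i iM; rewrite !coefM; apply: eq_bigr => j _.
by have ji := ltn_ord j; rewrite H ?K //; lia.
Qed.

Lemma eqmD M p p' q q' : eqm M p p' -> eqm M q q' -> eqm M (p + q) (p' + q').
Proof. by move=> H K i iM; rewrite !coefD H // K. Qed.

Lemma eqm_refl M p : eqm M p p. Proof. by []. Qed.

Lemma eqm_trans M p q r : eqm M p q -> eqm M q r -> eqm M p r.
Proof. by move=> H K i iM; rewrite H // K. Qed.

Lemma eqm_sym M p q : eqm M p q -> eqm M q p.
Proof. by move=> H i iM; rewrite H. Qed.

Lemma coef_lin (c d : R) p k :
  ((c%:P + d *: 'X) * p)`_k = c * p`_k + d * (if k is k'.+1 then p`_k' else 0).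
Proof.
rewrite mulrDl coefD coefCM -scalerAl coefZ coefXM.
by case: k => [|k] /=; rewrite ?mulr0.
Qed.

Lemma coef_1subX p k : ((1 - 'X) * p)`_k = p`_k - (if k is k'.+1 then p`_k' else 0).
Proof.
have -> : 1 - 'X = (1 : R)%:P + (-1) *: 'X by rewrite scaleN1r polyC1.
by rewrite coef_lin mul1r mulN1r.
Qed.

Lemma sum_1subX p k : \sum_(i < k.+1) ((1 - 'X) * p)`_i = p`_k.
Proof.
elim: k => [|k IH]; first by rewrite big_ord1 coef_1subX subr0.
by rewrite big_ord_recr /= IH coef_1subX addrC subrK.
Qed.

(* Renewal bound: column [k] of the Galton-Watson matrix of [th] sums the
   coefficients of the Green function [1 / (1 - th)]. *)
Lemma pgf_col (th q : {poly R}) : pnn th -> pnn q -> 0 < q`_0 -> 1 - th = (1 - 'X) * q ->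
  forall N k, \sum_(n < N) (th ^+ n)`_k <= (q`_0)^-1.
Proof.
move=> tn qn q0 H N k.
pose S := \sum_(n < N) th ^+ n.
have S1 : (1 - 'X) * (q * S) = 1 - th ^+ N.
  by rewrite mulrA -H -[in RHS](expr1n _ N) subrXX; congr (_ * _); apply: eq_bigr => i _; rewrite expr1n mul1r.
(* By [sum_1subX] this coefficient is a partial sum of the coefficients of 1 - th^N, and those of
   th^N are nonnegative. *)
have Sk : (q * S)`_k <= 1.
  rewrite -sum_1subX S1 big_ord_recl coefB coef1 /=.
  have := pnnX N tn 0%N; set x := (th ^+ N)`_0 => x0.
  suff : \sum_(i < k) (1 - th ^+ N)`_(bump 0 i) <= 0 by lra.
  by apply: sumr_le0 => i _; rewrite coefB coef1 /= sub0r oppr_le0 pnnX.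
have Sc j : S`_j = \sum_(n < N) (th ^+ n)`_j by rewrite /S coef_sum.
have Sn : pnn S by move=> j; rewrite Sc sumr_ge0 // => i _; exact: pnnX.
rewrite -Sc -[leRHS]mul1r ler_pdivlMr // mulrC; apply: le_trans Sk.
by rewrite coefM big_ord_recl /= subn0 lerDl sumr_ge0 // => i _; exact: mulr_ge0.
Qed.

Lemma pgf_row (th q : {poly R}) : pnn th -> 1 - th = (1 - 'X) * q ->
  forall M n, \sum_(k < M) (th ^+ n)`_k <= 1.
Proof.
move=> tn H M n; apply: le_trans (pnn_sum_le M (pnnX n tn)) _.
have : (1 - th).[1] = 0 by rewrite H !hornerE subrr mul0r.
rewrite hornerD hornerN hornerC => /eqP; rewrite subr_eq0 => /eqP E.
by rewrite horner_exp -E expr1n.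
Qed.

Definition bino (be : R) : {poly R} := (1 - be)%:P + be *: 'X.

Lemma bino_pnn be : 0 <= be <= 1 -> pnn (bino be).
Proof.
move=> /andP[h1 h2] i; rewrite coefD coefC coefZ coefX.
by case: i => [|[|i]] /=; rewrite ?mulr0 ?mulr1 ?addr0 ?add0r //; lra.
Qed.

Lemma bino_1sub be : 1 - bino be = (1 - 'X) * be%:P.
Proof. by rewrite /bino polyCB polyC1 -mul_polyC; ring. Qed.

Lemma size_bino be n : (size (bino be ^+ n) <= n.+1)%N.
Proof.
have : (size (bino be) <= 2)%N.
  apply: leq_trans (size_polyD _ _) _; rewrite geq_max (leq_trans (size_polyC_leq1 _)) //=.
  by apply: leq_trans (size_scale_leq _ _) _; rewrite size_polyX.
move=> H; apply: leq_trans (size_poly_exp_leq _ _) _; rewrite ltnS.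
by case: (size (bino be)) H => [|[|[|]]] //= _; rewrite ?mul0n ?mul1n.
Qed.

(** Variance of the binomial law. When one Bernoulli trial is added, the terms linear in k - n be
    cancel and the variance grows by be (1 - be). *)
Lemma bino_var be n :
  \sum_(k < n.+1) (bino be ^+ n)`_k * (k%:R - n%:R * be) ^+ 2 = n%:R * (be * (1 - be)).
Proof.
have tot m : \sum_(k < m.+1) (bino be ^+ m)`_k = 1.
  have := horner_coef_wide 1 (size_bino be m).
  rewrite horner_exp !hornerE subrK expr1n => ->.
  by apply: eq_bigr => i _; rewrite expr1n mulr1.
have top m : (bino be ^+ m)`_m.+1 = 0 by rewrite nth_default // size_bino.
elim: n => [|n IH]; first by rewrite big_ord1 !mul0r subrr expr0n mulr0.
under eq_bigr do rewrite exprS coef_lin mulrDl.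
rewrite big_split /= big_ord_recr /= top mulr0 mul0r addr0 [X in _ + X]big_ord_recl /=.
rewrite mulr0 mul0r add0r -big_split /=.
transitivity (\sum_(k < n.+1) ((bino be ^+ n)`_k * (k%:R - n%:R * be) ^+ 2 + (bino be ^+ n)`_k * (be * (1 - be)))).
  apply: eq_bigr => k _; rewrite /bump /= add1n -natr1 -[k.+1%:R]natr1.
  set x := (bino be ^+ n)`_k; ring.
by rewrite big_split /= IH -mulr_suml tot -[in RHS]natr1; ring.
Qed.

(** Comes from the derivative of bino^(m+1), which is (m+1) be bino^m. The discrete derivative of a
    binomial law is thereby the law with one more trial times its centred variable, up to sign and
    normalization. *)
Lemma bino_diff be m k :
  (m.+1%:R * (be * (1 - be))) * ((1 - 'X) * bino be ^+ m)`_k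
  = (bino be ^+ m.+1)`_k * (m.+1%:R * be - k%:R).
Proof.
have D : (bino be)^`() = be%:P.
  by rewrite /bino derivD derivC derivZ derivX add0r alg_polyC.
have K j : (bino be ^+ m.+1)`_j.+1 * j.+1%:R = m.+1%:R * be * (bino be ^+ m)`_j.
  rewrite mulr_natr -coef_deriv deriv_exp D coefMn coefCM.
  by rewrite -[LHS]mulr_natr; ring.
rewrite coef_1subX [in RHS]exprS coef_lin.
case: k => [|k]; first by rewrite !subr0 mulr0 addr0; ring.
have := K k; rewrite exprS coef_lin.
set x := (bino be ^+ m)`_k.+1; set y := (bino be ^+ m)`_k => E.
transitivity (m.+1%:R * be * ((1 - be) * x + be * y) - be * m.+1%:R * y); first by ring.
have -> : be * m.+1%:R * y = ((1 - be) * x + be * y) * k.+1%:R by rewrite E; ring.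
by ring.
Qed.

Lemma weighted_CS (I : finType) (k t : I -> R) : (forall i, 0 <= k i) ->
  (\sum_i k i * t i) ^+ 2 <= (\sum_i k i) * \sum_i k i * t i ^+ 2.
Proof.
move=> k0; set K := \sum_i k i; set L := \sum_i k i * t i; set Q := \sum_i _ * _ ^+ 2.
have K0 : 0 <= K by apply: sumr_ge0.
have H (x : R) : 0 <= Q - 2 * x * L + x ^+ 2 * K.
  have -> : Q - 2 * x * L + x ^+ 2 * K = \sum_i k i * (t i - x) ^+ 2.
    rewrite /Q /L /K !mulr_sumr -sumrB -big_split /=; apply: eq_bigr => i _; ring.
  by apply: sumr_ge0 => i _; rewrite mulr_ge0 // sqr_ge0.
have [K1|] := ltrP 0 K.
  have := H (L / K); have -> : Q - 2 * (L / K) * L + (L / K) ^+ 2 * K = Q - L ^+ 2 / K by field; lra.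
  by rewrite subr_ge0 ler_pdivrMr // mulrC.
move=> K1; have KE : K = 0 by lra.
have k00 i : k i = 0.
  apply/eqP; rewrite eq_le k0 andbT -KE /K (bigD1 i) //= lerDl.
  exact: sumr_ge0.
by rewrite /L big1 ?expr0n ?KE ?mul0r // => i _; rewrite k00 mul0r.
Qed.

(** By [bino_diff] the l1 norm is the first absolute centred moment of a binomial law divided by its
    variance v. Cauchy-Schwarz bounds the squared moment by v, leaving v / v^2. *)
Lemma bino_smooth be M m : 0 < be < 1 ->
  l1 M ((1 - 'X) * bino be ^+ m) ^+ 2 <= (m.+1%:R * (be * (1 - be)))^-1.
Proof.
move=> /andP[b0 b1]; set v := m.+1%:R * _.
have v0 : 0 < v by rewrite /v !mulr_gt0 ?ltr0n //; lra.
have bn : pnn (bino be) by apply: bino_pnn; lra.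
have E k : `|((1 - 'X) * bino be ^+ m)`_k| = v^-1 * ((bino be ^+ m.+1)`_k * `|m.+1%:R * be - k%:R|).
  rewrite -[in RHS](ger0_norm (pnnX m.+1 bn k)) -normrM -bino_diff normrM (gtr0_norm v0).
  by rewrite mulKf ?gt_eqF.
rewrite /l1; under eq_bigr do rewrite E.
rewrite -mulr_sumr exprMn.
have H := @weighted_CS 'I_M (fun k => (bino be ^+ m.+1)`_k) (fun k => `|m.+1%:R * be - k%:R|) (fun k => pnnX m.+1 bn k).
have H1 := pgf_row bn (bino_1sub be) M m.+1.
have H2 : \sum_(k < M) (bino be ^+ m.+1)`_k * `|m.+1%:R * be - k%:R| ^+ 2 <= v.
  have -> : v = \sum_(k < m.+2) (bino be ^+ m.+1)`_k * (k%:R - m.+1%:R * be) ^+ 2 by rewrite bino_var.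
  under eq_bigr do rewrite real_normK ?num_real // -sqrrN opprB.
  have Z k : (m.+2 <= k)%N -> (bino be ^+ m.+1)`_k * (k%:R - m.+1%:R * be) ^+ 2 = 0.
    by move=> h; rewrite nth_default ?mul0r // (leq_trans (size_bino _ _)).
  rewrite -!(big_mkord xpredT (fun k => (bino be ^+ m.+1)`_k * (k%:R - m.+1%:R * be) ^+ 2)).
  have [h|h] := leqP M m.+2.
    rewrite (big_cat_nat (leq0n _) h) //= lerDl sumr_ge0 // => i _.
    by rewrite mulr_ge0 ?sqr_ge0 // pnnX.
  rewrite (big_cat_nat (leq0n _) (ltnW h)) //= gerDl big_nat_cond big1 // => i /andP[/andP[h1 _] _].
  exact: Z.
have {}H : (\sum_(i < M) (bino be ^+ m.+1)`_i * `|m.+1%:R * be - i%:R|) ^+ 2 <= v.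
  apply: le_trans H _; rewrite -[leRHS]mul1r; apply: ler_pM => //.
    by apply: sumr_ge0 => i _; exact: pnnX.
  by apply: sumr_ge0 => i _; rewrite mulr_ge0 ?sqr_ge0 // pnnX.
have vi : 0 < v^-1 by rewrite invr_gt0.
apply: (@le_trans _ _ (v^-1 ^+ 2 * v)); first by rewrite ler_wpM2l // sqr_ge0.
by rewrite expr2 -mulrA mulVf ?mulr1 // gt_eqF.
Qed.

End PolyL1.

(** * The l1 distance between Phi^n and u xi^n *)

Section PhiEstimate.
Variable R : realType.
Variable a : R.
Hypothesis a_gt0 : 0 < a.
Hypothesis a_le : a <= 1 / 4.

Definition Phi : {poly R} := 'X + a *: (1 - 'X) ^+ 2.

Lemma Phi_1sub : 1 - Phi = (1 - 'X) * ((1 - a)%:P + a *: 'X).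
Proof. by rewrite /Phi polyCB polyC1 -!mul_polyC; ring. Qed.

Lemma PhiE : Phi = a%:P + (1 - 2 * a) *: 'X + a *: 'X^2.
Proof. by rewrite /Phi -!mul_polyC polyCB polyCM polyC1 (_ : 2%:P = 2) //; ring. Qed.

Lemma Phi_pnn : pnn Phi.
Proof.
move: a_gt0 a_le => a0 a1.
move=> i; rewrite PhiE !coefD !coefZ coefC coefX coefXn.
by case: i => [|[|[|i]]] /=; rewrite ?mulr0 ?mulr1 ?addr0 ?add0r //; lra.
Qed.

Lemma lin_pnn (c d : R) : 0 <= c -> 0 <= d -> pnn (c%:P + d *: 'X).
Proof.
move=> c0 d0 i; rewrite coefD coefC coefZ coefX.
by case: i => [|[|i]] /=; rewrite ?mulr0 ?mulr1 ?addr0 ?add0r //; lra.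
Qed.

(** The quadratic be (1 - be) = a has a root in (0, 1) because a <= 1/4. So Phi^j is the law of a
    sum of 2j independent Bernoulli variables, to which the binomial estimates apply. *)
Lemma Phi_fact : exists2 be : R, 0 < be < 1 /\ be * (1 - be) = a & Phi = bino be * bino (1 - be).
Proof.
have h : 0 <= 1 - 4 * a by move: a_le; lra.
pose s := Num.sqrt (1 - 4 * a).
have s2 : s ^+ 2 = 1 - 4 * a by rewrite sqr_sqrtr.
have s0 : 0 <= s := sqrtr_ge0 _.
clearbody s; move: a_gt0 => a0.
have s1 : s < 1 by rewrite ltNge; apply/negP => s1; nra.
have E : (1 - s) / 2 * (1 - (1 - s) / 2) = a by move: s2; rewrite expr2; lra.
exists ((1 - s) / 2); first by split; [lra|].
move: ((1 - s) / 2) E => b Eb; rewrite /Phi /bino -Eb.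
by rewrite -!mul_polyC !(polyCM, polyCB) polyC1; ring.
Qed.

Lemma half_bounds j :
  [/\ j = (j./2 + (j - j./2))%N, (j.+1 <= (j./2).+1.*2)%N & (j.+1 <= (j - j./2).+1.*2)%N].
Proof. split; lia. Qed.

(** Each factor 1 - X is given to a separate binomial power, at the cost of one [bino_smooth] bound:
    with h = j/2 the powers are bino be^h, bino be^(j-h) and bino (1 - be)^j. Halving j for two of
    them produces the factor 2. *)
Lemma Phi_smooth M j :
  l1 M ((1 - 'X) ^+ 3 * Phi ^+ j) <= 2 / (a * Num.sqrt a) * (j.+1%:R * Num.sqrt j.+1%:R)^-1.
Proof.
move: a_gt0 => a0.
have [be [b01 bea] E] := Phi_fact.
have b01' : 0 < 1 - be < 1 by lra.
have bea' : (1 - be) * (1 - (1 - be)) = a by rewrite -bea; ring.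
pose h := j./2; pose h' := (j - h)%N.
have [jE _ _] := half_bounds j; rewrite -/h -/h' in jE.
have sa : 0 < Num.sqrt a by rewrite sqrtr_gt0.
have B1 (b : R) m : 0 < b < 1 -> b * (1 - b) = a ->
  l1 M ((1 - 'X) * bino b ^+ m) <= (Num.sqrt a * Num.sqrt m.+1%:R)^-1.
  move=> hb hba; have := bino_smooth M m hb; rewrite hba => H.
  have m0 : (0 : R) < m.+1%:R by rewrite ltr0n.
  have sm : 0 < Num.sqrt (m.+1%:R : R) by rewrite sqrtr_gt0.
  rewrite -(@ler_pXn2r _ 2) ?nnegrE ?l1_ge0 ?invr_ge0 ?mulr_ge0 ?sqrtr_ge0 //.
  by rewrite exprVn exprMn !sqr_sqrtr ?ler0n ?(ltW a0) // [a * _]mulrC.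
have -> : (1 - 'X) ^+ 3 * Phi ^+ j = ((1 - 'X) * bino be ^+ h) * ((1 - 'X) * bino be ^+ h') *
   ((1 - 'X) * bino (1 - be) ^+ j).
  by rewrite E exprMn {1}jE exprD; ring.
apply: le_trans (l1M _ _ _) _.
have K1 := B1 _ h b01 bea; have K2 := B1 _ h' b01 bea; have K3 := B1 _ j b01' bea'.
have K4 := l1M M ((1 - 'X) * bino be ^+ h) ((1 - 'X) * bino be ^+ h').
have K5 : l1 M ((1 - 'X) * bino be ^+ h) * l1 M ((1 - 'X) * bino be ^+ h') <=
   (a * (Num.sqrt h.+1%:R * Num.sqrt h'.+1%:R))^-1.
  apply: le_trans (ler_pM (l1_ge0 _ _) (l1_ge0 _ _) K1 K2) _.
  rewrite -invfM -{3}(sqr_sqrtr (ltW a0)) expr2.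
  by rewrite (_ : Num.sqrt a * _ * _ = Num.sqrt a * Num.sqrt a * (Num.sqrt h.+1%:R * Num.sqrt h'.+1%:R)) //; ring.
have K6 : (j.+1%:R : R) / 2 <= Num.sqrt h.+1%:R * Num.sqrt h'.+1%:R.
  have G m : (j.+1 <= m.*2)%N -> Num.sqrt (j.+1%:R / 2 : R) <= Num.sqrt m%:R.
    by move=> hm; rewrite ler_wsqrtr // ler_pdivrMr // -natrM ler_nat muln2.
  have -> : (j.+1%:R : R) / 2 = Num.sqrt (j.+1%:R / 2) * Num.sqrt (j.+1%:R / 2).
    by rewrite -expr2 sqr_sqrtr // divr_ge0 ?ler0n.
  have [_ g1 g2] := half_bounds j.
  exact: ler_pM (sqrtr_ge0 _) (sqrtr_ge0 _) (G _ g1) (G _ g2).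
have j0 : (0 : R) < j.+1%:R by rewrite ltr0n.
have K7 : (a * (Num.sqrt h.+1%:R * Num.sqrt h'.+1%:R))^-1 <= (a * (j.+1%:R / 2))^-1.
  rewrite lef_pV2 ?posrE ?mulr_gt0 ?sqrtr_gt0 ?ltr0n // ?ler_pM2l // .
apply: le_trans (ler_pM (l1_ge0 _ _) (l1_ge0 _ _) (le_trans K4 (le_trans K5 K7)) K3) _.
rewrite le_eqVlt; apply/orP; left; apply/eqP.
have sj : 0 < Num.sqrt (j.+1%:R : R) by rewrite sqrtr_gt0.
by field; rewrite !gt_eqF //.
Qed.

Lemma sum_3half n : \sum_(j < n) ((j.+1%:R : R) * Num.sqrt j.+1%:R)^-1 <= 3.
Proof.
(* The subtracted term bounds the tail of the series, as in the integral test, and makes the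
   induction go through; with 3 the case of a single term is an equality. *)
suff : \sum_(j < n.+1) ((j.+1%:R : R) * Num.sqrt j.+1%:R)^-1 <= 3 - 2 / Num.sqrt n.+1%:R.
  have s0 : 0 < Num.sqrt (n.+1%:R : R) by rewrite sqrtr_gt0 ltr0n.
  rewrite big_ord_recr /=; set S := \sum_(j < n) _; set x := (_ * _)^-1.
  have : 0 <= x by rewrite invr_ge0 mulr_ge0 ?ler0n ?sqrtr_ge0.
  have : 0 < 2 / Num.sqrt (n.+1%:R : R) by rewrite divr_gt0.
  lra.
elim: n => [|n IH]; first by rewrite big_ord1 sqrtr1 mulr1 invr1; lra.
rewrite big_ord_recr /=; apply: le_trans (lerD IH (lexx _)) _.
have n0 : (0 : R) < n.+1%:R by rewrite ltr0n.
set x := Num.sqrt n.+1%:R; set y := Num.sqrt n.+2%:R.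
have x0 : 0 < x by rewrite sqrtr_gt0.
have y0 : 0 < y by rewrite sqrtr_gt0 ltr0n.
have x2 : x ^+ 2 = n.+1%:R by rewrite sqr_sqrtr ?ler0n.
have y2 : y ^+ 2 = n.+2%:R by rewrite sqr_sqrtr ?ler0n.
have E : y ^+ 2 = x ^+ 2 + 1 by rewrite x2 y2 -natr1.
rewrite -y2; clearbody x y.
have xy : x <= y by rewrite leNgt; apply/negP => h; nra.
have xye : (y - x) * (y + x) = 1 by rewrite -subr_sqr E; ring.
have -> : 3 - 2 / x + (y ^+ 2 * y)^-1 = 3 - 2 / y - (2 / (x * y * (y + x)) * ((y - x) * (y + x)) - (y ^+ 2 * y)^-1).
  by field; rewrite !gt_eqF //; lra.
rewrite xye mulr1 gerBl subr_ge0 -[leLHS]mul1r ler_pdivrMr ?mulr_gt0 ?exprn_gt0 //.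
have D0 : 0 < x * y * (y + x) by rewrite !mulr_gt0 //; lra.
rewrite mulrAC ler_pdivlMr // mul1r.
have : 0 <= (y - x) * (y * (2 * y + x)) by rewrite mulr_ge0 // ?mulr_ge0 //; lra.
lra.
Qed.

(** Read off from u = 1/(1 + a(1 - z)) = sg/(1 - bb z). The adjoint of composition with bb + sg z
    sends f to f(zeta)/(1 - bb z), where zeta = sg z/(1 - bb z), and bb + sg zeta = xi. This is why
    u f(xi) is sg times the adjoint after the composition. *)
Definition sg := (1 + a)^-1.
Definition bb := a / (1 + a).

Lemma sg_bb : [/\ 0 < sg, 0 < bb, bb = 1 - sg, bb <= a & sg * (1 + a) = 1].
Proof.
move: a_gt0 => a0; have h : 0 < 1 + a by lra.
split; rewrite /sg /bb ?invr_gt0 ?divr_gt0 //.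
- by field; lra.
- by rewrite ler_pdivrMr //; nra.
- by rewrite mulVf // gt_eqF.
Qed.

(* [A k n] is the matrix of composition with [bb + sg z]; the positive
   operator is [sg * A^T A], whose column [n] is [V M n] modulo [X ^ M]. *)
Definition A k n : R := (bino sg ^+ n)`_k.
Definition Pmx M m n : R := sg * \sum_(k < M) A k m * A k n.
Definition V M n : {poly R} := \poly_(m < M) Pmx M m n.
(** The expansion of u = sg/(1 - bb z) modulo X^M. *)
Definition U M : {poly R} := \poly_(m < M) (sg * bb ^+ m).

Lemma A_ge0 k n : 0 <= A k n.
Proof. by apply/pnnX/bino_pnn; case: sg_bb => *; lra. Qed.

Lemma A_rec k n : A k n.+1 = bb * A k n + sg * (if k is k'.+1 then A k' n else 0).
Proof. by rewrite /A exprS coef_lin; case: sg_bb => _ _ <-. Qed.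

Lemma A_row M n : \sum_(k < M) A k n <= 1.
Proof. by apply: pgf_row (bino_1sub sg) M n; apply: bino_pnn; case: sg_bb => *; lra. Qed.

Lemma A_col N k : \sum_(n < N) A k n <= sg^-1.
Proof.
have [s0 b0 bs _ _] := sg_bb.
have := @pgf_col R (bino sg) (sg%:P) _ _ _ (bino_1sub sg) N k.
rewrite coefC /=; apply => //; first by apply: bino_pnn; lra.
by move=> i; rewrite coefC; case: i => [|i] /=; lra.
Qed.

Lemma Pmx_ge0 M m n : 0 <= Pmx M m n.
Proof.
have [s0 _ _ _ _] := sg_bb.
by rewrite /Pmx mulr_ge0 ?(ltW s0) // sumr_ge0 // => i _; rewrite mulr_ge0 ?A_ge0.
Qed.

Lemma Pmx_sym M m n : Pmx M m n = Pmx M n m.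
Proof. by rewrite /Pmx; congr (_ * _); apply: eq_bigr => i _; rewrite mulrC. Qed.

Lemma Pmx_row M N n : \sum_(m < N) Pmx M m n <= 1.
Proof.
have [s0 _ _ _ _] := sg_bb.
rewrite /Pmx -mulr_sumr exchange_big /=.
rewrite -[leRHS](mulfV (lt0r_neq0 s0)) ler_pM2l //.
apply: (@le_trans _ _ (\sum_(k < M) sg^-1 * A k n)).
  by apply: ler_sum => i _; rewrite -mulr_suml ler_wpM2r ?A_ge0 // A_col.
have si : 0 <= sg^-1 by rewrite invr_ge0 (ltW s0).
by rewrite -mulr_sumr -[leRHS]mulr1; apply: ler_wpM2l => //; exact: A_row.
Qed.

Lemma A_shift M m n : (m.+1 < M)%N -> \sum_(k < M) A k m * A k n =
  \sum_(k < M) (if k : nat is k'.+1 then A k' m * A k' n else 0).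
Proof.
case: M => [//|M] mM; rewrite big_ord_recr big_ord_recl /= add0r.
rewrite (_ : A M m = 0) ?mul0r ?addr0 //.
by rewrite /A nth_default // (leq_trans (size_bino _ _)).
Qed.

(** Applying the recursion of [A] in both factors of A^T A gives, coefficientwise, (1 - bb z) u
    xi^(n+1) = (bb + (1 - 2 bb) z) u xi^n. It is the only way in which xi enters; no power series is
    composed. *)
Lemma Pmx_rec M m n : (m < M)%N ->
  Pmx M m n.+1 - bb * (if m is m'.+1 then Pmx M m' n.+1 else 0) =
  bb * Pmx M m n + (1 - 2 * bb) * (if m is m'.+1 then Pmx M m' n else 0).
Proof.
have [_ _ bs _ _] := sg_bb.
pose Rm m n := sg * \sum_(k < M) A k m * (if k : nat is k'.+1 then A k' n else 0).
have P1 i : Pmx M i n.+1 = bb * Pmx M i n + sg * Rm i n.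
  rewrite /Pmx /Rm mulrCA [sg * (sg * _)]mulrCA -mulrDr; congr (_ * _).
  rewrite !mulr_sumr -big_split; apply: eq_bigr => k _ /=.
  by rewrite A_rec mulrDr; congr (_ + _); exact: mulrCA.
case: m => [|m] mM.
  rewrite !mulr0 subr0 addr0 P1 /Rm big1 ?mulr0 ?addr0 // => k _.
  by rewrite /A expr0 coef1; case: (k : nat) => [|j] /=; rewrite ?mulr0 ?mul0r.
have R1 : Rm m.+1 n = bb * Rm m n + sg * Pmx M m n.
  rewrite /Pmx /Rm mulrCA [sg * (sg * _)]mulrCA -mulrDr; congr (_ * _).
  rewrite (A_shift n mM).
  rewrite !mulr_sumr -big_split; apply: eq_bigr => k _ /=; rewrite A_rec.
  by case: (k : nat) => [|j]; rewrite ?mulr0 ?addr0 //; ring.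
by rewrite !P1 R1 bs; ring.
Qed.

Lemma eqm_scal M (c : R) p q : c != 0 -> eqm M (c%:P * p) (c%:P * q) -> eqm M p q.
Proof. by move=> c0 H i /H; rewrite !coefCM => /(mulfI c0). Qed.

Lemma V_rec M n : eqm M (((1 + a)%:P - a *: 'X) * V M n.+1) ((a%:P + (1 - a) *: 'X) * V M n).
Proof.
move: a_gt0 => a0; have [s0 b0 bs _ sa] := sg_bb.
apply: (@eqm_scal _ sg); first by rewrite gt_eqF.
move=> m mM; rewrite !mulrA.
have -> : sg%:P * ((1 + a)%:P - a *: 'X) = 1%:P + (- bb) *: 'X.
  rewrite mulrBr -polyCM sa -!mul_polyC mulrA -polyCM polyCN mulNr.
  by rewrite (_ : bb = sg * a) // /bb /sg mulrC.
have -> : sg%:P * (a%:P + (1 - a) *: 'X) = bb%:P + (1 - 2 * bb) *: 'X.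
  have -> : 1 - 2 * bb = sg * (1 - a) by rewrite /bb /sg; field; lra.
  by rewrite -!mul_polyC (_ : bb = sg * a) ?polyCM; [ring|rewrite /bb /sg mulrC].
rewrite !coef_lin !coef_poly mM mul1r mulNr.
have := Pmx_rec n mM; case: m mM => [|m] mM //.
by rewrite !coef_poly (ltnW mM).
Qed.

Lemma U_inv M : eqm M (U M * ((1 + a)%:P - a *: 'X)) 1.
Proof.
move: a_gt0 => a0; have [s0 b0 bs _ sa] := sg_bb.
move=> m mM; rewrite mulrC (_ : - (a *: 'X) = (- a) *: 'X); last by rewrite scaleNr.
rewrite coef_lin coef_poly mM coef1.
case: m mM => [|m] mM /=; first by rewrite mulr0 addr0 expr0 mulr1 mulrC sa.
rewrite coef_poly (ltnW mM) exprS /bb /sg; set x := _ ^+ m.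
by field; lra.
Qed.

Lemma U_l1 M : l1 M (U M) <= 1.
Proof.
have [s0 b0 bs _ _] := sg_bb.
have -> : l1 M (U M) = 1 - bb ^+ M.
  have -> : l1 M (U M) = sg * \sum_(i < M) bb ^+ i.
    rewrite mulr_sumr; apply: eq_bigr => i _; rewrite coef_poly ltn_ord ger0_norm //.
    by rewrite mulr_ge0 ?exprn_ge0 ?ltW.
  have -> : sg = 1 - bb by lra.
  by rewrite -[in RHS](expr1n _ M) subrXX; congr (_ * _); apply: eq_bigr => i _; rewrite expr1n mul1r.
by rewrite gerBl exprn_ge0 // ltW.
Qed.

Lemma U_1sub M : l1 M (1 - U M) <= 2 * a.
Proof.
have [s0 b0 bs ba _] := sg_bb.
case: M => [|M]; first by rewrite /l1 big_ord0; move: a_gt0; lra.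
rewrite /l1 big_ord_recl coefB coef1 coef_poly /= expr0 mulr1 -bs (gtr0_norm b0).
have -> : \sum_(i < M) `|(1 - U M.+1)`_(bump 0 i)| = bb * \sum_(i < M) sg * bb ^+ i.
  rewrite mulr_sumr; apply: eq_bigr => i _; rewrite coefB coef1 coef_poly /bump /= add1n ltnS ltn_ord.
  rewrite sub0r normrN ger0_norm ?exprS; first by ring.
  by rewrite !mulr_ge0 ?exprn_ge0 ?ltW.
have : \sum_(i < M) sg * bb ^+ i <= 1.
  apply: le_trans (U_l1 M); apply: ler_sum => i _.
  by rewrite coef_poly ltn_ord ler_norm.
by move=> h; have := ler_wpM2l (ltW b0) h; lra.
Qed.

Lemma V_l1 M n : l1 M (V M n) <= 1.
Proof.
apply: le_trans (Pmx_row M M n); apply: ler_sum => i _.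
by rewrite coef_poly ltn_ord ger0_norm // Pmx_ge0.
Qed.

Lemma V0 M : eqm M (V M 0) (U M).
Proof.
have [s0 b0 bs ba _] := sg_bb.
move=> m mM; rewrite !coef_poly mM /Pmx; congr (_ * _).
case: M mM => [//|M] mM; rewrite big_ord_recl big1 => [|i _]; last first.
  by rewrite /A expr0 coef1 mulr0.
rewrite /A expr0 coef1 mulr1 addr0.
elim: m {mM} => [|m IH]; first by rewrite !expr0 coef1.
by rewrite !exprS coef_lin mulr0 addr0 IH bs.
Qed.

Lemma V_step M n : eqm M (Phi * V M n - V M n.+1) (a ^+ 2 *: ((1 - 'X) ^+ 3 * (U M * V M n))).
Proof.
have H : eqm M (V M n.+1) (U M * ((a%:P + (1 - a) *: 'X) * V M n)).
  apply: eqm_trans (eqmM (eqm_refl (U M)) (@V_rec M n)).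
  rewrite mulrA -{1}[V M n.+1]mul1r; apply: eqmM => //.
  exact/eqm_sym/U_inv.
have H2 : eqm M (Phi * V M n) (U M * ((1 + a)%:P - a *: 'X) * (Phi * V M n)).
  rewrite -{1}[Phi * V M n]mul1r; apply: eqmM => //; exact/eqm_sym/U_inv.
(* After the factor U V_n is taken out, what remains is Phi ((1 + a) - a X) - (a + (1 - a) X) = a^2
   (1 - X)^3. *)
move=> i iM; rewrite coefB H // H2 // -coefB; congr (nth 0 (polyseq _) i).
rewrite /Phi -!mul_polyC polyCD !polyCM polyCB polyC1; ring.
Qed.

(** The telescoping starts from [V M 0], which is u and not 1; hence the factor [U M] on Phi^n. The
    predecessor in the exponent is harmless at n = 0, where the sum is empty. *)
Lemma V_expand M n : eqm M (Phi ^+ n * U M - V M n)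
  (\sum_(j < n) a ^+ 2 *: ((1 - 'X) ^+ 3 * Phi ^+ j * (U M * V M (n.-1 - j)))).
Proof.
elim: n => [|n IH].
  by rewrite expr0 mul1r big_ord0 => i iM; rewrite coefB V0 // subrr coef0.
have -> : Phi ^+ n.+1 * U M - V M n.+1 = Phi * (Phi ^+ n * U M - V M n) + (Phi * V M n - V M n.+1).
  by rewrite exprS; ring.
apply: eqm_trans (eqmD (eqmM (eqm_refl Phi) IH) (@V_step M n)) _.
move=> i iM; congr (nth 0 (polyseq _) i); rewrite big_ord_recl /= subn0 expr0 mulr1 addrC; congr (_ + _).
rewrite mulr_sumr; apply: eq_bigr => j _; rewrite /bump /= add1n exprS -scalerAr.
have jn := ltn_ord j; rewrite (_ : n.-1 - j = n - j.+1)%N; last by lia.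
congr (_ *: _); move: (U M * V M (n - j.+1)) => W.
by rewrite [Phi ^+ j.+1]exprS; move: (Phi ^+ j) => Y; ring.
Qed.

(** The first term is a^2 from [V_step], times 2/(a sqrt a) from [Phi_smooth], times the sum 3 of
    the series; the second is the cost of replacing Phi^n u by Phi^n. *)
Lemma Phi_V_l1 M n : l1 M (Phi ^+ n - V M n) <= 6 * Num.sqrt a + 2 * a.
Proof.
move: a_gt0 => a0; have sa : 0 < Num.sqrt a by rewrite sqrtr_gt0.
have -> : Phi ^+ n - V M n = (Phi ^+ n * U M - V M n) + Phi ^+ n * (1 - U M) by ring.
apply: le_trans (l1D _ _ _) _; apply: lerD; last first.
  apply: le_trans (l1M _ _ _) _; rewrite -[leRHS]mul1r.
  apply: ler_pM; rewrite ?l1_ge0 ?U_1sub //.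
  by rewrite pnn_l1; [exact: pgf_row Phi_pnn Phi_1sub M n|exact/pnnX/Phi_pnn].
rewrite (l1_eqm (@V_expand M n)); apply: le_trans (l1_sum _ _ _) _.
apply: (@le_trans _ _ (\sum_(j < n) a ^+ 2 * (2 / (a * Num.sqrt a) * (j.+1%:R * Num.sqrt j.+1%:R)^-1))).
  apply: ler_sum => j _; rewrite l1Z ger0_norm ?sqr_ge0 // ler_wpM2l ?sqr_ge0 //.
  apply: le_trans (l1M _ _ _) _; rewrite -[leRHS]mulr1.
  apply: ler_pM; rewrite ?l1_ge0 ?Phi_smooth //.
  apply: le_trans (l1M _ _ _) _; rewrite -[leRHS]mulr1.
  by apply: ler_pM; rewrite ?l1_ge0 ?U_l1 ?V_l1.
rewrite -!mulr_sumr.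
apply: (@le_trans _ _ (a ^+ 2 * (2 / (a * Num.sqrt a) * 3))).
  by rewrite ler_wpM2l ?sqr_ge0 // ler_wpM2l ?sum_3half // divr_ge0 ?mulr_ge0 ?ltW.
rewrite le_eqVlt; apply/orP; left; apply/eqP.
have -> : a ^+ 2 = a * (Num.sqrt a * Num.sqrt a) by rewrite -!expr2 sqr_sqrtr ?(ltW a0) // expr2.
by field; rewrite !gt_eqF.
Qed.

End PhiEstimate.

(** * The Schur test and the positive contraction *)

Section Schur.
Variable R : realType.
Local Notation C := R[i].

Lemma normc_sqr (z : C) : normc z ^+ 2 = complex.Re z ^+ 2 + complex.Im z ^+ 2.
Proof. by case: z => x y; rewrite /Normc.normc /= sqr_sqrtr // addr_ge0 ?sqr_ge0. Qed.

Lemma Re_realM (k : R) (z : C) : complex.Re (k%:C%C * z) = k * complex.Re z.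
Proof. by case: z => x y /=; rewrite mul0r subr0. Qed.

Lemma Im_realM (k : R) (z : C) : complex.Im (k%:C%C * z) = k * complex.Im z.
Proof. by case: z => x y /=; rewrite mul0r addr0. Qed.

Lemma Re_sum (I : Type) (s : seq I) (F : I -> C) :
  complex.Re (\sum_(i <- s) F i) = \sum_(i <- s) complex.Re (F i).
Proof. by elim: s => [|i s IH]; rewrite ?big_nil // !big_cons raddfD /= IH. Qed.

Lemma Im_sum (I : Type) (s : seq I) (F : I -> C) :
  complex.Im (\sum_(i <- s) F i) = \sum_(i <- s) complex.Im (F i).
Proof. by elim: s => [|i s IH]; rewrite ?big_nil // !big_cons raddfD /= IH. Qed.

(** Cauchy-Schwarz in each row with weights |K m n| uses the row sums; exchanging the summations
    then uses the column sums. *)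
Lemma Schur_real M N (K : nat -> nat -> R) (al be : R) (x : nat -> R) :
  0 <= al -> 
  (forall m, (m < M)%N -> \sum_(n < N) `|K m n| <= al) ->
  (forall n, (n < N)%N -> \sum_(m < M) `|K m n| <= be) ->
  \sum_(m < M) (\sum_(n < N) K m n * x n) ^+ 2 <= al * be * \sum_(n < N) x n ^+ 2.
Proof.
move=> al0 Hr Hc.
apply: (@le_trans _ _ (\sum_(m < M) al * \sum_(n < N) `|K m n| * x n ^+ 2)).
  apply: ler_sum => m _.
  have := @weighted_CS R 'I_N (fun n => `|K m n|) (fun n => `|x n|) (fun n => normr_ge0 _).
  under [X in _ <= _ * X -> _]eq_bigr do rewrite real_normK ?num_real //.
  move=> H; apply: le_trans (_ : (\sum_(i < N) `|K m i| * `|x i|) ^+ 2 <= _).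
    rewrite -(real_normK (num_real (\sum_(n < N) _))) lerXn2r ?nnegrE ?normr_ge0 //.
      by rewrite sumr_ge0 // => i _; rewrite mulr_ge0.
    by apply: le_trans (ler_norm_sum _ _ _) _; apply: ler_sum => i _; rewrite normrM.
  apply: le_trans H _; apply: ler_wpM2r; last exact: Hr.
  by rewrite sumr_ge0 // => i _; rewrite mulr_ge0 ?sqr_ge0.
rewrite -mulr_sumr exchange_big /= -mulrA ler_wpM2l // mulr_sumr.
by apply: ler_sum => n _; rewrite -mulr_suml ler_wpM2r ?sqr_ge0 // Hc.
Qed.

Definition sq2 N (x : nat -> C) : R := \sum_(n < N) normc (x n) ^+ 2.

Lemma sq2E N x : sq2 N x = \sum_(n < N) complex.Re (x n) ^+ 2 + \sum_(n < N) complex.Im (x n) ^+ 2.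
Proof. by rewrite /sq2 -big_split; apply: eq_bigr => i _; rewrite normc_sqr. Qed.

Lemma Schur M N (K : nat -> nat -> R) (al be : R) (x : nat -> C) :
  0 <= al -> 
  (forall m, (m < M)%N -> \sum_(n < N) `|K m n| <= al) ->
  (forall n, (n < N)%N -> \sum_(m < M) `|K m n| <= be) ->
  sq2 M (fun m => \sum_(n < N) (K m n)%:C%C * x n) <= al * be * sq2 N x.
Proof.
move=> al0 Hr Hc; rewrite !sq2E mulrDr; apply: lerD.
  under eq_bigr do (rewrite Re_sum; under eq_bigr do rewrite Re_realM).
  exact: (@Schur_real M N K al be (fun n => complex.Re (x n))).
under eq_bigr do (rewrite Im_sum; under eq_bigr do rewrite Im_realM).
exact: (@Schur_real M N K al be (fun n => complex.Im (x n))).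
Qed.

(** Column n of the matrix of composition with [th] lists the coefficients of th^n. Its mass is at
    most 1, and the Green function bound of [pgf_col] controls the rows. *)
Lemma pgf_Schur (th q : {poly R}) : pnn th -> pnn q -> 0 < q`_0 -> 1 - th = (1 - 'X) * q ->
  forall M N (x : nat -> C), sq2 M (fun m => \sum_(n < N) ((th ^+ n)`_m)%:C%C * x n) <= (q`_0)^-1 * sq2 N x.
Proof.
move=> tn qn q0 H M N x; rewrite -[(q`_0)^-1]mulr1.
apply: (@Schur M N (fun m n => (th ^+ n)`_m)) => [|m _|n _].
- by rewrite invr_ge0 ltW.
- by under eq_bigr do rewrite ger0_norm ?pnnX //; exact: pgf_col H _ _.
- by under eq_bigr do rewrite ger0_norm ?pnnX //; exact: pgf_row H _ _.
Qed.

Section Positive.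
Variable a : R.
Hypothesis a_gt0 : 0 < a.
Hypothesis a_le : a <= 1 / 4.
Local Notation sg := (sg a).
Local Notation A := (A a).

Implicit Types (u w : nat -> R).

Definition Av M (u : nat -> R) k := \sum_(n < M) A k n * u n.
Definition Pv M (u : nat -> R) m := \sum_(n < M) Pmx a M m n * u n.

Lemma PvE M u m : Pv M u m = sg * \sum_(k < M) A k m * Av M u k.
Proof.
rewrite /Pv /Pmx /Av; under eq_bigr do rewrite -mulrA mulr_suml.
rewrite -mulr_sumr exchange_big /=; congr (_ * _); apply: eq_bigr => k _.
by rewrite mulr_sumr; apply: eq_bigr => n _; rewrite mulrA.
Qed.

Lemma Pv_form M u w : \sum_(m < M) Pv M u m * w m = sg * \sum_(k < M) Av M u k * Av M w k.
Proof.
under eq_bigr do rewrite PvE -mulrA mulr_suml.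
rewrite -mulr_sumr exchange_big /=; congr (_ * _); apply: eq_bigr => k _.
rewrite [Av M w k]/Av mulr_sumr; apply: eq_bigr => n _; ring.
Qed.

(** In view of [Pv_form] this reads <P u, u> <= |u|^2; it is the Schur test for A. *)
Lemma Av_le M u : sg * \sum_(k < M) Av M u k ^+ 2 <= \sum_(n < M) u n ^+ 2.
Proof.
have [s0 _ _ _ _] := sg_bb a_gt0.
rewrite mulrC -ler_pdivlMr // mulrC -[sg^-1]mulr1.
apply: Schur_real => [|m _|n _].
- by rewrite invr_ge0 ltW.
- by under eq_bigr do rewrite ger0_norm ?A_ge0 //; exact: A_col.
- by under eq_bigr do rewrite ger0_norm ?A_ge0 //; exact: A_row.
Qed.

(** The Schur test for the transpose of A, where the row and column bounds change places. It reads
    |P u|^2 <= <P u, u>. *)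
Lemma Pv_le M u : \sum_(m < M) Pv M u m ^+ 2 <= sg * \sum_(k < M) Av M u k ^+ 2.
Proof.
have [s0 _ _ _ _] := sg_bb a_gt0.
have H : \sum_(m < M) (\sum_(k < M) A k m * Av M u k) ^+ 2 <= 1 * sg^-1 * \sum_(k < M) Av M u k ^+ 2.
  apply: (@Schur_real M M (fun m k => A k m)) => // [m _|n _].
  - by under eq_bigr do rewrite ger0_norm ?A_ge0 //; exact: A_row.
  - by under eq_bigr do rewrite ger0_norm ?A_ge0 //; exact: A_col.
under eq_bigr do rewrite PvE exprMn.
rewrite -mulr_sumr; apply: (@le_trans _ _ (sg ^+ 2 * (1 * sg^-1 * \sum_(k < M) Av M u k ^+ 2))).
  by rewrite ler_wpM2l ?sqr_ge0.
rewrite le_eqVlt; apply/orP; left; apply/eqP.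
by move: (\sum_(k < M) _) => S; field; rewrite gt_eqF.
Qed.

(* As 0 <= P <= 1, the norm of P - c is attained at the ends of [0, 1]. *)
Lemma P_sub_le M (x : nat -> C) (c : C) (rho : R) :
  normc c ^+ 2 <= rho -> normc (1 - c) ^+ 2 <= rho ->
  sq2 M (fun m => \sum_(n < M) (Pmx a M m n)%:C%C * x n - c * x m) <= rho * sq2 M x.
Proof.
pose u n := complex.Re (x n); pose w n := complex.Im (x n).
case: c => c d; rewrite !normc_sqr /= => h1 h2.
have [s0 _ _ _ _] := sg_bb a_gt0.
pose Gu := sg * \sum_(k < M) Av M u k ^+ 2; pose Gw := sg * \sum_(k < M) Av M w k ^+ 2.
have E m : normc (\sum_(n < M) (Pmx a M m n)%:C%C * x n - (c +i* d)%C * x m) ^+ 2 =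
    Pv M u m ^+ 2 + Pv M w m ^+ 2 + (c ^+ 2 + d ^+ 2) * (u m ^+ 2 + w m ^+ 2)
    - 2 * c * (Pv M u m * u m + Pv M w m * w m) - 2 * d * (Pv M w m * u m - Pv M u m * w m).
  rewrite normc_sqr !raddfB /= Re_sum Im_sum.
  under eq_bigr do rewrite Re_realM; under [X in _ + (X - _) ^+ 2]eq_bigr do rewrite Im_realM.
  rewrite -/(Pv M u m) -/(Pv M w m).
  have -> : complex.Re ((c +i* d)%C * x m) = c * u m - d * w m by rewrite /u /w; case: (x m).
  have -> : complex.Im ((c +i* d)%C * x m) = c * w m + d * u m by rewrite /u /w; case: (x m).
  by move: (Pv M u m) (Pv M w m) (u m) (w m) => p1 p2 p3 p4; ring.
have S : sq2 M x = \sum_(n < M) u n ^+ 2 + \sum_(n < M) w n ^+ 2 by rewrite sq2E.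
rewrite {1}/sq2; under eq_bigr do rewrite E.
have -> : \sum_(m < M) (Pv M u m ^+ 2 + Pv M w m ^+ 2 + (c ^+ 2 + d ^+ 2) * (u m ^+ 2 + w m ^+ 2)
    - 2 * c * (Pv M u m * u m + Pv M w m * w m) - 2 * d * (Pv M w m * u m - Pv M u m * w m))
  = \sum_(m < M) Pv M u m ^+ 2 + \sum_(m < M) Pv M w m ^+ 2 + (c ^+ 2 + d ^+ 2) * sq2 M x
    - 2 * c * (Gu + Gw).
  have F v : \sum_(m < M) Pv M v m * v m = sg * \sum_(k < M) Av M v k ^+ 2.
    by rewrite Pv_form; congr (_ * _); apply: eq_bigr => k _; rewrite expr2.
  (* The symmetry of P removes the cross terms that carry the imaginary part of c. *)
  have F2 : \sum_(m < M) Pv M w m * u m = \sum_(m < M) Pv M u m * w m.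
    by rewrite !Pv_form; congr (_ * _); apply: eq_bigr => k _; rewrite mulrC.
  rewrite !sumrB !big_split /= -!mulr_sumr !big_split /= sumrN (F u) (F w) F2 S.
  by rewrite subrr mulr0 subr0.
have := Pv_le M u; have := Pv_le M w; have := Av_le M u; have := Av_le M w.
rewrite -/Gu -/Gw => k1 k2 k3 k4.
have gu : 0 <= Gu by rewrite mulr_ge0 ?(ltW s0) // sumr_ge0 // => i _; exact: sqr_ge0.
have gw : 0 <= Gw by rewrite mulr_ge0 ?(ltW s0) // sumr_ge0 // => i _; exact: sqr_ge0.
have k5 : Gu + Gw <= sq2 M x by rewrite S; lra.
move: (sq2 M x) Gu Gw gu gw (\sum_(m < M) Pv M u m ^+ 2) (\sum_(m < M) Pv M w m ^+ 2)
  k3 k4 k5 {k1 k2 E S} => X g1 g2 g10 g20 p1 p2 k3 k4 k5.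
move: h2; rewrite sub0r sqrrN => h2.
(* If Re c >= 1/2 then 0 is the end of [0, 1] farther from c, and the bound on |c| suffices;
   otherwise it is 1, and <P x, x> <= |x|^2 is used. *)
have [h|h] := leP (1 - 2 * c) 0.
  have : 0 <= (2 * c - 1) * (g1 + g2) by rewrite mulr_ge0; lra.
  have : 0 <= (rho - (c ^+ 2 + d ^+ 2)) * X by rewrite mulr_ge0; lra.
  lra.
have : 0 <= (1 - 2 * c) * (X - g1 - g2) by rewrite mulr_ge0; lra.
have : 0 <= (rho - ((1 - c) ^+ 2 + d ^+ 2)) * X by rewrite mulr_ge0; lra.
lra.
Qed.

(** Schur bound for the squared norm of composition with Phi minus P: the row sums are at most 1/(1
    - a) + 1 <= 3, the column sums at most the l1 distance of [Phi_V_l1]. *)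
Definition eps_a := 3 * (6 * Num.sqrt a + 2 * a).

Lemma Phi_sub_le M (x : nat -> C) (c : C) (rho t : R) : 0 < t ->
  normc c ^+ 2 <= rho -> normc (1 - c) ^+ 2 <= rho ->
  sq2 M (fun m => \sum_(n < M) ((Phi a ^+ n)`_m)%:C%C * x n - c * x m)
   <= ((1 + t) * rho + (1 + t^-1) * eps_a) * sq2 M x.
Proof.
move=> t0 h1 h2.
pose D m n : R := (Phi a ^+ n)`_m - Pmx a M m n.
have HD : sq2 M (fun m => \sum_(n < M) (D m n)%:C%C * x n) <= eps_a * sq2 M x.
  apply: Schur => // [m mM|n nM].
    apply: (@le_trans _ _ (\sum_(n < M) ((Phi a ^+ n)`_m + Pmx a M m n))).
      apply: ler_sum => n _; apply: le_trans (ler_normB _ _) _.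
      by rewrite !ger0_norm ?Pmx_ge0 //; exact/pnnX/Phi_pnn.
    rewrite big_split /=; under [X in _ + X]eq_bigr do rewrite Pmx_sym.
    have k1 := Pmx_row a_gt0 M M m.
    have k2 := pgf_col (Phi_pnn a_gt0 a_le) (lin_pnn _ _) _ (Phi_1sub a) M m.
    move: k2; rewrite coefD coefC coefZ coefX /= mulr0 addr0 => k2.
    have k3 : (1 - a)^-1 <= 2 by rewrite invf_ple ?posrE; move: a_le; lra.
    apply: le_trans (_ : 2 + 1 <= 3); last by lra.
    apply: lerD => //; apply: le_trans k3; apply: k2; move: a_gt0 a_le; lra.
  apply: le_trans (Phi_V_l1 a_gt0 a_le M n).
  by rewrite /l1; apply: ler_sum => m _; rewrite coefB coef_poly ltn_ord.
have HP := P_sub_le M x h1 h2.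
pose y m := \sum_(n < M) (Pmx a M m n)%:C%C * x n - c * x m.
pose z m := \sum_(n < M) (D m n)%:C%C * x n.
have ti : 0 < t^-1 by rewrite invr_gt0.
apply: (@le_trans _ _ ((1 + t) * sq2 M y + (1 + t^-1) * sq2 M z)).
  rewrite /sq2 !mulr_sumr -big_split /=; apply: ler_sum => m _.
  have -> : \sum_(n < M) ((Phi a ^+ n)`_m)%:C%C * x n - c * x m = y m + z m.
    rewrite /y /z addrAC -big_split /=; congr (_ - _); apply: eq_bigr => n _.
    by rewrite -mulrDl -rmorphD /= /D addrC subrK.
  exact: sqr_normcD_le.
rewrite [leRHS]mulrDl -(mulrA (1 + t)) -(mulrA (1 + t^-1)); apply: lerD; apply: ler_wpM2l; [lra|exact: HP|lra|exact: HD].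
Qed.

End Positive.
End Schur.

(** * Roots of unity and Parseval's identity *)

Section Circle.
Variable R : realType.
Local Notation C := R[i].
Implicit Types (x y t : R) (z w : C).

Definition cis x : C := (cos x +i* sin x)%C.

Lemma cisD x y : cis (x + y) = cis x * cis y.
Proof. by rewrite /cis cosD sinD; congr (_ +i* _)%C; rewrite ?[sin x * cos y]mulrC // addrC [cos y * _]mulrC. Qed.

Lemma cis0 : cis 0 = 1.
Proof. by rewrite /cis cos0 sin0. Qed.

Lemma cis_exp x n : cis x ^+ n = cis (x *+ n).
Proof. by elim: n => [|n IH]; rewrite ?mulr0n ?cis0 // exprS IH mulrS cisD. Qed.

Lemma normc_cis x : normc (cis x) = 1.
Proof. by rewrite /Normc.normc /cis cos2Dsin2 sqrtr1. Qed.

Lemma cis_pi : cis pi = -1.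
Proof. by rewrite /cis cospi sinpi; apply/eqP; rewrite eq_complex /= oppr0 !eqxx. Qed.

(** The order is a power of two: primitivity then follows from the half power being -1, and the
    nodes fit the bisections in [goursat]. *)
Definition om k : C := cis (2 * pi / (2 ^ k)%:R).

Lemma om_half k : om k.+1 ^+ (2 ^ k) = -1.
Proof.
rewrite cis_exp -cis_pi; congr cis.
rewrite -mulr_natr expnS natrM; field.
by rewrite pnatr_eq0 -lt0n expn_gt0.
Qed.

Lemma om_full k : om k ^+ (2 ^ k) = 1.
Proof.
case: k => [|k]; last by rewrite expnS mulnC exprM om_half -signr_odd.
by rewrite expn0 expr1 /om expn0 divr1 mulr2n mulrDl mul1r cisD cis_pi mulrNN mulr1.
Qed.

(** Write d = 2^v m with m odd; then v < k, and om^d = 1 would force the power 2^(k-1) m of om to be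
    1, whereas it is (-1)^m = -1. *)
Lemma om_neq1 k d : (0 < d < 2 ^ k)%N -> om k ^+ d != 1.
Proof.
case: k => [|k] /andP[d0 dk]; first by move: dk; rewrite expn0; lia.
have [m com dE] := pfactor_coprime (isT : prime 2) d0.
have om2 : odd m by rewrite -coprime2n.
have vk : (logn 2 d <= k)%N.
  rewrite -ltnS -(@ltn_exp2l 2) //; apply: leq_ltn_trans dk.
  by rewrite {2}dE leq_pmull //; case: m {com dE} om2.
apply/negP => /eqP E.
have : om k.+1 ^+ (2 ^ k * m) = 1.
  have -> : (2 ^ k * m = d * 2 ^ (k - logn 2 d))%N.
    by rewrite {1}dE -mulnA -expnD subnKC // mulnC.
  by rewrite exprM E expr1n.
rewrite exprM om_half -signr_odd om2 expr1 => /eqP.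
by rewrite eq_sym -subr_eq0 opprK (_ : 1 + 1 = 2%:R) // pnatr_eq0.
Qed.

Lemma normc_om k : normc (om k) = 1.
Proof. exact: normc_cis. Qed.

Lemma normc_sqrJ z : ((normc z ^+ 2)%:C)%C = z * z^*%C.
Proof. by rewrite rmorphXn /= -normcE sqr_normc. Qed.

Lemma om_conj k : om k * (om k)^*%C = 1.
Proof. by rewrite -normc_sqrJ normc_om expr1n. Qed.

Lemma om_orth k j l : (j < 2 ^ k)%N -> (l < 2 ^ k)%N ->
  \sum_(n < 2 ^ k) om k ^+ (j * n) * (om k ^+ (l * n))^*%C = if j == l then (2 ^ k)%:R else 0.
Proof.
move=> jk lk; pose ze := om k ^+ j * (om k)^*%C ^+ l.
have E n : om k ^+ (j * n) * (om k ^+ (l * n))^*%C = ze ^+ n.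
  by rewrite /ze exprMn -!exprM rmorphXn.
under eq_bigr do rewrite E.
have [jl|jl] := eqVneq j l.
  have -> : ze = 1 by rewrite /ze jl -exprMn om_conj expr1n.
  by under eq_bigr do rewrite expr1n; rewrite sumr_const card_ord.
have z1 : ze != 1.
  apply/negP => /eqP z1.
  have H a b : (a < b)%N -> (b < 2 ^ k)%N -> om k ^+ a != om k ^+ b.
    move=> ab bk; apply/negP => /eqP h.
    have h1 : (0 < b - a < 2 ^ k)%N by apply/andP; split; lia.
    have /negP := om_neq1 h1; apply.
    apply/eqP; rewrite -[LHS]mul1r -[X in X * _](expr1n _ a) -(om_conj k) exprMn mulrAC -exprD.
    by rewrite subnKC 1?ltnW // -h -exprMn om_conj expr1n.
  have e : om k ^+ j = om k ^+ l.
    rewrite -[RHS]mul1r -z1 /ze -mulrA -exprMn [_^*%C * _]mulrC om_conj expr1n mulr1 //.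
  by case: (ltngtP j l) jl => // h _; have := H _ _ h; rewrite e eqxx => /(_ _) hh; [have := hh lk|have := hh jk].
have : (ze - 1) * \sum_(n < 2 ^ k) ze ^+ n = 0.
  rewrite -subrX1 /ze exprMn -!exprM ![(_ * 2 ^ k)%N]mulnC !exprM om_full expr1n.
  by rewrite -rmorphXn /= om_full conjc1 expr1n mulr1 subrr.
by move/eqP; rewrite mulf_eq0 subr_eq0 (negPf z1) /= => /eqP.
Qed.

Lemma conjcM z w : (z * w)^*%C = z^*%C * w^*%C.
Proof. exact: rmorphM. Qed.

Lemma parseval k (v : nat -> C) :
  \sum_(n < 2 ^ k) normc (\sum_(j < 2 ^ k) v j * om k ^+ (j * n)) ^+ 2
  = (2 ^ k)%:R * \sum_(j < 2 ^ k) normc (v j) ^+ 2.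
Proof.
apply: (@complexI R); rewrite rmorph_sum rmorphM rmorph_sum rmorph_nat /=.
under eq_bigr do rewrite normc_sqrJ rmorph_sum /= mulr_suml.
rewrite exchange_big /= mulr_sumr; apply: eq_bigr => j _.
under eq_bigr do rewrite mulr_sumr.
rewrite exchange_big /= (bigD1 j) //= [X in _ + X]big1 ?addr0 => [|l lj].
  have := om_orth (ltn_ord j) (ltn_ord j); rewrite eqxx => <-.
  rewrite normc_sqrJ mulr_suml; apply: eq_bigr => n _.
  by rewrite conjcM; ring.
have := om_orth (ltn_ord j) (ltn_ord l); rewrite eq_sym (negPf (lj : (l : nat) != j)) => E.
transitivity (v j * (v l)^*%C * \sum_(n < 2 ^ k) om k ^+ (j * n) * (om k ^+ (l * n))^*%C); last by rewrite E mulr0.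
rewrite mulr_sumr; apply: eq_bigr => n _.
by rewrite conjcM; ring.
Qed.

Lemma sqr_close (x y e c : R) : 0 <= x -> 0 <= y -> x <= y + e -> y <= c -> 0 <= e <= 1 ->
  x ^+ 2 <= y ^+ 2 + e * (2 * c + 1).
Proof.
move=> x0 y0 xy yc /andP[e0 e1].
apply: (@le_trans _ _ ((y + e) ^+ 2)); first by rewrite lerXn2r // nnegrE; lra.
have -> : (y + e) ^+ 2 = y ^+ 2 + e * (2 * y + e) by ring.
by rewrite lerD2l ler_wpM2l //; lra.
Qed.

(* Pointwise domination of squared moduli passes to H^2 norms, since these are
   limits of averages of squared moduli over roots of unity. *)
Lemma Hq_dom (f g : C -> C) (qf qg A B : R) : 0 <= A -> Hq f qf -> Hq g qg ->
  (forall z, normc z < 1 -> normc (g z) ^+ 2 <= A * normc (f z) ^+ 2 + B) -> Hq g (A * qf + B).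
Proof.
move=> A0 [a [fa qa]] [b [gb qb]] H; exists b; split => // n.
have am k := coef_le k qa; have bm k := coef_le k qb.
pose mf := Num.sqrt qf; pose mg := Num.sqrt qg.
have mf0 : 0 <= mf := sqrtr_ge0 _; have mg0 : 0 <= mg := sqrtr_ge0 _.
(* On a circle of radius r < 1 the tails of both series are uniformly small; r tends to 1 only at
   the end. *)
have main r : 0 < r < 1 -> \sum_(k < n) normc (b k * (r ^+ k)%:C%C) ^+ 2 <= A * qf + B.
  move=> /andP[r0 r1]; have D0 : 0 < 1 - r by lra.
  pose cf := mf * (r ^+ 0 / (1 - r)); pose cg := mg * (r ^+ 0 / (1 - r)).
  have cf0 : 0 <= cf by rewrite /cf expr0 mulr_ge0 ?divr_ge0 // ltW.
  have cg0 : 0 <= cg by rewrite /cg expr0 mulr_ge0 ?divr_ge0 // ltW.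
  apply: eps_le => d d0.
  pose T := A * (2 * cf + 1) + (2 * cg + 1).
  have T0 : 0 < T by rewrite /T ltr_wpDl ?mulr_ge0 //; lra.
  have [e [e0 e1 eT]] : exists e, [/\ 0 < e, e <= 1 & e * T <= d].
    exists (Num.min 1 (d / T)); split.
    - by rewrite lt_min ltr01 divr_gt0.
    - by rewrite ge_min lexx.
    - by rewrite -ler_pdivlMr // ge_min lexx orbT.
  have h : 0 < e * (1 - r) / (mf + mg + 1) by rewrite divr_gt0 ?mulr_gt0 //; lra.
  have rr : 0 <= r < 1 by lra.
  have [N HN] := expr_small rr h.
  (* With Q nodes Parseval is exact for truncations to Q terms; Q >= N makes the tails at most e,
     and Q >= n retains the coefficients to be bounded. *)
  pose k := maxn N n; pose Q := (2 ^ k)%N.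
  have kQ : (k < Q)%N by rewrite ltn_expl.
  have NQ : (N <= Q)%N by rewrite (leq_trans (leq_maxl N n)) // ltnW.
  have nQ : (n <= Q)%N by rewrite (leq_trans (leq_maxr N n)) // ltnW.
  have small m : 0 <= m -> m <= mf + mg -> m * (r ^+ Q / (1 - r)) <= e.
    move=> m0 mle; rewrite mulrA ler_pdivrMr //.
    have := HN _ NQ; rewrite ltr_pdivlMr ?ltr_wpDl ?addr_ge0 // => L.
    apply: le_trans (ltW L); rewrite mulrC ler_wpM2l ?exprn_ge0 ?(ltW r0) //; lra.
  pose z (j : nat) := (r%:C)%C * om k ^+ j.
  have nz j : normc (z j) = r.
    by rewrite /z Normc.normcM normcX normc_om expr1n mulr1 normc_real gtr0_norm.
  have nz1 j : normc (z j) < 1 by rewrite nz.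
  have pE (c : nat -> C) j : psum c (z j) Q = \sum_(i < Q) (c i * (r ^+ i)%:C%C) * om k ^+ (i * j).
    rewrite /psum; apply: eq_bigr => i _; rewrite /z exprMn -exprM mulnC -mulrA; congr (_ * (_ * _)).
    by rewrite rmorphXn.
  have step j : normc (psum b (z j) Q) ^+ 2 <= A * normc (psum a (z j) Q) ^+ 2 + B + d.
    have e01 : 0 <= e <= 1 by lra.
    have f1 : normc (f (z j)) <= normc (psum a (z j) Q) + e.
      have := tay_tail Q am (nz1 j) (fa _ (nz1 j)); rewrite nz => t1.
      have := small mf mf0 _; have := normc_sub_ge (f (z j)) (psum a (z j) Q).
      rewrite -/mf in t1; move=> t2 /(_ _) t3; have := t3 _; lra.
    have g1 : normc (psum b (z j) Q) <= normc (g (z j)) + e.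
      have := tay_tail Q bm (nz1 j) (gb _ (nz1 j)); rewrite nz normc_distC => t1.
      have := small mg mg0 _; have := normc_sub_ge (psum b (z j) Q) (g (z j)).
      rewrite -/mg in t1; move=> t2 /(_ _) t3; have := t3 _; lra.
    have f2 : normc (psum a (z j) Q) <= cf.
      have := psum_diff_le 0 Q am (nz1 j); rewrite nz {2}/psum big_ord0 subr0 add0n; exact.
    have g2 : normc (g (z j)) <= cg.
      have := tay_tail 0 bm (nz1 j) (gb _ (nz1 j)); rewrite nz /psum big_ord0 subr0; exact.
    have := sqr_close (normc_ge0 _) (normc_ge0 _) f1 f2 e01.
    have := sqr_close (normc_ge0 _) (normc_ge0 _) g1 g2 e01.
    have := H _ (nz1 j).
    move: (normc (psum b _ _)) (normc (g _)) (normc (psum a _ _)) (normc (f _)) => x1 x2 x3 x4 y1 y2 y3.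
    have y4 := ler_wpM2l A0 y3; move: eT; rewrite /T; lra.
  have Q0 : (0 : R) < Q%:R by rewrite ltr0n expn_gt0.
  have S1 : \sum_(j < Q) normc (psum b (z j) Q) ^+ 2 = Q%:R * \sum_(i < Q) normc (b i * (r ^+ i)%:C%C) ^+ 2.
    by under eq_bigr do rewrite pE; rewrite (parseval k (fun i => b i * (r ^+ i)%:C%C)).
  have S2 : \sum_(j < Q) normc (psum a (z j) Q) ^+ 2 = Q%:R * \sum_(i < Q) normc (a i * (r ^+ i)%:C%C) ^+ 2.
    by under eq_bigr do rewrite pE; rewrite (parseval k (fun i => a i * (r ^+ i)%:C%C)).
  have S3 : \sum_(j < Q) normc (psum b (z j) Q) ^+ 2 <= A * \sum_(j < Q) normc (psum a (z j) Q) ^+ 2 + Q%:R * (B + d).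
    have -> : Q%:R * (B + d) = \sum_(j < Q) (B + d) by rewrite sumr_const card_ord mulr_natl.
    rewrite mulr_sumr -big_split /=; apply: ler_sum => j _.
    by rewrite addrA.
  have S4 : \sum_(i < Q) normc (a i * (r ^+ i)%:C%C) ^+ 2 <= qf.
    apply: le_trans (qa Q); apply: ler_sum => i _.
    rewrite lerXn2r ?nnegrE ?normc_ge0 // Normc.normcM normc_real normrX (gtr0_norm r0).
    by rewrite ler_piMr ?normc_ge0 // exprn_ile1 // ltW.
  move: S3; rewrite S1 S2 mulrCA -mulrDr ler_pM2l // => S3.
  apply: (@le_trans _ _ (\sum_(i < Q) normc (b i * (r ^+ i)%:C%C) ^+ 2)).
    rewrite -!(big_mkord xpredT (fun i => normc (b i * (r ^+ i)%:C%C) ^+ 2)) (big_cat_nat (leq0n n) nQ) /=.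
    by rewrite lerDl sumr_ge0 // => i _; exact: sqr_ge0.
  have := ler_wpM2l A0 S4; lra.
pose S := \sum_(k < n) normc (b k) ^+ 2.
have S0 : 0 <= S by rewrite sumr_ge0 // => i _; exact: sqr_ge0.
apply: eps_le => d d0; rewrite -/S.
have T0 : 0 < 2 * n%:R * S + 1 + d by rewrite !ltr_wpDl ?addr_ge0 ?mulr_ge0 ?ler0n.
(* For r = 1 - de, Bernoulli's inequality gives r^(2n) >= 1 - 2 n de, so the loss 2 n de S stays
   below d; the summand 1 + d ensures de < 1. *)
pose de := d / (2 * n%:R * S + 1 + d).
have de0 : 0 < de by rewrite divr_gt0.
have de1 : de < 1.
  by rewrite ltr_pdivrMr // mul1r ltrDr ltr_wpDl ?mulr_ge0 ?ler0n.
have deE : de * (2 * n%:R * S + 1 + d) = d by rewrite mulfVK // gt_eqF.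
clearbody de.
have r01 : 0 < 1 - de < 1 by lra.
have := main _ r01 => M.
have bern m : 1 - m%:R * de <= (1 - de) ^+ m.
  elim: m => [|m IH]; first by rewrite mul0r subr0.
  have p0 : 0 <= (1 - de) by lra.
  rewrite exprS; apply: le_trans (ler_wpM2l p0 IH).
  by rewrite -natr1; have := mulr_ge0 (mulr_ge0 (ler0n R m) (ltW de0)) (ltW de0); lra.
have : (1 - de) ^+ (n + n) * S <= A * qf + B.
  apply: le_trans M; rewrite mulr_sumr; apply: ler_sum => i _.
  rewrite Normc.normcM normc_real exprMn mulrC ler_wpM2l ?sqr_ge0 //.
  have p0 : 0 <= 1 - de by lra.
  rewrite (ger0_norm (exprn_ge0 _ p0)) -exprM.
  have p1 : 1 - de <= 1 by rewrite gerBl ltW.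
  have i2 : (i * 2 <= n + n)%N by rewrite muln2 -addnn leq_add // ltnW.
  exact: (ler_wiXn2l p0 p1 i2).
have := ler_wpM2r S0 (bern (n + n)%N); rewrite natrD.
have := mulr_ge0 (ltW de0) (ltW d0).
lra.
Qed.

End Circle.

(** * Goursat's theorem by Riemann-Stieltjes sums *)

Section Goursat.
Variable R : realType.
Local Notation C := R[i].
Implicit Types (x y h c e t : R) (z w : C).

Definition cdiff (f : C -> C) z := exists d, forall e, 0 < e -> exists2 de, 0 < de &
  forall w, normc (w - z) < de -> normc (f w - f z - d * (w - z)) <= e * normc (w - z).

Section Contour.
Variable F : C -> C.

(* Riemann-Stieltjes sums along paths and boundaries of squares. *)
Definition stieltjes (N : nat) (ga : R -> C) x h : C :=
  \sum_(q < N) F (ga (x + q%:R * (h / N%:R))) *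
    (ga (x + q.+1%:R * (h / N%:R)) - ga (x + q%:R * (h / N%:R))).

Definition contour (Z : R -> R -> C) N x y h : C :=
  stieltjes N (Z^~ y) x h + stieltjes N (Z (x + h)) y h - stieltjes N (Z^~ (y + h)) x h - stieltjes N (Z x) y h.

Lemma stieltjes_split N ga x h : (0 < N)%N ->
  stieltjes (N + N) ga x h = stieltjes N ga x (h / 2) + stieltjes N ga (x + h / 2) (h / 2).
Proof.
move=> N0; have n0 : (N%:R : R) != 0 by rewrite pnatr_eq0 -lt0n.
rewrite /stieltjes big_split_ord /=; congr (_ + _); apply: eq_bigr => q _.
  have -> : h / (N + N)%:R = h / 2 / N%:R.
    by rewrite natrD; field; rewrite n0 /=; rewrite -mulr2n -mulr_natr mulf_neq0.
  by [].
have E (k : nat) : x + (N + k)%:R * (h / (N + N)%:R) = x + h / 2 + k%:R * (h / 2 / N%:R).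
  by rewrite !natrD; field; rewrite n0 /=; rewrite -mulr2n -mulr_natr mulf_neq0.
by rewrite -addnS !E.
Qed.

(** With twice as many steps on a full edge, the nodes of its halves are the same points, so the
    inner edges cancel exactly and no limit is taken. *)
Lemma contour_split Z N x y h : (0 < N)%N ->
  contour Z (N + N) x y h =
    contour Z N x y (h / 2) + contour Z N (x + h / 2) y (h / 2)
  + contour Z N x (y + h / 2) (h / 2) + contour Z N (x + h / 2) (y + h / 2) (h / 2).
Proof.
move=> N0; rewrite /contour !stieltjes_split //.
have -> : x + h / 2 + h / 2 = x + h by field.
have -> : y + h / 2 + h / 2 = y + h by field.
ring.
Qed.

(** The primitive A z + d z^2/2 of the affine model telescopes over the nodes. The left-endpoint
    rule errs by d/2 times each squared step, which gives the first term; the deviation of F from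
    the model, times the length, gives the second. *)
Lemma stieltjes_affine N ga x h (A d : C) L D e : (0 < N)%N -> 0 <= L -> 0 <= h -> 0 <= e -> 0 <= D ->
  (forall q, (q < N)%N -> normc (ga (x + q.+1%:R * (h / N%:R)) - ga (x + q%:R * (h / N%:R))) <= L * (h / N%:R)) ->
  (forall q, (q < N)%N -> normc (F (ga (x + q%:R * (h / N%:R))) - (A + d * ga (x + q%:R * (h / N%:R)))) <= e * D) ->
  normc (stieltjes N ga x h - (A * ga (x + h) + d * ga (x + h) ^+ 2 / 2 - (A * ga x + d * ga x ^+ 2 / 2)))
   <= normc d * (L * h) ^+ 2 / N%:R + e * D * (L * h).
Proof.
move=> N0 L0 h0 e0 D0 HL HF.
have n0 : (0 : R) < N%:R by rewrite ltr0n.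
pose g q := ga (x + q%:R * (h / N%:R)).
have g0 : ga x = g 0%N by rewrite /g mul0r addr0.
have gN : ga (x + h) = g N by rewrite /g mulrCA mulfV ?mulr1 // gt_eqF.
pose G z := A * z + d * z ^+ 2 / 2.
have -> : A * ga (x + h) + d * ga (x + h) ^+ 2 / 2 - (A * ga x + d * ga x ^+ 2 / 2)
   = \sum_(q < N) (G (g q.+1) - G (g q)).
  by rewrite g0 gN -(big_mkord xpredT (fun q => G (g q.+1) - G (g q))) telescope_sumr.
rewrite /stieltjes -sumrB; apply: le_trans (normc_sum _ _ _) _.
have -> : normc d * (L * h) ^+ 2 / N%:R + e * D * (L * h)
  = \sum_(q < N) (normc d * (L * (h / N%:R)) ^+ 2 + e * D * (L * (h / N%:R))).
  by rewrite sumr_const card_ord -mulr_natr; field; rewrite gt_eqF.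
apply: ler_sum => q _; rewrite -/(g q) -/(g q.+1).
have HLq := HL q (ltn_ord q); have HFq := HF q (ltn_ord q).
rewrite -/(g q) -/(g q.+1) in HLq HFq.
have -> : F (g q) * (g q.+1 - g q) - (G (g q.+1) - G (g q))
  = (F (g q) - (A + d * g q)) * (g q.+1 - g q) - d / 2 * (g q.+1 - g q) ^+ 2.
  by rewrite /G; field.
apply: le_trans (le_normcD _ _) _; rewrite normcN addrC.
rewrite [normc (d / 2 * _)]Normc.normcM normcX [normc (d / 2)]Normc.normcM [normc ((F _ - _) * _)]Normc.normcM.
have n2 : normc ((2 : C)^-1) <= 1.
  rewrite Normc.normcV (_ : (2 : C) = (2 : R)%:C%C); last by rewrite rmorph_nat.
  by rewrite normc_real normr_nat invf_le1 // ler1n.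
apply: lerD; last by apply: ler_pM; rewrite ?normc_ge0.
apply: ler_pM; rewrite ?mulr_ge0 ?normc_ge0 ?exprn_ge0 ?normc_ge0 //.
  by rewrite ler_piMr ?normc_ge0.
by rewrite lerXn2r // nnegrE ?normc_ge0 // mulr_ge0 // divr_ge0 // ltW.
Qed.

Variable Z : R -> R -> C.
Variable L : R.
Hypothesis L_ge0 : 0 <= L.
Hypothesis Z_lip : forall x y x' y', 0 <= x <= 1 -> 0 <= y <= 1 -> 0 <= x' <= 1 -> 0 <= y' <= 1 ->
  normc (Z x y - Z x' y') <= L * (`|x - x'| + `|y - y'|).

Lemma Z_diam x y h u v u' v' : 0 <= h -> 0 <= x -> x + h <= 1 -> 0 <= y -> y + h <= 1 ->
  x <= u <= x + h -> y <= v <= y + h -> x <= u' <= x + h -> y <= v' <= y + h ->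
  normc (Z u v - Z u' v') <= 2 * (L * h).
Proof.
move=> h0 x0 x1 y0 y1 hu hv hu' hv'.
apply: le_trans (_ : L * (h + h) <= _); last by lra.
apply: le_trans (Z_lip _ _ _ _) _; [lra|lra|lra|lra|].
by rewrite ler_wpM2l // lerD // ler_norml; lra.
Qed.

(** The primitive of the linearization at the marked point cancels around the boundary; what is left
    is four times the error of [stieltjes_affine] with D = 2 L h, the diameter bound for the
    image. *)
Lemma contour_le N x y h xs ys (d : C) e : (0 < N)%N -> 0 <= e -> 0 <= h ->
  0 <= x -> x + h <= 1 -> 0 <= y -> y + h <= 1 -> x <= xs <= x + h -> y <= ys <= y + h ->
  (forall u v, x <= u <= x + h -> y <= v <= y + h ->
    normc (F (Z u v) - F (Z xs ys) - d * (Z u v - Z xs ys)) <= e * normc (Z u v - Z xs ys)) ->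
  normc (contour Z N x y h) <= 4 * (normc d * (L * h) ^+ 2 / N%:R) + 8 * e * (L * h) ^+ 2.
Proof.
move=> N0 e0 h0 x0 x1 y0 y1 hxs hys H.
have n0 : (0 : R) < N%:R by rewrite ltr0n.
pose A := F (Z xs ys) - d * Z xs ys.
have lipd u v u' v' : x <= u <= x + h -> y <= v <= y + h -> x <= u' <= x + h -> y <= v' <= y + h ->
    normc (Z u v - Z u' v') <= L * (`|u - u'| + `|v - v'|).
  by move=> *; apply: Z_lip; lra.
have HA u v : x <= u <= x + h -> y <= v <= y + h ->
    normc (F (Z u v) - (A + d * Z u v)) <= e * (2 * (L * h)).
  move=> hu hv.
  have -> : F (Z u v) - (A + d * Z u v) = F (Z u v) - F (Z xs ys) - d * (Z u v - Z xs ys).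
    by rewrite /A; ring.
  apply: le_trans (H _ _ hu hv) _; apply: ler_wpM2l => //.
  exact: (@Z_diam x y h).
have q01 (q : nat) : (q <= N)%N -> 0 <= q%:R * (h / N%:R) <= h.
  move=> qN; apply/andP; split; first by rewrite mulr_ge0 ?divr_ge0 // ltW.
  by rewrite mulrCA ler_piMr // ler_pdivrMr // mul1r ler_nat.
have E ga x' : (forall u, x' <= u <= x' + h -> normc (F (ga u) - (A + d * ga u)) <= e * (2 * (L * h))) ->
   (forall u u', x' <= u <= x' + h -> x' <= u' <= x' + h -> normc (ga u - ga u') <= L * `|u - u'|) ->
   normc (stieltjes N ga x' h - (A * ga (x' + h) + d * ga (x' + h) ^+ 2 / 2 - (A * ga x' + d * ga x' ^+ 2 / 2)))
   <= normc d * (L * h) ^+ 2 / N%:R + e * (2 * (L * h)) * (L * h).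
  move=> H1 H2; apply: stieltjes_affine => //; first by rewrite !mulr_ge0.
    move=> q qN; apply: le_trans (H2 _ _ _ _) _.
    - have := q01 q.+1 qN; lra.
    - have := q01 q (ltnW qN); lra.
    rewrite ler_wpM2l //.
    have -> : x' + q.+1%:R * (h / N%:R) - (x' + q%:R * (h / N%:R)) = h / N%:R.
      by rewrite -natr1; ring.
    by rewrite ger0_norm // divr_ge0 // ltW.
  by move=> q qN; apply: H1; have := q01 q (ltnW qN); lra.
have xx : x <= x <= x + h by lra.
have xh : x <= x + h <= x + h by lra.
have yy : y <= y <= y + h by lra.
have yh : y <= y + h <= y + h by lra.
have EH v : y <= v <= y + h -> normc (stieltjes N (Z^~ v) x h - (A * Z (x + h) v + d * Z (x + h) v ^+ 2 / 2 - (A * Z x v + d * Z x v ^+ 2 / 2)))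
   <= normc d * (L * h) ^+ 2 / N%:R + e * (2 * (L * h)) * (L * h).
  move=> hv; apply: (E (Z^~ v)) => [u hu|u u' hu hu']; first exact: HA.
  by apply: le_trans (lipd _ _ _ _ hu hv hu' hv) _; rewrite subrr normr0 addr0.
have EV u : x <= u <= x + h -> normc (stieltjes N (Z u) y h - (A * Z u (y + h) + d * Z u (y + h) ^+ 2 / 2 - (A * Z u y + d * Z u y ^+ 2 / 2)))
   <= normc d * (L * h) ^+ 2 / N%:R + e * (2 * (L * h)) * (L * h).
  move=> hu; apply: (E (Z u)) => [v hv|v v' hv hv']; first exact: HA.
  by apply: le_trans (lipd _ _ _ _ hu hv hu hv') _; rewrite subrr normr0 add0r.
have := EH _ yy; have := EH _ yh; have := EV _ xx; have := EV _ xh.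
set T := normc d * (L * h) ^+ 2 / N%:R.
set b1 := _ - _ => K1; set b2 := _ - _ => K2; set b3 := _ - _ => K3; set b4 := _ - _ => K4.
have -> : contour Z N x y h = b4 + b1 - b3 - b2 by rewrite /contour /b1 /b2 /b3 /b4; ring.
apply: le_trans (le_normcD _ _) _; rewrite normcN.
have := le_normcD (b4 + b1) (- b3); have := le_normcD b4 b1; rewrite normcN.
move: K1 K2 K3 K4; lra.
Qed.

(** Finite sums stand in for integrals, so largeness is required at arbitrarily fine levels. This
    form survives a bisection, in which the level drops by one. *)
Definition large_contour c x y h := forall K, exists2 m, (K <= m)%N & c * h ^+ 2 < normc (contour Z (2 ^ m) x y h).

(** Pigeonhole: four quarters that are small at all fine levels would bound the whole by 4 c (h/2)^2
    = c h^2. *)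
Lemma large_contour_split c x y h : large_contour c x y h -> exists x' y',
  [/\ x' = x \/ x' = x + h / 2, y' = y \/ y' = y + h / 2 & large_contour c x' y' (h / 2)].
Proof.
move=> B; apply: contrapT => nB.
have small x' y' : x' = x \/ x' = x + h / 2 -> y' = y \/ y' = y + h / 2 ->
    exists K, forall m, (K <= m)%N -> normc (contour Z (2 ^ m) x' y' (h / 2)) <= c * (h / 2) ^+ 2.
  move=> hx hy; apply: contrapT => nK; apply: nB; exists x', y'; split => // K.
  apply: contrapT => nm; apply: nK; exists K => m Km; rewrite leNgt; apply/negP => bb.
  by apply: nm; exists m.
have [K1 H1] := small x y (or_introl erefl) (or_introl erefl).
have [K2 H2] := small (x + h / 2) y (or_intror erefl) (or_introl erefl).
have [K3 H3] := small x (y + h / 2) (or_introl erefl) (or_intror erefl).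
have [K4 H4] := small (x + h / 2) (y + h / 2) (or_intror erefl) (or_intror erefl).
have [[|m]] := B (K1 + K2 + K3 + K4).+1; first by [].
rewrite ltnS => Km; apply/negP; rewrite -leNgt expnS mul2n -addnn contour_split ?expn_gt0 //.
have := H1 m _; have := H2 m _; have := H3 m _; have := H4 m _.
set c1 := contour _ _ _ _ _; set c2 := contour _ _ _ _ _; set c3 := contour _ _ _ _ _; set c4 := contour _ _ _ _ _.
move=> /(_ _) k4 /(_ _) k3 /(_ _) k2 /(_ _) k1.
have := le_normcD (c4 + c3 + c2) c1; have := le_normcD (c4 + c3) c2; have := le_normcD c4 c3.
have := k1 ltac:(lia); have := k2 ltac:(lia); have := k3 ltac:(lia); have := k4 ltac:(lia).
have -> : c * (h / 2) ^+ 2 = c * h ^+ 2 / 4 by field.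
lra.
Qed.

Lemma goursat : (forall x y, 0 <= x <= 1 -> 0 <= y <= 1 -> cdiff F (Z x y)) ->
  forall c, 0 < c -> exists K, forall m, (K <= m)%N -> normc (contour Z (2 ^ m) 0 0 1) <= c.
Proof.
move=> HF c c0; apply: contrapT => nK.
have B0 : large_contour c 0 0 1.
  move=> K; apply: contrapT => nm; apply: nK; exists K => m Km; rewrite leNgt; apply/negP => b.
  by apply: nm; exists m => //; rewrite expr1n mulr1.
(* The corner of the next square; (0, 0) is a dummy value for squares that are not large. *)
have /choice[nx Hnx] : forall p : R * R * R, exists q : R * R,
    large_contour c p.1.1 p.1.2 p.2 ->
    [/\ q.1 = p.1.1 \/ q.1 = p.1.1 + p.2 / 2, q.2 = p.1.2 \/ q.2 = p.1.2 + p.2 / 2 & large_contour c q.1 q.2 (p.2 / 2)].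
  move=> p; have [/large_contour_split[x' [y' H]]|nb] := pselect (large_contour c p.1.1 p.1.2 p.2).
    by exists (x', y').
  by exists (0, 0) => /nb.
pose s := fix s n : R * R * R := if n is n'.+1 then (nx (s n'), (s n').2 / 2) else (0, 0, 1).
pose X n := (s n).1.1; pose Y n := (s n).1.2; pose h n := (s n).2.
have sB n : large_contour c (X n) (Y n) (h n).
  by elim: n => [//|n IH]; have [_ _] := Hnx (s n) IH.
have hS n : h n.+1 = h n / 2 by [].
have h0 n : 0 < h n by elim: n => [|n IH]; rewrite ?hS ?divr_gt0 // /h /= ltr01.
have hn n : h n = (1 / 2) ^+ n by elim: n => [|n IH]; [rewrite expr0|rewrite hS IH exprS; field].
have XS n : X n.+1 = X n \/ X n.+1 = X n + h n / 2 by have [] := Hnx (s n) (sB n).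
have YS n : Y n.+1 = Y n \/ Y n.+1 = Y n + h n / 2 by have [] := Hnx (s n) (sB n).
have nest (U : nat -> R) : U 0%N = 0 -> (forall n, U n.+1 = U n \/ U n.+1 = U n + h n / 2) ->
    exists2 u, (forall n, U n <= u <= U n + h n) & forall n, 0 <= U n /\ U n + h n <= 1.
  move=> U0 US.
  have mono n m : U n <= U (n + m)%N /\ U (n + m)%N + h (n + m)%N <= U n + h n.
    elim: m => [|m [I1 I2]]; first by rewrite addn0; split.
    rewrite addnS hS; have := h0 (n + m)%N; case: (US (n + m)%N) => ->; split; lra.
  have ub n m : U m <= U n + h n.
    have [_ A] := mono n (m - n)%N; have := h0 (n + (m - n))%N; have [B _] := mono m (n - m)%N.
    have [nm|mn] := leqP n m; first by rewrite subnKC // in A; have := h0 m; rewrite subnKC //; lra.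
    by rewrite subnKC ?(ltnW mn) // in B; have := h0 n; lra.
  have hs : has_sup (range U).
    by split; [exists (U 0%N); exists 0%N|exists (U 0%N + h 0%N) => _ [m _ <-]; exact: ub].
  exists (sup (range U)) => n.
    apply/andP; split; first by apply: sup_upper_bound => //; exists n.
    by apply: ge_sup; [case: hs|move=> _ [m _ <-]; exact: ub].
  have [A B] := mono 0%N n; rewrite add0n U0 in A B; split => //.
  have hz : h 0%N = 1 by [].
  by move: B; rewrite hz add0r.
have [xs hxs X01] := nest X erefl XS; have [ys hys Y01] := nest Y erefl YS.
have [d Hd] : cdiff F (Z xs ys).
  apply: HF; [have := hxs 0%N; have := X01 0%N|have := hys 0%N; have := Y01 0%N];
    rewrite /X /Y /h /=; lra.
have D0 : 0 < 32 * L ^+ 2 + 1 by have := sqr_ge0 L; lra.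
(* Makes the linearization error 8 e (L h)^2 of [contour_le] at most c h^2/4. *)
pose e := c / (32 * L ^+ 2 + 1).
have e0 : 0 < e by rewrite divr_gt0.
have eE : e * (32 * L ^+ 2) + e = c by rewrite /e; field; rewrite gt_eqF.
clearbody e.
have [de de0 Hde] := Hd e e0.
have [n Hn] : exists n, 2 * L * h n < de.
  have k0 : 0 < de / (2 * L + 1) by rewrite divr_gt0 //; move: L_ge0; lra.
  have hr : 0 <= (1 / 2 : R) < 1 by lra.
  have [N HN] := expr_small hr k0; exists N; rewrite hn.
  have := HN N (leqnn _); rewrite ltr_pdivlMr; last by move: L_ge0; lra.
  have : 0 < (1 / 2 : R) ^+ N by rewrite exprn_gt0 //; lra.
  lra.
have LL := L_ge0.
(* From level K on, the discretization error of [contour_le] is at most c h^2/2, since 2^m >= K. *)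
have [K HK] : exists K : nat, 8 * normc d * L ^+ 2 <= c * K%:R.
  have q0 : 0 <= 8 * normc d * L ^+ 2 / c.
    by rewrite divr_ge0 ?(ltW c0) // mulr_ge0 ?sqr_ge0 // mulr_ge0 ?normc_ge0.
  exists (Num.Def.archi_bound (8 * normc d * L ^+ 2 / c)).
  by rewrite [c * _]mulrC; have := Num.Theory.archi_boundP q0; rewrite ltr_pdivrMr // => /ltW.
have [m Km] := sB n K; apply/negP; rewrite -leNgt.
have [X0 X1] := X01 n; have [Y0 Y1] := Y01 n.
have N0 : (0 < 2 ^ m)%N by rewrite expn_gt0.
apply: le_trans (@contour_le (2 ^ m) (X n) (Y n) (h n) xs ys d e N0 (ltW e0) (ltW (h0 n)) X0 X1 Y0 Y1 (hxs n) (hys n) _) _.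
  move=> u v hu hv; apply: Hde; apply: le_lt_trans Hn.
  have := hxs n; have := hys n => kx ky.
  rewrite -mulrA; exact: (@Z_diam (X n) (Y n) (h n) _ _ _ _ (ltW (h0 n))).
have N1 : (0 : R) < (2 ^ m)%:R by rewrite ltr0n.
have NK : (K%:R : R) <= (2 ^ m)%:R by rewrite ler_nat (leq_trans Km) // ltnW // ltn_expl.
have T : 4 * (normc d * (L * h n) ^+ 2 / (2 ^ m)%:R) <= c * h n ^+ 2 / 2.
  rewrite mulrA ler_pdivrMr //.
  have a1 : 8 * normc d * L ^+ 2 <= c * (2 ^ m)%:R by apply: le_trans HK _; rewrite ler_wpM2l // ltW.
  have := ler_wpM2r (sqr_ge0 (h n)) a1; rewrite !exprMn; move: (h n ^+ 2) (L ^+ 2) => hh ll; lra.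
have : e * (32 * L ^+ 2) * h n ^+ 2 <= c * h n ^+ 2 by rewrite ler_wpM2r ?sqr_ge0 //; lra.
have := mulr_ge0 (ltW c0) (sqr_ge0 (h n)).
move: T; rewrite !exprMn; move: (h n ^+ 2) (L ^+ 2) (sqr_ge0 L) (sqr_ge0 (h n)) => hh ll l0 hh0.
lra.
Qed.

End Contour.
End Goursat.

(** * Complex differentiability *)

Section Cauchy.
Variable R : realType.
Local Notation C := R[i].
Implicit Types (x y h c e t : R) (z w : C).

Lemma cos_lip x y : `|cos x - cos y| <= `|x - y|.
Proof.
wlog xy : x y / y <= x.
  move=> H; have [yx|/ltW xy] := leP y x; first exact: H.
  by rewrite distrC (distrC x); exact: H.
have [u _ ->] := @MVT_segment R cos (fun u => - sin u) y x xy
  (fun u _ => is_derive_cos u) (continuous_subspaceT (@continuous_cos R)).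
by rewrite normrM normrN ler_piMl // sin_max.
Qed.

Lemma sin_lip x y : `|sin x - sin y| <= `|x - y|.
Proof.
wlog xy : x y / y <= x.
  move=> H; have [yx|/ltW xy] := leP y x; first exact: H.
  by rewrite distrC (distrC x); exact: H.
have [u _ ->] := @MVT_segment R sin (fun u => cos u) y x xy
  (fun u _ => is_derive_sin u) (continuous_subspaceT (@continuous_sin R)).
by rewrite normrM ler_piMl // cos_max.
Qed.

Lemma cis_lip x y : normc (cis x - cis y) <= 2 * `|x - y|.
Proof.
apply: le_trans (normc_le_ReIm _) _; rewrite /cis /=.
by have := cos_lip x y; have := sin_lip x y; lra.
Qed.

Lemma complex_gt0 (e : C) : 0 < e -> exists2 e' : R, 0 < e' & e = (e'%:C)%C.
Proof.
case: e => a b; rewrite ltcE /= => /andP[/eqP -> a0].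
by exists a.
Qed.

Lemma normcK z : ((normc z)%:C)%C = `|z|.
Proof. by []. Qed.

(** The scalars are complex, so the increment in direction 1 may be any w - z, and the directional
    derivative is the complex derivative. *)
Lemma derivable_cdiff (f : C -> C) z : derivable f z 1 -> cdiff f z.
Proof.
move=> H; pose d := 'D_1 f z; exists d => e e0.
have e0' : 0 < (e%:C)%C :> C by rewrite ltcR.
have /cvgrPdist_lt/(_ _ e0') := H.
rewrite nearE /dnbhs /within /= => /nbhs_ballP[de /= de0 Hd].
have [de' de'0 deE] := complex_gt0 de0.
exists de' => // w wz.
have [->|nwz] := eqVneq w z; first by rewrite !subrr mulr0 subr0 normc0 mulr0.
have h0 : w - z != 0 by rewrite subr_eq0.
have := Hd (w - z) _ h0.
rewrite /ball /= sub0r normrN deE -normcK ltcR => /(_ wz).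
rewrite /shift /= [(w - z) *: 1]mulr1 subrK.
rewrite -/('D_1 f z) -/d => L.
have L2 : normc (d - (w - z)^-1 * (f w - f z)) < e by rewrite -ltcR normcK.
have -> : f w - f z - d * (w - z) = - (d - (w - z)^-1 * (f w - f z)) * (w - z).
  by field.
rewrite Normc.normcM normcN ler_wpM2r ?normc_ge0 //; exact: ltW.
Qed.

Definition ccont (f : C -> C) z := forall e, 0 < e -> exists2 de, 0 < de &
  forall w, normc (w - z) < de -> normc (f w - f z) < e.

(* Caratheodory's form of differentiability, which reduces the rules of
   calculus to those for continuity. *)
Definition cara (f : C -> C) z := exists2 phi, ccont phi z & exists2 de, 0 < de &
  forall w, normc (w - z) < de -> f w - f z = phi w * (w - z).

Lemma ccont_cst (k : C) z : ccont (fun=> k) z.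
Proof. by move=> e e0; exists 1 => // w _; rewrite subrr normc0. Qed.

Lemma ccont_id z : ccont id z.
Proof. by move=> e e0; exists e. Qed.

Lemma ccontD f g z : ccont f z -> ccont g z -> ccont (fun w => f w + g w) z.
Proof.
move=> H K e e0; have e2 : 0 < e / 2 by lra.
have [d1 d10 L1] := H _ e2; have [d2 d20 L2] := K _ e2.
exists (Num.min d1 d2); first by rewrite lt_min d10.
move=> w; rewrite lt_min => /andP[/L1 A /L2 B].
by rewrite opprD addrACA; apply: le_lt_trans (le_normcD _ _) _; lra.
Qed.

Lemma ccontM f g z : ccont f z -> ccont g z -> ccont (fun w => f w * g w) z.
Proof.
move=> H K e e0.
have nf := normc_ge0 (f z); have ng := normc_ge0 (g z).
have T0 : 0 < normc (f z) + normc (g z) + 1 by lra.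
have [d [d0 d1 dT]] : exists d, [/\ 0 < d, d <= 1 & d * (normc (f z) + normc (g z) + 1) <= e].
  exists (Num.min 1 (e / (normc (f z) + normc (g z) + 1))); split.
  - by rewrite lt_min ltr01 divr_gt0.
  - by rewrite ge_min lexx.
  - by rewrite -ler_pdivlMr // ge_min lexx orbT.
have [d1' d10 L1] := H _ d0; have [d2' d20 L2] := K _ d0.
exists (Num.min d1' d2'); first by rewrite lt_min d10.
move=> w; rewrite lt_min => /andP[/L1 A /L2 B].
have -> : f w * g w - f z * g z = (f w - f z) * (g w - g z) + (f w - f z) * g z + f z * (g w - g z).
  by ring.
have K1 := le_normcD ((f w - f z) * (g w - g z) + (f w - f z) * g z) (f z * (g w - g z)).
have K2 := le_normcD ((f w - f z) * (g w - g z)) ((f w - f z) * g z).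
rewrite !Normc.normcM in K1 K2.
have a0 := normc_ge0 (f w - f z); have b0 := normc_ge0 (g w - g z).
have M1 : normc (f w - f z) * normc (g w - g z) <= d * normc (g w - g z) by rewrite ler_wpM2r // ltW.
have M2 : d * normc (g w - g z) < d * 1 by rewrite ltr_pM2l //; lra.
have M3 : normc (f w - f z) * normc (g z) <= d * normc (g z) by rewrite ler_wpM2r // ltW.
have M4 : normc (f z) * normc (g w - g z) <= normc (f z) * d by rewrite ler_wpM2l // ltW.
lra.
Qed.

Lemma ccontV z : z != 0 -> ccont (fun w => w^-1) z.
Proof.
move=> z0 e e0; have n0 : 0 < normc z by rewrite normc_gt0.
have h : 0 < e * normc z ^+ 2 / 2 by rewrite divr_gt0 ?mulr_gt0 ?exprn_gt0.
have h2 : 0 < normc z / 2 by lra.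
exists (Num.min (normc z / 2) (e * normc z ^+ 2 / 2)); first by rewrite lt_min h2.
move=> w; rewrite lt_min => /andP[A B].
have nw : normc z / 2 < normc w by have := normc_sub_ge z w; rewrite normc_distC; lra.
have w0 : w != 0 by rewrite -normc_gt0; lra.
have -> : w^-1 - z^-1 = - (w - z) / (w * z) by field; rewrite z0.
rewrite !Normc.normcM normcN Normc.normcV Normc.normcM ltr_pdivrMr ?mulr_gt0 ?normc_gt0 //.
apply: lt_le_trans B _.
by rewrite -mulrA ler_wpM2l ?(ltW e0) // expr2 mulrAC ler_wpM2r ?(ltW n0) // ltW.
Qed.

Lemma ccont_comp f g z : ccont f z -> ccont g (f z) -> ccont (fun w => g (f w)) z.
Proof.
move=> H K e e0; have [d d0 L] := K _ e0; have [d' d'0 L'] := H _ d0.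
by exists d' => // w /L' /L.
Qed.

Lemma cdiff_cara f z : cdiff f z -> cara f z.
Proof.
case=> d H; exists (fun w => if w == z then d else (f w - f z) / (w - z)).
  move=> e e0; have e2 : 0 < e / 2 by lra.
  have [de de0 K] := H _ e2; exists de => // w wz; rewrite eqxx.
  have [_|nwz] := eqVneq w z; first by rewrite subrr normc0.
  have h0 : w - z != 0 by rewrite subr_eq0.
  have n0 : 0 < normc (w - z) by rewrite normc_gt0.
  have -> : (f w - f z) / (w - z) - d = (f w - f z - d * (w - z)) / (w - z) by field.
  rewrite Normc.normcM Normc.normcV ltr_pdivrMr //.
  by apply: le_lt_trans (K w wz) _; rewrite ltr_pM2r //; lra.
exists 1 => // w _; have [->|nwz] := eqVneq w z; first by rewrite !subrr mulr0.
by rewrite divfK // subr_eq0.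
Qed.

Lemma cara_cdiff f z : cara f z -> cdiff f z.
Proof.
case=> phi pc [d d0 E]; exists (phi z) => e e0.
have [d' d'0 L] := pc _ e0; exists (Num.min d d'); first by rewrite lt_min d0.
move=> w; rewrite lt_min => /andP[/E -> /L wd].
by rewrite -mulrBl Normc.normcM ler_wpM2r ?normc_ge0 // ltW.
Qed.

Lemma cara_cont f z : cara f z -> ccont f z.
Proof.
case=> phi pc [d d0 E].
have c1 : ccont (fun w => w + - z) z by apply: ccontD; [exact: ccont_id|exact: ccont_cst].
have := ccontM pc c1 => H e e0; have [d' d'0 L] := H _ e0.
exists (Num.min d d'); first by rewrite lt_min d0.
by move=> w; rewrite lt_min => /andP[/E -> /L]; rewrite subrr mulr0 subr0.
Qed.

Lemma cara_cst (k : C) z : cara (fun=> k) z.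
Proof.
exists (fun=> 0); first exact: ccont_cst.
by exists 1 => // w _; rewrite subrr mul0r.
Qed.

Lemma cara_id z : cara id z.
Proof.
exists (fun=> 1); first exact: ccont_cst.
by exists 1 => // w _; rewrite mul1r.
Qed.

Lemma caraD f g z : cara f z -> cara g z -> cara (fun w => f w + g w) z.
Proof.
case=> p pc [d d0 E] [q qc [d' d'0 E']].
exists (fun w => p w + q w); first exact: ccontD.
exists (Num.min d d'); first by rewrite lt_min d0.
by move=> w; rewrite lt_min => /andP[/E A /E' B]; rewrite mulrDl -A -B; ring.
Qed.

Lemma caraM f g z : cara f z -> cara g z -> cara (fun w => f w * g w) z.
Proof.
move=> F G; have gc := cara_cont G; move: F G; case=> p pc [d d0 E] [q qc [d' d'0 E']].
exists (fun w => p w * g w + f z * q w).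
  by apply: ccontD; apply: ccontM => //; exact: ccont_cst.
exists (Num.min d d'); first by rewrite lt_min d0.
move=> w; rewrite lt_min => /andP[/E A /E' B].
by rewrite mulrDl mulrAC -A -mulrA -B; ring.
Qed.

Lemma caraV z : z != 0 -> cara (fun w => w^-1) z.
Proof.
move=> z0; exists (fun w => - z^-1 * w^-1).
  by apply: ccontM; [exact: ccont_cst|exact: ccontV].
have n0 : 0 < normc z by rewrite normc_gt0.
exists (normc z) => // w wz.
have w0 : w != 0.
  by apply/eqP => w0; move: wz; rewrite w0 sub0r normcN ltxx.
by field; rewrite z0 w0.
Qed.

Lemma cara_comp f g z : cara f z -> cara g (f z) -> cara (fun w => g (f w)) z.
Proof.
move=> F; have fc := cara_cont F; move: F; case=> p pc [d d0 E] [q qc [d' d'0 E']].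
exists (fun w => q (f w) * p w); first by apply: ccontM => //; exact: ccont_comp.
have [d2 d20 L] := fc _ d'0.
exists (Num.min d d2); first by rewrite lt_min d0.
by move=> w; rewrite lt_min => /andP[/E A /L B]; rewrite E' // A mulrA.
Qed.

Lemma cara_inv f z : cara f z -> f z != 0 -> cara (fun w => (f w)^-1) z.
Proof. by move=> F f0; apply: cara_comp F _; exact: caraV. Qed.

End Cauchy.

(** * Taylor expansion of bounded holomorphic functions *)

Section CauchyTaylor.
Variable R : realType.
Local Notation C := R[i].
Implicit Types (x y h c e t : R) (z w : C).

Lemma normc_conj z : normc (z^*)%C = normc z.
Proof. by case: z => a b; rewrite /Normc.normc /= sqrrN. Qed.

Lemma conjc_sum (I : Type) (s : seq I) (F : I -> C) :
  (\sum_(i <- s) F i)^*%C = \sum_(i <- s) (F i)^*%C.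
Proof.
elim: s => [|i s IH]; first by rewrite !big_nil conjc0.
by rewrite !big_cons -IH; exact: rmorphD.
Qed.

(** The half power minus 1 equals -2 and factors as om - 1 times a sum of 2^m unit terms. *)
Lemma om_gap m : 4 <= (2 ^ m.+1)%:R * normc (om R m.+1 - 1).
Proof.
have : normc (om R m.+1 ^+ (2 ^ m) - 1) = 2.
  rewrite om_half -opprD normcN (_ : 1 + 1 = (2 : R)%:C%C) ?normc_real ?ger0_norm //.
  by rewrite rmorph_nat.
rewrite subrX1 Normc.normcM => E.
have K : normc (\sum_(i < 2 ^ m) om R m.+1 ^+ i) <= (2 ^ m)%:R.
  apply: le_trans (normc_sum _ _ _) _.
  under eq_bigr do rewrite normcX normc_om expr1n.
  by rewrite sumr_const card_ord.
have := ler_wpM2l (normc_ge0 (om R m.+1 - 1)) K; rewrite E expnS natrM.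
lra.
Qed.

Definition quo (f : C -> C) z0 w := (f w - f z0) / (w - z0).
Definition pt r m (q : nat) : C := (r%:C)%C * om R m ^+ q.

Lemma cara_quo f z0 z : cara f z -> z != z0 -> cara (quo f z0) z.
Proof.
move=> F zz; apply: caraM.
  by apply: caraD => //; exact: cara_cst.
apply: cara_inv; last by rewrite subr_eq0.
by apply: caraD; [exact: cara_id|exact: cara_cst].
Qed.

(** Discrete Cauchy theorem for the difference quotient. The unit square is mapped onto the region
    between the circle of radius r and its image under a small homothety centred at z0. Thus z0 is
    avoided, and [goursat] compares the two curves. *)
Lemma mean_quot f z0 r : (forall z, normc z < 1 -> cara f z) -> normc z0 < r -> r < 1 ->
  forall e, 0 < e -> exists K, forall m, (K <= m)%N ->
   normc ((2 ^ m)%:R^-1 * \sum_(q < 2 ^ m) quo f z0 (pt r m q) * pt r m q) <= e.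
Proof.
move=> Hf z0r r1 e e0.
have nz0 := normc_ge0 z0.
have [d Hd] : cdiff f z0 by apply/cara_cdiff/Hf; lra.
have [de de0 Hde] := Hd 1 ltr01.
pose G := normc d + 1.
have G0 : 0 < G by have := normc_ge0 d; rewrite /G; lra.
have p0 : 0 < pi :> R := pi_gt0 R.
have T0 : 0 < 4 * pi * G by rewrite !mulr_gt0.
(* Ratio of the inner curve: 2 si < de keeps it where the quotient is at most G, and the last
   condition bounds the sum over it by e, 4 pi being a Lipschitz constant of the outer curve. *)
have [si [si0 si1 si2 si3]] : exists si : R, [/\ 0 < si, si <= 1 / 2, 2 * si < de & si * (4 * pi * G) <= e].
  exists (Num.min (1 / 2) (Num.min (de / 3) (e / (4 * pi * G)))); split.
  - by rewrite !lt_min !divr_gt0.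
  - by rewrite ge_min lexx.
  - have : Num.min (1 / 2) (Num.min (de / 3) (e / (4 * pi * G))) <= de / 3 by rewrite !ge_min lexx orbT.
    lra.
  - by rewrite -ler_pdivlMr // !ge_min lexx !orbT.
pose rho (s : R) := si + (1 - si) * s.
pose cr t : C := (r%:C)%C * cis (2 * pi * t) - z0.
pose Z s t : C := z0 + ((rho s)%:C)%C * cr t.
have ncis t : normc ((r%:C)%C * cis (2 * pi * t)) = r.
  by rewrite Normc.normcM normc_cis mulr1 normc_real ger0_norm //; lra.
have cr2 t : normc (cr t) <= 2.
  have := le_normcD ((r%:C)%C * cis (2 * pi * t)) (- z0); rewrite normcN ncis -/(cr t); lra.
have cr_lip t t' : normc (cr t - cr t') <= 4 * pi * `|t - t'|.
  rewrite /cr opprB addrA subrK -mulrBr Normc.normcM normc_real ger0_norm; last lra.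
  have := cis_lip (2 * pi * t) (2 * pi * t'); rewrite -mulrBr normrM ger0_norm; last by rewrite mulr_ge0 // ltW.
  move=> H; apply: (@le_trans _ _ (1 * normc (cis (2 * pi * t) - cis (2 * pi * t')))).
    by rewrite ler_wpM2r ?normc_ge0 //; lra.
  by apply: le_trans (_ : 2 * (2 * pi * `|t - t'|) <= _); lra.
have rho01 s : 0 <= s <= 1 -> si <= rho s <= 1.
  by move=> s01; rewrite /rho; apply/andP; split; nra.
pose L : R := 2 + 4 * pi.
have L0 : 0 <= L by rewrite /L; lra.
have Zlip s t s' t' : 0 <= s <= 1 -> 0 <= t <= 1 -> 0 <= s' <= 1 -> 0 <= t' <= 1 ->
    normc (Z s t - Z s' t') <= L * (`|s - s'| + `|t - t'|).
  move=> hs ht hs' ht'.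
  have -> : Z s t - Z s' t' = ((rho s - rho s')%:C)%C * cr t + ((rho s')%:C)%C * (cr t - cr t').
    by rewrite /Z rmorphB /=; ring.
  apply: le_trans (le_normcD _ _) _; rewrite !Normc.normcM !normc_real.
  have -> : rho s - rho s' = (1 - si) * (s - s') by rewrite /rho; ring.
  have /andP[h1 h2] := rho01 _ hs'.
  rewrite normrM (ger0_norm (_ : 0 <= 1 - si)) ?(ger0_norm (_ : 0 <= rho s')); try lra.
  have a0 := normr_ge0 (s - s'); have b0 := normr_ge0 (t - t').
  have k1 : (1 - si) * `|s - s'| * normc (cr t) <= `|s - s'| * 2.
    apply: ler_pM => //; rewrite ?normc_ge0 ?mulr_ge0 //; first lra.
    by rewrite ler_piMl //; lra.
  have k2 : rho s' * normc (cr t - cr t') <= 4 * pi * `|t - t'|.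
    apply: le_trans (cr_lip t t'); rewrite ler_piMl ?normc_ge0 //.
  have pa : 0 <= pi * `|s - s'| by rewrite mulr_ge0 // ltW.
  have pb : 0 <= pi * `|t - t'| by rewrite mulr_ge0 // ltW.
  rewrite /L; lra.
have cr0 t : 0 < normc (cr t).
  by have := normc_sub_ge ((r%:C)%C * cis (2 * pi * t)) z0; rewrite ncis -/(cr t); lra.
have Znz s t : 0 <= s <= 1 -> Z s t != z0.
  move=> hs; have := rho01 _ hs => hr; rewrite -subr_eq0 /Z addrAC subrr add0r -normc_gt0.
  by rewrite Normc.normcM normc_real mulr_gt0 // ger0_norm; lra.
have ZD s t : 0 <= s <= 1 -> normc (Z s t) < 1.
  move=> hs; have := rho01 _ hs => hr.
  have -> : Z s t = ((1 - rho s)%:C)%C * z0 + ((rho s)%:C)%C * ((r%:C)%C * cis (2 * pi * t)).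
    by rewrite /Z /cr rmorphB rmorph1 /=; ring.
  apply: le_lt_trans (le_normcD _ _) _.
  rewrite [normc (_ * z0)]Normc.normcM [normc ((rho s)%:C%C * _)]Normc.normcM ncis !normc_real !ger0_norm; try lra.
  have h1 : (1 - rho s) * normc z0 <= (1 - rho s) * r by rewrite ler_wpM2l; lra.
  lra.
have gc s t : 0 <= s <= 1 -> 0 <= t <= 1 -> cdiff (quo f z0) (Z s t).
  by move=> hs ht; apply/cara_cdiff/cara_quo; [exact/Hf/ZD|exact: Znz].
have [K HK] := goursat L0 Zlip gc e0.
exists K.+1 => -[//|m]; rewrite ltnS => Km; have := HK m.+1 (leqW Km).
set N := (2 ^ m.+1)%N.
have N0 : (0 : R) < N%:R by rewrite ltr0n expn_gt0.
rewrite /contour.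
(* By periodicity the two radial edges coincide, so they cancel in the contour. *)
have -> : Z^~ 0 = Z^~ (0 + 1).
  apply/funext => s; rewrite /Z /cr add0r mulr0 mulr1 cis0.
  have -> : cis (2 * pi) = 1 :> C by rewrite mulr2n mulrDl mul1r cisD cis_pi mulrNN mulr1.
  by [].
have zq q : Z (0 + 1) (0 + q%:R * (1 / N%:R)) = pt r m.+1 q.
  have r1E : rho (0 + 1) = 1 by rewrite /rho; ring.
  rewrite /Z r1E rmorph1 !mul1r /cr [LHS]addrC subrK add0r /pt /om.
  rewrite cis_exp -mulr_natr; congr (_ * cis _); rewrite -/N; field.
  by rewrite gt_eqF.
have -> : stieltjes (quo f z0) N (Z (0 + 1)) 0 1 = (om R m.+1 - 1) * \sum_(q < N) quo f z0 (pt r m.+1 q) * pt r m.+1 q.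
  rewrite /stieltjes mulr_sumr; apply: eq_bigr => q _; rewrite !zq.
  by rewrite /pt exprS; ring.
have B0 : normc (stieltjes (quo f z0) N (Z 0) 0 1) <= e.
  apply: le_trans (normc_sum _ _ _) _.
  have s0 : 0 <= (0 : R) <= 1 by rewrite lexx ler01.
  apply: (@le_trans _ _ (\sum_(q < N) G * (si * (4 * pi * (1 / N%:R))))).
    apply: ler_sum => q _; rewrite Normc.normcM; apply: ler_pM; rewrite ?normc_ge0 //.
      set t := 0 + _; have nz := Znz 0 t s0.
      have dz : 0 < normc (Z 0 t - z0) by rewrite normc_gt0 subr_eq0.
      rewrite /quo Normc.normcM Normc.normcV ler_pdivrMr //.
      have sm : normc (Z 0 t - z0) < de.
        rewrite /Z addrAC subrr add0r Normc.normcM normc_real /rho mulr0 addr0 gtr0_norm //.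
        by apply: le_lt_trans si2; rewrite mulrC ler_wpM2r // ltW.
      have := Hde _ sm; have := normc_sub_ge (f (Z 0 t) - f z0) (d * (Z 0 t - z0)).
      by rewrite Normc.normcM /G; lra.
    rewrite /Z opprD addrACA subrr add0r -mulrBr Normc.normcM normc_real /rho mulr0 addr0 gtr0_norm //.
    rewrite ler_wpM2l ?(ltW si0) //; apply: le_trans (cr_lip _ _) _.
    have -> : (0 : R) + q.+1%:R * (1 / N%:R) - (0 + q%:R * (1 / N%:R)) = 1 / N%:R by rewrite -natr1; ring.
    by rewrite ger0_norm // divr_ge0 // ltW.
  rewrite sumr_const card_ord -[leLHS]mulr_natr.
  have -> : G * (si * (4 * pi * (1 / N%:R))) * N%:R = si * (4 * pi * G) by field; rewrite gt_eqF.
  exact: si3.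
set S := \sum_(q < N) _; set A := (om R m.+1 - 1) * S.
set B := stieltjes _ _ _ _ _ in B0 *; set D := stieltjes _ _ _ _ _.
have -> : D + A - D - B = A - B by ring.
move=> H.
(* The outer sum is om - 1 times the sum S, and has modulus at most 2 e; dividing by |om - 1| >= 4/N
   bounds the mean by e/2. *)
have := normc_sub_ge A B => H2.
have H3 : normc (om R m.+1 - 1) * normc S <= 2 * e by rewrite -Normc.normcM -/A; lra.
have H4 := om_gap m; rewrite -/N in H4.
have NC : normc ((N%:R : C)^-1) = N%:R^-1.
  by rewrite Normc.normcV -(rmorph_nat (real_complex R)) normc_real normr_nat.
rewrite Normc.normcM NC mulrC ler_pdivrMr //.
have H5 := ler_wpM2r (normc_ge0 S) H4.
have H6 := ler_wpM2l (ltW N0) H3.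
have := normc_ge0 S; have : 0 < e * N%:R by rewrite mulr_gt0.
lra.
Qed.

Lemma sum_trunc (F : nat -> R) L Q : (forall k, 0 <= F k) -> (forall k, (Q <= k)%N -> F k = 0) ->
  \sum_(k < L) F k <= \sum_(k < Q) F k.
Proof.
move=> F0 FQ; rewrite -!(big_mkord xpredT F).
have [h|h] := leqP L Q; first by rewrite (big_cat_nat (leq0n L) h) //= lerDl sumr_ge0.
rewrite (big_cat_nat (leq0n Q) (ltnW h)) //= gerDl big_nat_cond big1 // => i /andP[/andP[h1 _] _].
exact: FQ.
Qed.

(** The polynomials with the discrete Fourier coefficients of f on the circle of radius r have
    squared norm at most S^2 by Parseval, and [mean_quot] makes them converge to the dilation of
    f. *)
Lemma Hq_scaled f S r : (forall z, normc z < 1 -> cara f z) -> (forall z, normc z < 1 -> normc (f z) <= S) ->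
  0 < r -> r < 1 -> Hq (fun z => f ((r%:C)%C * z)) (S ^+ 2).
Proof.
move=> Hf HS r0 r1.
have npt m q : normc (pt r m q) = r.
  by rewrite /pt Normc.normcM normcX normc_om expr1n mulr1 normc_real gtr0_norm.
pose b m n : C := (2 ^ m)%:R^-1 * \sum_(j < 2 ^ m) f (pt r m j) * (om R m ^+ (j * n))^*%C.
pose p m : {poly C} := \poly_(n < 2 ^ m) b m n.
have h0 : normc (0 : C) < 1 by rewrite normc0 ltr01.
have S0 : 0 <= S := le_trans (normc_ge0 _) (HS 0 h0).
apply: (@Hq_lim R (fun m z => (p m).[z])) => [m|w w1].
  apply: Hq_poly => n.
  have Q0 : (0 : R) < (2 ^ m)%:R by rewrite ltr0n expn_gt0.
  apply: le_trans (@sum_trunc (fun k => normc (p m)`_k ^+ 2) n (2 ^ m) _ _) _.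
  - by move=> k; exact: sqr_ge0.
  - by move=> k mk; rewrite nth_default ?normc0 ?expr0n // (leq_trans (size_poly _ _)).
  have E (k : 'I_(2 ^ m)) : normc (p m)`_k ^+ 2 = (2 ^ m)%:R^-1 ^+ 2 *
      normc (\sum_(j < 2 ^ m) (f (pt r m j))^*%C * om R m ^+ (j * k)) ^+ 2.
    rewrite coef_poly ltn_ord /b Normc.normcM exprMn; congr (_ ^+ 2 * _ ^+ 2).
      by rewrite Normc.normcV -(rmorph_nat (real_complex R)) normc_real normr_nat.
    rewrite -normc_conj conjc_sum; congr normc; apply: eq_bigr => j _.
    by rewrite conjcM conjcK.
  under eq_bigr do rewrite E.
  rewrite -mulr_sumr (parseval m (fun j => (f (pt r m j))^*%C)).
  rewrite expr2 -mulrA mulKf ?gt_eqF // mulrC ler_pdivrMr // mulr_natr.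
  rewrite -[X in _ *+ X]card_ord -sumr_const; apply: ler_sum => j _.
  by rewrite normc_conj lerXn2r ?nnegrE ?normc_ge0 // HS // npt.
pose z0 := (r%:C)%C * w.
have rC : (r%:C)%C != 0 :> C by rewrite -normc_gt0 normc_real normr_gt0 gt_eqF.
have z0r : normc z0 < r.
  by rewrite /z0 Normc.normcM normc_real gtr0_norm // gtr_pMr.
(* With Q = 2^m, the polynomial at w averages f(pt_j) against the geometric sums (1 - w^Q)/(1 -
   ze_j), whose mean is 1; and pt_j (1 - ze_j) = pt_j - z0. *)
have key m : (p m).[w] - f z0 = (2 ^ m)%:R^-1 * (\sum_(q < 2 ^ m) quo f z0 (pt r m q) * pt r m q) * (1 - w ^+ (2 ^ m)).
  have QC : ((2 ^ m)%:R : C) != 0 by rewrite pnatr_eq0 -lt0n expn_gt0.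
  pose ze (j : nat) : C := (om R m ^+ j)^*%C * w.
  have zeX j n : ze j ^+ n = (om R m ^+ (j * n))^*%C * w ^+ n.
    rewrite /ze exprMn exprM; congr (_ * _).
    by elim: n => [|n IH]; rewrite ?expr0 ?conjc1 // !exprS IH conjcM.
  have zeQ j : ze j ^+ (2 ^ m) = w ^+ (2 ^ m).
    by rewrite zeX mulnC exprM om_full expr1n conjc1 mul1r.
  have zept j : ze j * pt r m j = z0.
    have E1 : (om R m ^+ j)^*%C * om R m ^+ j = 1.
      by rewrite mulrC -normc_sqrJ normcX normc_om !expr1n.
    rewrite -[RHS]mul1r -E1 /ze /pt /z0; ring.
  have pw : (p m).[w] = (2 ^ m)%:R^-1 * \sum_(j < 2 ^ m) f (pt r m j) * \sum_(n < 2 ^ m) ze j ^+ n.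
    rewrite horner_poly mulr_sumr; under eq_bigr do rewrite /b -mulrA mulr_suml mulr_sumr.
    rewrite exchange_big /=; apply: eq_bigr => j _; rewrite !mulr_sumr; apply: eq_bigr => n _.
    by rewrite zeX; ring.
  have one : \sum_(j < 2 ^ m) \sum_(n < 2 ^ m) ze j ^+ n = (2 ^ m)%:R.
    rewrite exchange_big /=.
    have E (n : 'I_(2 ^ m)) : \sum_(j < 2 ^ m) ze j ^+ n = if (0%N == n) then (2 ^ m)%:R else 0.
      have N0 : (0 < 2 ^ m)%N by rewrite expn_gt0.
      have := om_orth R N0 (ltn_ord n).
      under eq_bigr do rewrite mul0n expr0 mul1r mulnC.
      move=> E; under eq_bigr do rewrite zeX; rewrite -mulr_suml E.
      by case: eqP => [<-|_]; rewrite ?expr0 ?mulr1 ?mul0r.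
    under eq_bigr do rewrite E.
    have N0 : (0 < 2 ^ m)%N by rewrite expn_gt0.
    by rewrite (bigD1 (Ordinal N0)) //= big1 ?addr0 // => i; rewrite eq_sym -val_eqE /= => /negPf ->.
  have fz : f z0 = (2 ^ m)%:R^-1 * \sum_(j < 2 ^ m) f z0 * \sum_(n < 2 ^ m) ze j ^+ n.
    by rewrite -mulr_sumr one mulrCA mulVf // mulr1.
  rewrite pw {1}fz -mulrBr -sumrB -mulrA mulr_suml; congr (_ * _); apply: eq_bigr => j _.
  rewrite -mulrBl /quo.
  have pn : pt r m j - z0 != 0.
    by rewrite -normc_gt0; have := normc_sub_ge (pt r m j) z0; rewrite npt; lra.
  have -> : 1 - w ^+ (2 ^ m) = (1 - ze j) * \sum_(n < 2 ^ m) ze j ^+ n.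
    rewrite -(zeQ j) -[in LHS](expr1n C (2 ^ m)) subrXX; congr (_ * _); apply: eq_bigr => n _.
    by rewrite expr1n mul1r.
  set T := \sum_(n < 2 ^ m) _.
  have <- : pt r m j * (1 - ze j) = pt r m j - z0 by rewrite mulrBr mulr1 [pt r m j * ze j]mulrC zept.
  have pn2 : pt r m j * (1 - ze j) != 0 by rewrite mulrBr mulr1 [pt r m j * ze j]mulrC zept.
  move: pn2; rewrite mulf_eq0 negb_or => /andP[pa pb].
  by field; rewrite pa pb.
have w0 := normc_ge0 w.
move=> e e0; have e2 : 0 < e / 3 by lra.
have [K HK] := mean_quot Hf z0r r1 e2; exists K => m /HK H.
rewrite key Normc.normcM.
have n1 : normc (1 - w ^+ (2 ^ m)) <= 2.
  have := le_normcD 1 (- w ^+ (2 ^ m)); rewrite normcN normcX normc1.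
  have : normc w ^+ (2 ^ m) <= 1 by rewrite exprn_ile1 // ltW.
  lra.
have := ler_pM (normc_ge0 _) (normc_ge0 _) H n1; lra.
Qed.

Lemma bounded_Hq f S : (forall z, normc z < 1 -> cara f z) -> (forall z, normc z < 1 -> normc (f z) <= S) ->
  Hq f (S ^+ 2).
Proof.
move=> Hf HS; pose r (N : nat) : R := 1 - (1 / 2) ^+ N.+1.
have h2 : 0 < (1 / 2 : R) by lra.
have rr N : 0 < (1 / 2 : R) ^+ N.+1 <= 1 / 2.
  rewrite exprn_gt0 //= exprS.
  have : (1 / 2 : R) ^+ N <= 1 by apply: exprn_ile1; lra.
  by move: ((1 / 2) ^+ N) => u; lra.
apply: (@Hq_lim R (fun N z => f ((r N)%:C%C * z))) => [N|z z1].
  by apply: Hq_scaled => //; have := rr N; rewrite /r; move: (_ ^+ N.+1) => u; lra.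
move=> e e0; have [de de0 H] := cara_cont (Hf z z1) e0.
have hr : 0 <= (1 / 2 : R) < 1 by lra.
have [N HN] := expr_small hr de0; exists N => n Nn; apply: H.
have -> : (r n)%:C%C * z - z = - ((1 / 2) ^+ n.+1)%:C%C * z.
  by rewrite /r rmorphB rmorph1 /=; ring.
rewrite Normc.normcM normcN normc_real.
have /andP[a b] := rr n; rewrite gtr0_norm //.
have := HN n.+1 (leqW Nn); have := normc_ge0 z.
move: ((1 / 2) ^+ n.+1) a b => u a b z0 ud; nra.
Qed.

End CauchyTaylor.

#[local] Arguments Normc.normc {R} x : simpl never.
(** * Composition and multiplication operators *)

Section Operators.
Variable R : realType.
Local Notation C := R[i].
Implicit Types (x y h c e t : R) (z w : C) (f g : C -> C).

Definition ev (th : {poly R}) z : C := (map_poly (real_complex R) th).[z].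

Lemma evE (th : {poly R}) z n : (size th <= n)%N -> ev th z = \sum_(i < n) (th`_i)%:C%C * z ^+ i.
Proof.
move=> sn; rewrite /ev (horner_coef_wide _ (n := n)).
  by apply: eq_bigr => i _; rewrite coef_map.
by apply: leq_trans sn; exact: size_poly.
Qed.

Lemma ev_bino b z : ev (bino b) z = 1 - (b%:C)%C * (1 - z).
Proof.
have sb : (size (bino b) <= 2)%N by move: (size_bino b 1); rewrite expr1.
rewrite (evE z sb).
rewrite !big_ord_recl big_ord0 /= !coefD !coefC !coefZ !coefX /= expr0 expr1.
by rewrite mulr0 addr0 add0r mulr1 rmorphB rmorph1 /=; ring.
Qed.

(** Nonnegative coefficients give |th(z)| <= th(|z|) = 1 - (1 - |z|) q(|z|), and q is positive at
    |z|. *)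
Lemma ev_pgf (th q : {poly R}) z : pnn th -> pnn q -> 0 < q`_0 -> 1 - th = (1 - 'X) * q ->
  normc z < 1 -> normc (ev th z) < 1.
Proof.
move=> tn qn q0 H z1.
have z0 := normc_ge0 z.
apply: (@le_lt_trans _ _ th.[normc z]).
  rewrite (@evE _ _ _ (leqnn _)) horner_coef; apply: le_trans (normc_sum _ _ _) _.
  by apply: ler_sum => i _; rewrite Normc.normcM normcX normc_real ger0_norm.
have : (1 - th).[normc z] = (1 - normc z) * q.[normc z] by rewrite H hornerM hornerD hornerN hornerX hornerC.
rewrite hornerD hornerN hornerC => E.
have qz : 0 < q.[normc z].
  have : size q != 0%N by rewrite size_poly_eq0; apply/eqP => q00; move: q0; rewrite q00 coef0 ltxx.
  rewrite horner_coef; case: (size q) => [//|m] _; rewrite big_ord_recl expr0 mulr1.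
  by apply: ltr_pwDl => //; rewrite sumr_ge0 // => i _; rewrite mulr_ge0 ?exprn_ge0.
have : 0 < (1 - normc z) * q.[normc z] by rewrite mulr_gt0 //; lra.
lra.
Qed.

Lemma psum_compo (a : nat -> C) (th : {poly R}) z N :
  (\sum_(n < N) a n *: (map_poly (real_complex R) th) ^+ n).[z] = psum a (ev th z) N.
Proof.
rewrite horner_sum; apply: eq_bigr => n _; by rewrite hornerZ horner_exp.
Qed.

Lemma coef_compo (a : nat -> C) (th : {poly R}) N m :
  (\sum_(n < N) a n *: (map_poly (real_complex R) th) ^+ n)`_m = \sum_(n < N) ((th ^+ n)`_m)%:C%C * a n.
Proof.
rewrite coef_sum; apply: eq_bigr => n _; rewrite coefZ -rmorphXn coef_map /= mulrC //.
Qed.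

Lemma Hq_compo (th q : {poly R}) f qf : pnn th -> pnn q -> 0 < q`_0 -> 1 - th = (1 - 'X) * q ->
  Hq f qf -> Hq (fun z => f (ev th z)) ((q`_0)^-1 * qf).
Proof.
move=> tn qn q0 H [a [fa qa]].
apply: (@Hq_lim R (fun N z => (\sum_(n < N) a n *: (map_poly (real_complex R) th) ^+ n).[z])) => [N|z z1].
  apply: Hq_poly => M.
  have := pgf_Schur tn qn q0 H M N a; rewrite /sq2.
  under [X in _ -> X <= _]eq_bigr do rewrite coef_compo.
  move=> S; apply: le_trans S _; rewrite ler_wpM2l ?invr_ge0 ?(ltW q0) //.
move=> e e0; have [N HN] := fa _ (ev_pgf tn qn q0 H z1) e e0; exists N => n Nn.
by rewrite psum_compo; exact: HN.
Qed.

Lemma Hq_Phi_sub a f qf (c : C) (rho t : R) : 0 < a -> a <= 1 / 4 -> 0 < t ->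
  normc c ^+ 2 <= rho -> normc (1 - c) ^+ 2 <= rho -> Hq f qf ->
  Hq (fun z => f (ev (Phi a) z) - c * f z) (((1 + t) * rho + (1 + t^-1) * eps_a a) * qf).
Proof.
move=> a0 a1 t0 h1 h2 [u [fu qu]].
have rho0 : 0 <= rho by apply: le_trans h1; exact: sqr_ge0.
have ti : 0 < t^-1 by rewrite invr_gt0.
have ea0 : 0 <= eps_a a by rewrite /eps_a; have := sqrtr_ge0 a; lra.
have K0 : 0 <= (1 + t) * rho + (1 + t^-1) * eps_a a.
  by rewrite addr_ge0 // mulr_ge0 //; lra.
pose p N : {poly C} := \sum_(n < N) u n *: (map_poly (real_complex R) (Phi a)) ^+ n - c *: \poly_(n < N) u n.
apply: (@Hq_lim R (fun N z => (p N).[z])) => [N|z z1].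
  apply: Hq_poly => L.
  (* [Phi_sub_le] concerns square sections; padding with zeros up to M accommodates both the N terms
     of the partial sum and the L coefficients to be bounded. *)
  pose M := (L + N)%N; pose x n := if (n < N)%N then u n else 0.
  have trunc (F : nat -> C) : (forall n, (N <= n)%N -> F n = 0) -> \sum_(n < N) F n = \sum_(n < M) F n.
    move=> F0; rewrite -!(big_mkord xpredT F) [RHS](big_cat_nat (leq0n N)) ?leq_addl //=.
    rewrite [X in _ = _ + X]big_nat_cond [X in _ = _ + X]big1 ?addr0 // => i /andP[/andP[h _] _]; exact: F0.
  have E m : (p N)`_m = \sum_(n < M) ((Phi a ^+ n)`_m)%:C%C * x n - c * x m.
    rewrite /p coefB coefZ coef_poly coef_compo -/(x m); congr (_ - _).
    rewrite -(trunc (fun n => ((Phi a ^+ n)`_m)%:C%C * x n)) => [|n Nn]; last by rewrite /x ltnNge Nn /= mulr0.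
    by apply: eq_bigr => n _; rewrite /x ltn_ord.
  have := Phi_sub_le a0 a1 M x t0 h1 h2; rewrite /sq2 => S.
  apply: (@le_trans _ _ (\sum_(m < M) normc (p N)`_m ^+ 2)).
    rewrite -!(big_mkord xpredT (fun m => normc (p N)`_m ^+ 2)) [leRHS](big_cat_nat (leq0n L)) ?leq_addr //=.
    by rewrite lerDl sumr_ge0 // => i _; exact: sqr_ge0.
  under eq_bigr do rewrite E.
  apply: le_trans S _; rewrite ler_wpM2l //; apply: le_trans (qu M).
  apply: ler_sum => i _; rewrite /x; case: ifP => // _.
  by rewrite normc0 expr0n sqr_ge0.
have th1 : normc (ev (Phi a) z) < 1.
  apply: (ev_pgf (Phi_pnn a0 a1) (lin_pnn _ _) _ (Phi_1sub a)) => //; try lra.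
  by rewrite coefD coefC coefZ coefX /= mulr0 addr0; lra.
have S1 : seq_lim (fun N => psum u (ev (Phi a) z) N) (f (ev (Phi a) z)) by exact: fu.
have S2 : seq_lim (fun N => psum u z N) (f z) by exact: fu.
have S3 := seq_limD S1 (seq_limZ (- c) S2).
move=> e e0; have [N HN] := S3 _ e0; exists N => n /HN.
rewrite /p hornerD hornerN hornerZ psum_compo horner_poly -/(psum u z n) !mulNr; exact.
Qed.

Lemma Hq_shift f q : Hq f q -> Hq (fun z => z * f z) q.
Proof.
case=> a [fa qa]; exists (fun k => if k is k'.+1 then a k' else 0); split => [z z1|[|n]].
- have S : forall n, psum (fun k => if k is k'.+1 then a k' else 0) z n.+1 = z * psum a z n.
    by move=> n; rewrite psumS add0r.
  have := seq_limZ z (fa z z1 : seq_lim (psum a z) (f z)) => H e e0.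
  by have [N HN] := H e e0; exists N.+1 => -[//|n]; rewrite ltnS S => /HN.
- by rewrite big_ord0; have := qa 0%N; rewrite big_ord0.
- by rewrite big_ord_recl /= normc0 expr0n add0r; exact: qa.
Qed.

Lemma Hq0 : Hq (fun=> 0 : C) 0.
Proof.
apply: Hq_eq (Hq_poly (p := 0) _) => [z _|n]; first by rewrite horner0.
by rewrite big1 // => i _; rewrite coef0 normc0 expr0n.
Qed.

Lemma Hq_mul_poly f q (p : {poly C}) : Hq f q -> exists q', Hq (fun z => f z * p.[z]) q'.
Proof.
move=> H; elim/poly_ind: p => [|p c [q' IH]].
  by exists 0; apply: Hq_eq Hq0 => z _; rewrite horner0 mulr0.
eexists; apply: Hq_eq (HqD ltr01 (Hq_shift IH) (HqZ c H)) => z _.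
by rewrite hornerMXaddC; ring.
Qed.

(** [Hq_dom] needs the product to be in H^2 already. This holds with a crude bound when f is a
    polynomial, domination then gives the right bound, and it passes from the truncations of f to
    f. *)
Lemma Hq_mul chi f qc qf (S : R) : Hq chi qc -> (forall z, normc z < 1 -> normc (chi z) <= S) ->
  Hq f qf -> Hq (fun z => chi z * f z) (S ^+ 2 * qf).
Proof.
move=> Hc cS [a [fa qa]].
have S0 : 0 <= S by apply: le_trans (normc_ge0 _) (cS 0 _); rewrite normc0 ltr01.
apply: (@Hq_lim R (fun N z => chi z * (\poly_(n < N) a n).[z])) => [N|z z1].
  have Hp : Hq (fun z => (\poly_(n < N) a n : {poly C}).[z]) qf.
    apply: Hq_poly => n; apply: le_trans (qa n); apply: ler_sum => i _.
    by rewrite coef_poly; case: ifP => // _; rewrite normc0 expr0n sqr_ge0.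
  have [q' Hq'] := Hq_mul_poly (\poly_(n < N) a n) Hc.
  rewrite -[S ^+ 2 * qf]addr0; apply: Hq_dom Hp Hq' _; first exact: sqr_ge0.
  move=> z z1; rewrite addr0 Normc.normcM exprMn ler_wpM2r ?sqr_ge0 //.
  by rewrite lerXn2r ?nnegrE ?normc_ge0 // cS.
have := seq_limZ (chi z) (fa z z1 : seq_lim (psum a z) (f z)) => H e e0.
by have [N HN] := H e e0; exists N => n /HN; rewrite horner_poly.
Qed.

End Operators.

(** * Resolvents *)

Section Abstract.
Variable R : realType.
Local Notation C := R[i].
Implicit Types (x y h e t : R) (z w c lam : C) (f g : C -> C) (T U A B : (C -> C) -> (C -> C)).

Definition eqd f g := forall z, normc z < 1 -> f z = g z.

Definition linear_op T := (forall f g, eqd f g -> eqd (T f) (T g)) /\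
  forall c f g, eqd (T (fun z => c * f z + g z)) (fun z => c * T f z + T g z).

Definition sq_bounded T (k : R) := 0 <= k /\ forall f q, Hq f q -> Hq (T f) (k * q).

(* Stated without choosing an inverse operator, so that its linearity comes for
   free from uniqueness. *)
Definition has_resolvent T lam := exists2 K, 0 <= K & forall f q, Hq f q -> exists g,
  [/\ Hq g (K * q), eqd (fun z => T g z - lam * g z) f
    & forall g' q', Hq g' q' -> eqd (fun z => T g' z - lam * g' z) f -> eqd g' g].

Lemma linear_op0 T : linear_op T -> eqd (T (fun=> 0)) (fun=> 0).
Proof.
move=> [E L] z z1; have := L (-1) (fun=> 0) (fun=> 0) z z1.
have -> : T (fun w => -1 * (fun=> 0) w + (fun=> 0 : C) w) z = T (fun=> 0) z.
  by apply: E => // w _; rewrite mulr0 addr0.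
by move=> ->; rewrite mulN1r addNr.
Qed.

Lemma HqB f g q1 q2 : Hq f q1 -> Hq g q2 -> Hq (fun z => f z - g z) (2 * q1 + 2 * q2).
Proof.
move=> F G; have := HqD ltr01 F (HqZ (-1) G).
rewrite normcN normc1 expr1n mul1r invr1 => H.
by apply: Hq_eq H => z _; rewrite mulN1r.
Qed.

Lemma sqrt_small (q : R) k e : 0 <= q -> 0 <= k < 1 -> 0 < e ->
  exists N, forall n, (N <= n)%N -> Num.sqrt (k ^+ n * q) < e.
Proof.
move=> q0 k01 e0; have q1 : 0 < q + 1 by lra.
have h : 0 < e ^+ 2 / (q + 1) by rewrite divr_gt0 ?exprn_gt0.
have [N HN] := expr_small k01 h; exists N => n Nn.
rewrite -[e]gtr0_norm // -sqrtr_sqr ltr_sqrt ?exprn_gt0 //.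
have := HN n Nn; rewrite ltr_pdivlMr //.
have : 0 <= k ^+ n by rewrite exprn_ge0 //; case/andP: k01.
lra.
Qed.

(** Here k bounds the square of the norm. The iterates converge pointwise because [Hq_eval] turns
    geometric decay in H^2 into decay of values, and [Hq_lim] bounds the limit. *)
Lemma neumann U k : linear_op U -> sq_bounded U k -> k < 1 ->
  exists2 K, 0 <= K & forall f q, Hq f q -> exists2 g, Hq g (K * q) & eqd (fun z => g z - U g z) f.
Proof.
move=> UL [k0 Uk] k1.
have [t [t0 tk]] : exists t, 0 < t /\ (1 + t) * k < 1.
  exists (1 - k); split; first lra.
  have -> : (1 + (1 - k)) * k = 1 - (1 - k) ^+ 2 by ring.
  have : 0 < (1 - k) ^+ 2 by rewrite exprn_gt0 //; lra.
  by lra.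
have ti : 0 < t^-1 by rewrite invr_gt0.
have d0 : 0 < 1 - (1 + t) * k by lra.
(* Fixed point of K = (1 + 1/t) + (1 + t) k K, the estimate of [HqD] for f + U g, so that one bound
   serves all iterates. *)
pose K := (1 + t^-1) / (1 - (1 + t) * k).
have K0 : 0 < K by rewrite divr_gt0 //; lra.
have KE : K = (1 + t^-1) + (1 + t) * k * K by rewrite /K; field; rewrite !gt_eqF.
exists K; first exact: ltW.
move=> f q Hf; have q0 := Hq_ge0 Hf.
pose G := fix G n : C -> C := if n is n'.+1 then fun z => f z + U (G n') z else fun=> 0.
have HG n : Hq (G n) (K * q).
  elim: n => [|n IH]; first by apply: Hq_le (Hq0 R); rewrite mulr_ge0 // ltW.
  apply: Hq_le (HqD (_ : 0 < t^-1) Hf (Uk _ _ IH)) => //.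
  by rewrite invrK {2}KE; lra.
have HGd n m : Hq (fun z => G (n + m)%N z - G n z) (k ^+ n * (K * q)).
  elim: n => [|n IH].
    by rewrite expr0 mul1r; apply: Hq_eq (HG m) => z _; rewrite subr0.
  rewrite exprS -mulrA; apply: Hq_eq (Uk _ _ IH) => z z1.
  have [E L] := UL.
  transitivity (U (fun w => -1 * G n w + G (n + m)%N w) z).
    by apply: E => // w _; rewrite mulN1r addrC.
  by rewrite L // addSn /=; ring.
have Kq : 0 <= K * q by rewrite mulr_ge0 // ltW.
have k01 : 0 <= k < 1 by lra.
have lim z : exists l, normc z < 1 -> seq_lim (fun n => G n z) l.
  have [z1|z1] := ltP (normc z) 1; last by exists 0.
  have dz : 0 < 1 - normc z by lra.
  have [l Hl] : exists l, seq_lim (fun n => G n z) l.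
    apply: seq_cauchy_lim => e e0.
    have h : 0 < e / 2 * (1 - normc z) by rewrite mulr_gt0 // divr_gt0.
    have [N HN] := sqrt_small Kq k01 h; exists N => n m Nn Nm.
    have S p : (N <= p)%N -> normc (G p z - G N z) < e / 2.
      move=> Np; have := Hq_eval (HGd N (p - N)%N) z1; rewrite subnKC //.
      move=> H; apply: le_lt_trans H _; rewrite ltr_pdivrMr //.
      exact: HN.
    have := S n Nn; have := S m Nm; have := normc_triangle (G n z) (G N z) (G m z).
    rewrite (normc_distC (G N z)); lra.
  by exists l.
have [g Hg] := choice lim.
have Hgq : Hq g (K * q) by apply: (Hq_lim HG) => z z1; exact: Hg.
exists g => // z z1; apply/eqP; rewrite -subr_eq0 -normc_eq0 eq_le normc_ge0 andbT.
apply: eps_le => e e0; rewrite add0r.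
have dz : 0 < 1 - normc z by lra.
have Hgn n : Hq (fun w => g w - G n w) (k ^+ n * (K * q)).
  apply: (@Hq_lim R (fun m w => G (n + m)%N w - G n w)) => [m|w w1]; first exact: HGd.
  move=> d d0'; have [N HN] := Hg w w1 d d0'; exists N => m Nm.
  have -> : G (n + m)%N w - G n w - (g w - G n w) = G (n + m)%N w - g w by ring.
  by apply: HN; rewrite (leq_trans Nm) // leq_addl.
have h : 0 < e / 2 * (1 - normc z) by rewrite mulr_gt0 // divr_gt0.
have [N HN] := sqrt_small Kq k01 h.
have a1 := Hq_eval (Hgn N.+1) z1; have a2 := Hq_eval (Uk _ _ (Hgn N)) z1.
have [E L] := UL.
have a3 : U (fun w => g w - G N w) z = U g z - U (G N) z.
  transitivity (U (fun w => -1 * G N w + g w) z).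
    by apply: E => // w _; rewrite mulN1r addrC.
  by rewrite L //; ring.
rewrite a3 mulrA -exprS in a2.
have b := HN N.+1 (leqnSn N).
have b' : Num.sqrt (k ^+ N.+1 * (K * q)) / (1 - normc z) < e / 2 by rewrite ltr_pdivrMr.
have -> : g z - U g z - f z = (g z - G N.+1 z) - (U g z - U (G N) z) by rewrite /=; ring.
have := le_normcD (g z - G N.+1 z) (- (U g z - U (G N) z)); rewrite normcN.
lra.
Qed.

Lemma Hq_contr U k f q : sq_bounded U k -> k < 1 -> Hq f q -> (forall f g, eqd f g -> eqd (U f) (U g)) ->
  eqd (U f) f -> eqd f (fun=> 0).
Proof.
move=> [k0 Uk] k1 Hf E Uf z z1.
have Hn n : Hq f (k ^+ n * q).
  elim: n => [|n IH]; first by rewrite expr0 mul1r.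
  by rewrite exprS -mulrA; apply: Hq_eq Uf _; exact: Uk.
have dz : 0 < 1 - normc z by lra.
apply/eqP; rewrite -normc_eq0 eq_le normc_ge0 andbT; apply: eps_le => e e0; rewrite add0r.
have h : 0 < e * (1 - normc z) by rewrite mulr_gt0.
have k01 : 0 <= k < 1 by lra.
have [N HN] := sqrt_small (Hq_ge0 Hf) k01 h.
apply: le_trans (Hq_eval (Hn N) z1) _; rewrite ler_pdivrMr //; exact/ltW/HN.
Qed.

(* Neumann series around the center [c0] of a disk containing the spectrum. *)
Lemma has_resolvent_center T c0 lam (k : R) : linear_op T -> sq_bounded (fun f z => T f z - c0 * f z) k ->
  k < normc (lam - c0) ^+ 2 -> has_resolvent T lam.
Proof.
move=> TL [k0 Tk] kl.
have n0 : 0 < normc (lam - c0) ^+ 2 by apply: le_lt_trans kl.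
have l0 : lam - c0 != 0.
  by apply/eqP => l0; move: n0; rewrite l0 normc0 expr0n ltxx.
pose m := (lam - c0)^-1; pose U f z := m * (T f z - c0 * f z).
have nm : normc m ^+ 2 = (normc (lam - c0) ^+ 2)^-1 by rewrite /m Normc.normcV exprVn.
have UL : linear_op U.
  case: TL => E L; split=> [f g fg z z1|c f g z z1]; first by rewrite /U (E f g) // fg.
  by rewrite /U L //; ring.
have Uk : sq_bounded U (normc m ^+ 2 * k).
  split; first by rewrite mulr_ge0 ?sqr_ge0.
  by move=> f q Hf; rewrite -mulrA; apply: HqZ; exact: Tk.
have k1 : normc m ^+ 2 * k < 1 by rewrite nm mulrC ltr_pdivrMr // mul1r.
have [K K0 HK] := neumann UL Uk k1.
exists (K * normc m ^+ 2); first by rewrite mulr_ge0 ?sqr_ge0.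
move=> f q Hf; have [g Hg gE] := HK _ _ (HqZ (- m) Hf).
rewrite normcN in Hg.
have tr g' z : g' z - U g' z = - m * (T g' z - lam * g' z).
  by rewrite /U /m; field.
have m0 : - m != 0 by rewrite oppr_eq0 invr_eq0.
exists g; split; first by rewrite -mulrA.
  by move=> z z1; apply: (mulfI m0); rewrite -tr; exact: gE.
move=> g' q' Hg' g'E.
pose d z := g' z - g z.
have dU : eqd (U d) d.
  move=> z z1; case: (UL) => E L.
  have -> : U d z = U (fun w => -1 * g w + g' w) z by apply: E => // w _; rewrite /d mulN1r addrC.
  rewrite L // /d.
  have h1 := gE z z1; have h2 : g' z - U g' z = - m * f z by rewrite tr g'E.
  have -> : U g z = g z - - m * f z by rewrite -h1; ring.
  have -> : U g' z = g' z - - m * f z by rewrite -h2; ring.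
  ring.
have := Hq_contr Uk k1 (HqB Hg' Hg) (proj1 UL) dU => H z z1.
by apply/eqP; rewrite -subr_eq0; apply/eqP; exact: H.
Qed.

(* If BA = T, AB = T' then (T - lam)^-1 = lam^-1 (B (T' - lam)^-1 A - 1). *)
Lemma has_resolvent_comm T T' A B kA kB lam : lam != 0 -> linear_op A -> linear_op B -> sq_bounded A kA -> sq_bounded B kB ->
  (forall f, eqd (T f) (B (A f))) -> (forall f, eqd (T' f) (A (B f))) ->
  has_resolvent T' lam -> has_resolvent T lam.
Proof.
move=> l0 [AE AL] [BE BL] [kA0 Ak] [kB0 Bk] TE TE' [K K0 HK].
have nl : 0 < normc lam^-1 ^+ 2 by rewrite exprn_gt0 // normc_gt0 invr_eq0.
exists (normc lam^-1 ^+ 2 * (2 * (kB * (K * kA)) + 2)).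
  by rewrite mulr_ge0 ?(ltW nl) // addr_ge0 // !mulr_ge0.
move=> f q Hf; have [h [Hh hE hU]] := HK _ _ (Ak _ _ Hf).
exists (fun z => lam^-1 * (B h z - f z)); split.
- rewrite -mulrA; apply: HqZ.
  by apply: Hq_le (HqB (Bk _ _ Hh) Hf); rewrite le_eqVlt; apply/orP; left; apply/eqP; ring.
- move=> z z1.
  have e1 : T (fun w => lam^-1 * (B h w - f w)) z = lam^-1 * (B (A (B h)) z - B (A f) z).
    have c1 : eqd (A (fun w => lam^-1 * (B h w - f w))) (fun w => lam^-1 * (A (B h) w - A f w)).
      move=> w w1.
      have -> : A (fun u => lam^-1 * (B h u - f u)) w = A (fun u => lam^-1 * B h u + (- lam^-1 * f u + 0)) w.
        by apply: AE => // u _; ring.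
      rewrite AL //.
      have -> : A (fun u => - lam^-1 * f u + 0) w = - lam^-1 * A f w + 0.
        rewrite (AL (- lam^-1) f (fun=> 0)) //; congr (_ + _).
        exact: (linear_op0 (conj AE AL)).
      by ring.
    rewrite TE // (BE _ _ c1) //.
    have -> : B (fun w => lam^-1 * (A (B h) w - A f w)) z = B (fun u => lam^-1 * A (B h) u + (- lam^-1 * A f u + 0)) z.
      by apply: BE => // u _; ring.
    rewrite BL //.
    have -> : B (fun u => - lam^-1 * A f u + 0) z = - lam^-1 * B (A f) z + 0.
      rewrite (BL (- lam^-1) (A f) (fun=> 0)) //; congr (_ + _).
      exact: (linear_op0 (conj BE BL)).
    by ring.
  have e2 : B (A (B h)) z = B (A f) z + lam * B h z.
    have c1 : eqd (A (B h)) (fun w => lam * h w + A f w).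
      by move=> w w1; rewrite -TE' // -(hE w w1); ring.
    by rewrite (BE _ _ c1) // BL // addrC.
  by rewrite e1 e2; field.
move=> g' q' Hg' g'E z z1.
have Ag : eqd (fun w => T' (A g') w - lam * A g' w) (A f).
  move=> w w1; rewrite TE' //.
  have -> : A f w = A (fun u => - lam * g' u + B (A g') u) w.
    apply: AE => // u u1; rewrite -(g'E u u1) TE //; ring.
  by rewrite AL //; ring.
have hA := hU _ _ (Ak _ _ Hg') Ag.
have := g'E z z1; rewrite TE // (BE _ _ hA) // => <-.
by field.
Qed.

End Abstract.

(** * The operators T_s and the upper inclusion *)

Section Upper.
Variable R : realType.
Local Notation C := R[i].
Implicit Types (x y h e t s a : R) (z w c lam : C) (f g : C -> C).

Lemma evD (p q : {poly R}) z : ev (p + q) z = ev p z + ev q z.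
Proof. by rewrite /ev rmorphD hornerD. Qed.

Lemma evZ (k : R) (p : {poly R}) z : ev (k *: p) z = (k%:C)%C * ev p z.
Proof. by rewrite /ev -mul_polyC rmorphM /= map_polyC hornerCM. Qed.

Lemma evX z : ev 'X z = z.
Proof. by rewrite /ev map_polyX hornerX. Qed.

Lemma evXn z n : ev 'X^n z = z ^+ n.
Proof. by rewrite /ev map_polyXn hornerXn. Qed.

Lemma evC (k : R) z : ev k%:P z = (k%:C)%C.
Proof. by rewrite /ev map_polyC hornerC. Qed.

Lemma ev_Phi a z : ev (Phi a) z = z + (a%:C)%C * (1 - z) ^+ 2.
Proof.
rewrite PhiE !evD evC !evZ evX evXn rmorphB rmorph1 rmorphM rmorph_nat; ring.
Qed.

(** Solves Phi = tau o kap with tau(z) = 1 - (1 - a)(1 - z), the affine map onto the tangent disk of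
    radius 1 - a. In the other order kap o tau is Phi for the parameter a(1 - a), the source of the
    step from s to s(1 - s/2). *)
Definition kap a : {poly R} := ((1 - 2 * a) / (1 - a)) *: 'X + (a / (1 - a)) *: 'X^2.
Definition kapq a : {poly R} := 1%:P + (a / (1 - a)) *: 'X.

Lemma kap_pgf a : 0 < a <= 1 / 2 ->
  [/\ pnn (kap a), pnn (kapq a), (kapq a)`_0 = 1 & 1 - kap a = (1 - 'X) * kapq a].
Proof.
move=> /andP[a0 a1]; have d0 : 0 < 1 - a by lra.
have h1 : 0 <= (1 - 2 * a) / (1 - a) by rewrite divr_ge0 //; lra.
have h2 : 0 <= a / (1 - a) by rewrite divr_ge0 //; lra.
split.
- move=> i; rewrite coefD !coefZ coefX coefXn.
  by case: i => [|[|[|i]]] /=; rewrite ?mulr0 ?mulr1 ?addr0 ?add0r.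
- exact: lin_pnn.
- by rewrite coefD coefC coefZ coefX /= mulr0 addr0.
rewrite /kap /kapq (_ : (1 - 2 * a) / (1 - a) = 1 - a / (1 - a)); last by field; lra.
by rewrite -!mul_polyC polyCB polyC1; ring.
Qed.

Lemma ev_kap a z : a < 1 ->
  ev (kap a) z = ((1 - 2 * (a%:C)%C) * z + (a%:C)%C * z ^+ 2) / (1 - (a%:C)%C).
Proof.
move=> a1; have d0 : 1 - (a%:C)%C != 0 :> C.
  by rewrite -(rmorph1 (real_complex R)) -rmorphB -normc_gt0 normc_real normr_gt0 /=; lra.
rewrite !evD !evZ evX evXn !rmorphM !fmorphV !rmorphB !rmorph1 rmorphM rmorph_nat /=.
by field.
Qed.

Lemma bino_D b z : 0 < b <= 1 -> normc z < 1 -> normc (ev (bino b) z) < 1.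
Proof.
move=> /andP[b0 b1] z1.
apply: (ev_pgf (bino_pnn _) _ _ (bino_1sub b) z1); rewrite ?coefC //=; first lra.
by move=> i; rewrite coefC; case: i => [|i] /=; lra.
Qed.

Lemma Hq_bino b f q : 0 < b <= 1 -> Hq f q -> Hq (fun z => f (ev (bino b) z)) (b^-1 * q).
Proof.
move=> /andP[b0 b1] Hf.
have := @Hq_compo R (bino b) (b%:P) f q _ _ _ (bino_1sub b) Hf.
rewrite coefC /=; apply => //; first by apply: bino_pnn; lra.
by move=> i; rewrite coefC; case: i => [|i] /=; lra.
Qed.

Lemma kap_D a z : 0 < a <= 1 / 2 -> normc z < 1 -> normc (ev (kap a) z) < 1.
Proof.
move=> /kap_pgf[h1 h2 h3 h4] z1.
by apply: (ev_pgf h1 h2 _ h4 z1); rewrite h3.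
Qed.

Lemma Hq_kap a f q : 0 < a <= 1 / 2 -> Hq f q -> Hq (fun z => f (ev (kap a) z)) q.
Proof.
move=> /kap_pgf[h1 h2 h3 h4] Hf.
by have := Hq_compo h1 h2 _ h4 Hf; rewrite h3 invr1 mul1r; apply.
Qed.

Lemma bino_kap a z : a < 1 -> ev (bino (1 - a)) (ev (kap a) z) = ev (Phi a) z.
Proof.
move=> a1; have d0 : 1 - (a%:C)%C != 0 :> C.
  by rewrite -(rmorph1 (real_complex R)) -rmorphB -normc_gt0 normc_real normr_gt0 /=; lra.
rewrite ev_bino ev_kap // ev_Phi rmorphB rmorph1 /=.
by field.
Qed.

Lemma kap_bino a z : a < 1 -> ev (kap a) (ev (bino (1 - a)) z) = ev (Phi (a * (1 - a))) z.
Proof.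
move=> a1; have d0 : 1 - (a%:C)%C != 0 :> C.
  by rewrite -(rmorph1 (real_complex R)) -rmorphB -normc_gt0 normc_real normr_gt0 /=; lra.
rewrite ev_kap // ev_bino ev_Phi rmorphM rmorphB rmorph1 /=.
by field.
Qed.

Lemma bino_bino b b' z : ev (bino b) (ev (bino b') z) = ev (bino (b * b')) z.
Proof. by rewrite !ev_bino rmorphM /=; ring. Qed.

Lemma bino_sub1 b z : 0 <= b -> normc z < 1 -> normc (ev (bino b) z - 1) <= 2 * b.
Proof.
move=> b0 z1; rewrite ev_bino addrAC subrr add0r normcN Normc.normcM normc_real ger0_norm //.
rewrite mulrC ler_wpM2r //.
by have := le_normcD 1 (- z); rewrite normcN normc1; lra.
Qed.

Lemma Hq_Phi a f q : 0 < a <= 1 / 4 -> Hq f q -> Hq (fun z => f (ev (Phi a) z)) (2 * q).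
Proof.
move=> a01 Hf; have a2 : 0 < a <= 1 / 2 by lra.
have a3 : 0 < 1 - a <= 1 by lra.
apply: Hq_eq (Hq_le _ (Hq_kap a2 (Hq_bino a3 Hf))) => [z z1|]; first by rewrite bino_kap //; lra.
by rewrite ler_wpM2r ?(Hq_ge0 Hf) // invf_ple ?posrE; lra.
Qed.

Lemma eps_a_ge0 a : 0 <= a -> 0 <= eps_a a.
Proof. by move=> a0; rewrite /eps_a; have := sqrtr_ge0 a; lra. Qed.

Lemma Hq1 : Hq (fun=> 1 : C) 1.
Proof.
apply: Hq_eq (Hq_poly (p := 1) _) => [z _|n]; first by rewrite hornerC.
apply: le_trans (@sum_trunc R (fun k => normc (1 : {poly C})`_k ^+ 2) n 1 _ _) _.
- by move=> k; exact: sqr_ge0.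
- by case=> [//|k] _; rewrite coef1 normc0 expr0n.
- by rewrite big_ord1 coef1 normc1 expr1n.
Qed.

Section Psi.
Variables (psi : C -> C) (psi1 : C) (qp S : R).
Hypothesis psiH : Hq psi qp.
Hypothesis psiS : forall z, normc z < 1 -> normc (psi z) <= S.
Hypothesis psiL : forall e, 0 < e -> exists2 de, 0 < de &
  forall z, normc z < 1 -> normc (z - 1) < de -> normc (psi z - psi1) < e.

(* The restriction of [W_(psi,phi)] to the disk internally tangent at 1 with
   radius [s], transported to the unit disk. *)
Definition Tw s f z := psi (ev (bino s) z) * f (ev (Phi (s / 2)) z).
Definition Aop a f z : C := f (ev (bino (1 - a)) z).
Definition Bop s f z := psi (ev (bino s) z) * f (ev (kap (s / 2)) z).

Lemma Aop_linear a : 0 <= a < 1 -> linear_op (Aop a).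
Proof.
by move=> a01; split=> [f g fg z z1|c f g z z1] //; apply: fg; apply: bino_D => //; lra.
Qed.

Lemma Bop_linear s : 0 < s <= 1 -> linear_op (Bop s).
Proof.
move=> s01; split=> [f g fg z z1|c f g z z1]; rewrite /Bop; last by ring.
by rewrite fg //; apply: kap_D => //; lra.
Qed.

Lemma Aop_sq_bounded a : 0 <= a < 1 -> sq_bounded (Aop a) (1 - a)^-1.
Proof.
move=> a01; split; first by rewrite invr_ge0; lra.
by move=> f q; apply: Hq_bino; lra.
Qed.

Lemma psi_bino s : 0 < s <= 1 -> Hq (fun z => psi (ev (bino s) z)) (s^-1 * qp) /\
  forall z, normc z < 1 -> normc (psi (ev (bino s) z)) <= S.
Proof.
by move=> s01; split; [exact: Hq_bino|move=> z z1; apply/psiS/bino_D].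
Qed.

Lemma Bop_sq_bounded s : 0 < s <= 1 -> sq_bounded (Bop s) (S ^+ 2).
Proof.
move=> s01; split; first exact: sqr_ge0.
move=> f q Hf; have [h1 h2] := psi_bino s01.
by apply: (Hq_mul h1 h2); apply: Hq_kap => //; lra.
Qed.

Lemma Tw_BA s f z : s < 2 -> Tw s f z = Bop s (Aop (s / 2) f) z.
Proof. by move=> s2; rewrite /Tw /Bop /Aop bino_kap //; lra. Qed.

Lemma Tw_AB s f z : s < 2 -> Tw (s * (1 - s / 2)) f z = Aop (s / 2) (Bop s f) z.
Proof.
move=> s2; rewrite /Tw /Bop /Aop kap_bino; last lra.
by rewrite bino_bino; congr (psi _ * f (ev (Phi _) z)); field.
Qed.

Lemma Tw_linear s : 0 < s <= 1 -> linear_op (Tw s).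
Proof.
move=> s01; have [E L] := Aop_linear (a := s / 2) ltac:(lra); have [E' L'] := Bop_linear s01.
split=> [f g fg z z1|c f g z z1].
  have s2 : s < 2 by lra.
  by rewrite !(Tw_BA _ _ s2); apply: E' => //; exact: E.
by rewrite /Tw; ring.
Qed.

Lemma has_resolvent_Tw_step s lam : 0 < s <= 1 -> lam != 0 -> has_resolvent (Tw (s * (1 - s / 2))) lam -> has_resolvent (Tw s) lam.
Proof.
move=> s01 l0; have a01 : 0 <= s / 2 < 1 by lra.
apply: (has_resolvent_comm l0 (Aop_linear a01) (Bop_linear s01) (Aop_sq_bounded a01) (Bop_sq_bounded s01)).
  by move=> f z _; apply: Tw_BA; lra.
by move=> f z _; apply: Tw_AB; lra.
Qed.

Fixpoint sn n : R := if n is n'.+1 then sn n' * (1 - sn n' / 2) else 1.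

(** The reciprocals grow by at least 1/2 at each step, from 1 at n = 0. *)
Lemma sn_bound n : 0 < sn n <= 1 /\ sn n * (n%:R + 2) <= 2.
Proof.
elim: n => [|n [/andP[h0 h1] h2]]; first by rewrite /= ltr01 lexx add0r mul1r.
split.
  rewrite /=; apply/andP; split; first by rewrite mulr_gt0 //; lra.
  by rewrite -[leRHS]mulr1; apply: ler_pM; lra.
rewrite -natr1 /=; move: (sn n) (n%:R) (ler0n R n) h0 h1 h2 => s m m0 h0 h1 h2.
have k1 : 0 <= s * (2 - s * (m + 2)) by rewrite mulr_ge0; lra.
have : s * (1 - s / 2) * (m + 1 + 2) = s * (m + 2) + s * (2 - s * (m + 2)) / 2 - s ^+ 2 / 2 by field.
move=> ->.
have k2 : 0 <= (2 - s * (m + 2)) * (2 - s) by rewrite mulr_ge0; lra.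
have := sqr_ge0 s; lra.
Qed.

Lemma has_resolvent_Tw_sn n lam : lam != 0 -> has_resolvent (Tw (sn n)) lam -> has_resolvent (Tw 1) lam.
Proof.
move=> l0; elim: n => [//|n IH] H; apply: IH; apply: has_resolvent_Tw_step => //.
by have [] := sn_bound n.
Qed.

(** With C the composition with Phi and psi_s the weight, T_s - psi1 c = psi1 (C - c) + (psi_s -
    psi1) C. The first term has squared norm at most about |psi1|^2 rho and the second is small; the
    strict inequality absorbs both errors. *)
Lemma has_resolvent_Tw_small lam c (rho : R) : normc c ^+ 2 <= rho -> normc (1 - c) ^+ 2 <= rho ->
  normc psi1 ^+ 2 * rho < normc (lam - psi1 * c) ^+ 2 ->
  exists2 s0, 0 < s0 & forall s, 0 < s <= 1 -> s < s0 -> has_resolvent (Tw s) lam.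
Proof.
move=> h1 h2 hl.
have rho0 : 0 <= rho by apply: le_trans h1; exact: sqr_ge0.
pose X := normc psi1 ^+ 2 * rho; pose La := normc (lam - psi1 * c) ^+ 2.
have X0 : 0 <= X by rewrite mulr_ge0 ?sqr_ge0.
have XL : X < La by [].
(* The weight t is spent twice, in [Hq_Phi_sub] and in [HqD]; m is the rest of the gap, of which a
   third goes to each of the two errors. *)
have [t [t0 [m [m0 tX]]]] : exists t, 0 < t /\ exists m, 0 < m /\ (1 + t) * ((1 + t) * X) + m <= La.
  have D0 : 0 < 6 * X + La + 1 by lra.
  pose t := (La - X) / (6 * X + La + 1).
  have t0 : 0 < t by rewrite divr_gt0 //; lra.
  have t1 : t <= 1 by rewrite ler_pdivrMr //; lra.
  have tE : t * (6 * X + La + 1) = La - X by rewrite /t; field; rewrite gt_eqF.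
  clearbody t.
  exists t; split => //; exists ((La - X) / 2); split; first by lra.
  have k1 : 0 <= t * X * (1 - t) by apply: mulr_ge0; [apply: mulr_ge0 => //; exact: ltW|lra].
  have k2 : 0 <= t * La by apply: mulr_ge0; [exact: ltW|exact: sqr_ge0].
  move: X La X0 XL tE k1 k2 {D0 hl} => X La X0 XL tE k1 k2; lra.
have ti : 0 < t^-1 by rewrite invr_gt0.
pose K1 := (1 + t) * normc psi1 ^+ 2 * (1 + t^-1) + 1.
pose K2 := 2 * (1 + t^-1).
have k10 : 0 <= (1 + t) * normc psi1 ^+ 2 * (1 + t^-1).
  by apply: mulr_ge0; [apply: mulr_ge0; [lra|exact: sqr_ge0]|lra].
have K10 : 0 < K1 by exact: ltr_wpDl.
have K20 : 0 < K2 by rewrite /K2; lra.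
have [et [et0 et1 etm]] : exists et : R, [/\ 0 < et, et <= 1 & K2 * et <= m / 3].
  exists (Num.min 1 (m / 3 / K2)); split.
  - by rewrite lt_min ltr01 !divr_gt0.
  - by rewrite ge_min lexx.
  - by rewrite mulrC -ler_pdivlMr // ge_min lexx orbT.
have [de de0 Hde] := psiL et0.
(* When sqrt a and a are at most w0, [eps_a] is at most 3 (6 + 2) w0 = 24 w0. *)
pose y := m / 3 / K1 / 24.
have y0 : 0 < y by rewrite !divr_gt0.
pose w0 := Num.min 1 y.
have w00 : 0 < w0 by rewrite lt_min ltr01.
(* In turn: a <= 1/4; the disk of radius s lies within de of 1; sqrt a < w0. *)
exists (Num.min (1 / 2) (Num.min (de / 2) (w0 ^+ 2))).
  by rewrite !lt_min !divr_gt0 ?exprn_gt0.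
move=> s s01; rewrite !lt_min => /and3P[s2 sde sw].
pose a := s / 2.
have a0 : 0 < a by rewrite /a; lra.
have a1 : a <= 1 / 4 by rewrite /a; lra.
have sqa : Num.sqrt a < w0.
  rewrite -[w0]gtr0_norm // -sqrtr_sqr ltr_sqrt ?exprn_gt0 //.
  by rewrite /a; lra.
have ae : K1 * eps_a a <= m / 3.
  have w1 : w0 <= 1 by rewrite ge_min lexx.
  have wy : w0 <= y by rewrite ge_min lexx orbT.
  have aw : a <= w0.
    rewrite -(sqr_sqrtr (ltW a0)) expr2 -[leRHS]mulr1.
    by apply: ler_pM; rewrite ?sqrtr_ge0 //; lra.
  have : eps_a a <= 24 * y by rewrite /eps_a; lra.
  move=> H; apply: le_trans (ler_wpM2l (ltW K10) H) _.
  by rewrite le_eqVlt; apply/orP; left; apply/eqP; rewrite /y; field; rewrite gt_eqF.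
have [q1 q2] := psi_bino s01.
have /andP[s0 _] := s01.
have a14 : 0 < a <= 1 / 4 by rewrite a0 a1.
have bound f q : Hq f q -> Hq (fun z => Tw s f z - psi1 * c * f z)
  (((1 + t) * (normc psi1 ^+ 2 * ((1 + t) * rho + (1 + t^-1) * eps_a a)) + (1 + t^-1) * (et ^+ 2 * 2)) * q).
  move=> Hf.
  have P1 := HqZ psi1 (Hq_Phi_sub a0 a1 t0 h1 h2 Hf).
  have C1 := Hq_Phi a14 Hf.
  have chi : Hq (fun z => psi (ev (bino s) z) - psi1 * 1) (2 * (s^-1 * qp) + 2 * (normc psi1 ^+ 2 * 1)).
    by apply: HqB => //; apply: HqZ; exact: Hq1.
  have chiS z : normc z < 1 -> normc (psi (ev (bino s) z) - psi1 * 1) <= et.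
    move=> z1; rewrite mulr1; apply/ltW/Hde; first exact: bino_D.
    apply: le_lt_trans (bino_sub1 (ltW s0) z1) _.
    by rewrite mulrC -ltr_pdivlMr.
  have M1 := Hq_mul chi chiS C1.
  apply: Hq_eq (Hq_le _ (HqD t0 P1 M1)) => [z z1|].
    by rewrite /Tw -/a; ring.
  by rewrite le_eqVlt; apply/orP; left; apply/eqP; ring.
have ea0 := eps_a_ge0 (ltW a0).
apply: has_resolvent_center (Tw_linear s01) (conj _ bound) _.
  have tp : 0 <= 1 + t by rewrite addr_ge0 // ltW.
  have tip : 0 <= 1 + t^-1 by rewrite addr_ge0 // ltW.
  apply: addr_ge0; apply: mulr_ge0 => //; apply: mulr_ge0; rewrite ?sqr_ge0 //.
  by apply: addr_ge0; apply: mulr_ge0.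
rewrite -/La.
have -> : (1 + t) * (normc psi1 ^+ 2 * ((1 + t) * rho + (1 + t^-1) * eps_a a)) =
  (1 + t) * ((1 + t) * X) + (K1 - 1) * eps_a a by rewrite /X /K1; ring.
have et2 : et ^+ 2 <= et by rewrite expr2 ler_piMr // ltW.
have : (1 + t^-1) * (et ^+ 2 * 2) <= K2 * et.
  by have := ler_wpM2l (ltW K20) et2; rewrite /K2; lra.
have q3 : 0 <= (1 + t^-1) * eps_a a by rewrite mulr_ge0 // addr_ge0 // ltW.
lra.
Qed.

(** For mu = u + iv off the real axis the centre -i/v has squared distances 1/v^2, 1 + 1/v^2 and u^2
    + v^2 + 2 + 1/v^2 to 0, 1 and mu. For real mu the centre is the end of [0, 1] farther from
    mu. *)
Lemma center_exists (mu : C) : (forall x, 0 <= x <= 1 -> mu <> (x%:C)%C) ->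
  exists c, exists rho : R, [/\ normc c ^+ 2 <= rho, normc (1 - c) ^+ 2 <= rho & rho < normc (mu - c) ^+ 2].
Proof.
move=> H; case: mu H => u v H.
have [v0|v0] := eqVneq v 0.
  have [u0|u0] := ltP u 0.
    by exists 1, 1; rewrite !normc_sqr /= v0; split; nra.
  have u1 : 1 < u.
    rewrite ltNge; apply/negP => u1; apply: (H u); first by rewrite u0 u1.
    by rewrite v0.
  by exists 0, 1; rewrite !normc_sqr /= v0; split; nra.
exists (0 +i* (- v^-1))%C, (1 + v^-1 ^+ 2).
rewrite !normc_sqr /= !opprK !subr0 !add0r sqrrN.
have vv : v * v^-1 = 1 by rewrite mulfV.
have := sqr_ge0 u; have : 0 < v ^+ 2 by rewrite exprn_even_gt0.
move: (v^-1) vv => i vv; split; nra.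
Qed.

Lemma has_resolvent_Tw1 lam : lam != 0 -> (forall t, 0 <= t -> lam <> psi1 * ((expR (- t / 2))%:C)%C) ->
  has_resolvent (Tw 1) lam.
Proof.
move=> l0 H.
have [c [rho [h1 h2 h3]]] : exists c, exists rho : R, [/\ normc c ^+ 2 <= rho, normc (1 - c) ^+ 2 <= rho
    & normc psi1 ^+ 2 * rho < normc (lam - psi1 * c) ^+ 2].
  have [p0|p0] := eqVneq psi1 0.
    exists 0, 1; rewrite subr0 normc0 normc1 p0 normc0 !mul0r subr0 expr0n expr1n /= mul0r; split => //.
    by rewrite exprn_gt0 // normc_gt0.
  have [|c [rho [h1 h2 h3]]] := @center_exists (lam / psi1).
    move=> x /andP[x0 x1] E.
    have lE : lam = psi1 * (x%:C)%C by rewrite -E mulrC divfK.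
    have xp : 0 < x.
      rewrite lt_neqAle x0 andbT eq_sym; apply/eqP => xe.
      by move/eqP: l0; apply; rewrite lE xe mulr0.
    apply: (H (- 2 * ln x)).
      by rewrite mulNr oppr_ge0 mulr_ge0_le0 // ln_le0.
    rewrite lE; congr (_ * (_)%:C%C).
    by rewrite (_ : - (- 2 * ln x) / 2 = ln x) ?lnK // ?posrE //; field.
  exists c, rho; split => //.
  have -> : lam - psi1 * c = psi1 * (lam / psi1 - c) by field.
  by rewrite [normc (psi1 * _)]Normc.normcM exprMn ltr_pM2l // exprn_gt0 // normc_gt0.
have [s0 s00 Hs] := has_resolvent_Tw_small h1 h2 h3.
have q0 : 0 <= 2 / s0 by rewrite divr_ge0 // ltW.
pose n := Num.Def.archi_bound (2 / s0).
apply: (@has_resolvent_Tw_sn n) => //.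
have [n1 n2] := sn_bound n; apply: Hs => //.
have := Num.Theory.archi_boundP q0; rewrite -/n ltr_pdivrMr // => hn.
case/andP: n1 => n0 _.
have k0 : (0 : R) < n%:R + 2 by rewrite ltr_wpDl.
rewrite -(ltr_pM2r k0); apply: le_lt_trans n2 _; lra.
Qed.

End Psi.
End Upper.

(** * The complex exponential and the lower inclusion *)

Section Cexp.
Variable R : realType.
Local Notation C := R[i].
Implicit Types (x y e t : R) (z w c h : C).

Definition cexp z : C := ((expR (complex.Re z))%:C)%C * cis (complex.Im z).

Lemma cexpD z w : cexp (z + w) = cexp z * cexp w.
Proof. by rewrite /cexp !raddfD /= expRD cisD rmorphM /=; ring. Qed.

Lemma normc_cexp z : normc (cexp z) = expR (complex.Re z).
Proof. by rewrite Normc.normcM normc_cis mulr1 normc_real ger0_norm // expR_ge0. Qed.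

Lemma cexp_real x : cexp (x%:C)%C = ((expR x)%:C)%C.
Proof. by rewrite /cexp /= cis0 mulr1. Qed.

Lemma cis_taylor y : normc (cis y - 1 - (0 +i* y)%C) <= 2 * y ^+ 2.
Proof.
have sabs u : `|sin u : R| <= `|u| by have := sin_lip u 0; rewrite sin0 !subr0.
have cabs u : `|cos u - 1 : R| <= `|u| by have := cos_lip u 0; rewrite cos0 subr0.
wlog y0 : y / 0 <= y.
  move=> H; have [|/ltW yn] := leP 0 y; first exact: H.
  have := H (- y) ltac:(lra); rewrite sqrrN -normc_conj.
  have -> : (cis (- y) - 1 - (0 +i* (- y))%C)^*%C = cis y - 1 - (0 +i* y)%C; last by [].
  by rewrite /cis cosN sinN; apply/eqP; rewrite eq_complex /=; apply/andP; split; apply/eqP; ring.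
have c1 : `|cos y - 1| <= y ^+ 2.
  have [u] := @MVT_segment R cos (fun u => - sin u) 0 y y0
    (fun u _ => is_derive_cos u) (continuous_subspaceT (@continuous_cos R)).
  rewrite in_itv /= => /andP[u0 uy]; rewrite cos0 subr0 => ->.
  rewrite normrM normrN (ger0_norm y0) expr2 ler_wpM2r //.
  by apply: le_trans (sabs u) _; rewrite ger0_norm.
have s1 : `|sin y - y| <= y ^+ 2.
  have [u] := @MVT_segment R sin (fun u => cos u) 0 y y0
    (fun u _ => is_derive_sin u) (continuous_subspaceT (@continuous_sin R)).
  rewrite in_itv /= => /andP[u0 uy]; rewrite sin0 !subr0 => ->.
  rewrite -{2}[y]mul1r -mulrBl normrM (ger0_norm y0) expr2 ler_wpM2r //.
  by apply: le_trans (cabs u) _; rewrite ger0_norm.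
apply: le_trans (normc_le_ReIm _) _.
have -> : complex.Re (cis y - 1 - (0 +i* y)%C) = cos y - 1 by rewrite /cis /= subr0.
have -> : complex.Im (cis y - 1 - (0 +i* y)%C) = sin y - y by rewrite /cis /= subr0.
lra.
Qed.

(** Both sides come from exp u >= 1 + u, at u = x and at u = -x. *)
Lemma expR_taylor x : `|x| <= 1 / 2 -> `|expR x - 1 - x| <= 2 * x ^+ 2.
Proof.
rewrite ler_norml => /andP[x1 x2].
have h1 := expR_ge1Dx x; have h2 := expR_ge1Dx (- x).
have e0 := expR_gt0 x.
have h3 : expR x * (1 - x) <= 1.
  have := ler_wpM2l (ltW e0) h2; rewrite -expRD subrr expR0; lra.
rewrite ger0_norm; last lra.
have k : 0 < 1 - x by lra.
have -> : expR x - 1 - x = (expR x * (1 - x) - (1 - x ^+ 2)) / (1 - x) by field; lra.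
rewrite ler_pdivrMr //.
have : 0 <= x ^+ 2 * (1 / 2 - x) by rewrite mulr_ge0 ?sqr_ge0; lra.
lra.
Qed.

Lemma cexp_taylor h : normc h <= 1 / 2 -> normc (cexp h - 1 - h) <= 8 * normc h ^+ 2.
Proof.
move=> hs; pose x := complex.Re h; pose y := complex.Im h.
have xh := normc_Re h; have yh := normc_Im h; have h0 := normc_ge0 h.
have x1 : `|x| <= 1 / 2 by apply: le_trans hs.
have X := expR_taylor x1; have Y := cis_taylor y.
have hE : h = (x%:C)%C + (0 +i* y)%C by rewrite /x /y; case: (h) => a b; simpc.
have ex : expR x <= 2.
  move: X; rewrite ler_norml => /andP[_ X].
  have : x ^+ 2 <= 1 / 4 by rewrite -real_normK ?num_real //; have := normr_ge0 x; nra.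
  have := ler_norm x; lra.
have ex1 : `|expR x - 1| <= 2 * `|x|.
  have -> : expR x - 1 = expR x - 1 - x + x by ring.
  apply: le_trans (ler_normD _ _) _; apply: le_trans (lerD X (lexx _)) _.
  by rewrite -real_normK ?num_real //; have := normr_ge0 x; nra.
have -> : cexp h - 1 - h = ((expR x)%:C)%C * (cis y - 1 - (0 +i* y)%C) + ((expR x - 1 - x)%:C)%C
   + ((expR x - 1)%:C)%C * (0 +i* y)%C.
  rewrite {2}hE /cexp -/x -/y !rmorphB rmorph1 /=; ring.
have k1 := le_normcD (((expR x)%:C)%C * (cis y - 1 - (0 +i* y)%C) + ((expR x - 1 - x)%:C)%C) (((expR x - 1)%:C)%C * (0 +i* y)%C).
have k2 := le_normcD (((expR x)%:C)%C * (cis y - 1 - (0 +i* y)%C)) ((expR x - 1 - x)%:C)%C.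
have niy : normc (0 +i* y)%C = `|y| by rewrite /Normc.normc /= expr0n add0r sqrtr_sqr.
rewrite [normc (_ * (cis y - 1 - _))]Normc.normcM !normc_real (ger0_norm (expR_ge0 x)) in k2.
rewrite [normc (_ * (0 +i* y)%C)]Normc.normcM normc_real niy in k1.
have k3 : expR x * normc (cis y - 1 - (0 +i* y)%C) <= 2 * (2 * y ^+ 2).
  by apply: ler_pM => //; exact: expR_ge0 || exact: normc_ge0.
have k4 : `|expR x - 1| * `|y| <= 2 * `|x| * `|y| by rewrite ler_wpM2r.
have k5 : y ^+ 2 <= normc h ^+ 2 by rewrite -real_normK ?num_real // lerXn2r ?nnegrE.
have k6 : x ^+ 2 <= normc h ^+ 2 by rewrite -real_normK ?num_real // lerXn2r ?nnegrE.
have k7 : `|x| * `|y| <= normc h ^+ 2 by rewrite expr2; apply: ler_pM.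
lra.
Qed.

Lemma cara_cexp z : cara cexp z.
Proof.
apply/cdiff_cara; exists (cexp z) => e e0.
have m0 : 0 < expR (complex.Re z) := expR_gt0 _.
have d0 : 0 < e / (8 * expR (complex.Re z)) by rewrite divr_gt0 // mulr_gt0.
exists (Num.min (1 / 2) (e / (8 * expR (complex.Re z)))); first by rewrite lt_min d0 divr_gt0.
move=> w; rewrite lt_min => /andP[w1 w2].
have -> : cexp w - cexp z - cexp z * (w - z) = cexp z * (cexp (w - z) - 1 - (w - z)).
  have -> : cexp w = cexp z * cexp (w - z) by rewrite -cexpD addrC subrK.
  ring.
rewrite Normc.normcM normc_cexp; apply: le_trans (ler_wpM2l (ltW m0) (cexp_taylor (ltW w1))) _.
move: w2; rewrite ltr_pdivlMr ?mulr_gt0 // => w2.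
have := ler_wpM2r (normc_ge0 (w - z)) (ltW w2); rewrite expr2; lra.
Qed.

Lemma cexp_lip (H : R) : 0 <= H -> exists2 L, 0 <= L & forall h, normc h <= H -> normc (cexp h - 1) <= L * normc h.
Proof.
move=> H0; have E0 := expR_gt0 H.
exists (5 + 2 * (expR H + 1)); first lra.
move=> h hH; have n0 := normc_ge0 h.
have [h2|h2] := leP (normc h) (1 / 2).
  have := cexp_taylor h2; have := le_normcD (cexp h - 1 - h) h; rewrite subrK.
  have : normc h ^+ 2 <= normc h * (1 / 2) by rewrite expr2 ler_wpM2l.
  have : 0 <= expR H * normc h by rewrite mulr_ge0 // ltW.
  lra.
have := le_normcD (cexp h) (- 1); rewrite normcN normc1 normc_cexp.
have : expR (complex.Re h) <= expR H.
  by rewrite ler_expR; apply: le_trans (ler_norm _) _; apply: le_trans (normc_Re h) hH.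
have : (expR H + 1) * (1 / 2) <= (expR H + 1) * normc h by rewrite ler_wpM2l ?(ltW h2) //; lra.
lra.
Qed.

End Cexp.

(** * Approximate eigenfunctions *)

Section Lower.
Variable R : realType.
Local Notation C := R[i].
Implicit Types (x y e t r : R) (z w c lam : C) (f g : C -> C) (T A B : (C -> C) -> (C -> C)).

Definition bounded_below T lam := exists2 K, 0 <= K & forall f q q', Hq f q ->
  Hq (fun z => T f z - lam * f z) q' -> Hq f (K * q').

(** If g = T' f - lam f, then (T - lam) B f = B g, which bounds B f, and f is recovered from lam f =
    A B f - g. *)
Lemma bounded_below_comm T T' A B kA kB lam : lam != 0 -> linear_op A -> linear_op B -> sq_bounded A kA -> sq_bounded B kB ->
  (forall f, eqd (T f) (B (A f))) -> (forall f, eqd (T' f) (A (B f))) ->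
  bounded_below T lam -> bounded_below T' lam.
Proof.
move=> l0 [AE AL] [BE BL] [kA0 Ak] [kB0 Bk] TE TE' [K K0 HK].
exists (normc lam^-1 ^+ 2 * (2 * (kA * (K * kB)) + 2)).
  by rewrite mulr_ge0 ?sqr_ge0 // addr_ge0 // !mulr_ge0.
move=> f q q' Hf Hg.
have HB : Hq (fun z => T (B f) z - lam * B f z) (kB * q').
  apply: Hq_eq (Bk _ _ Hg) => z z1.
  have -> : B (fun w => T' f w - lam * f w) z = B (fun w => - lam * f w + A (B f) w) z.
    by apply: BE => // w w1; rewrite TE' //; ring.
  by rewrite BL // TE //; ring.
have HBf := HK _ _ _ (Bk _ _ Hf) HB.
apply: Hq_eq (Hq_le _ (HqZ lam^-1 (HqB (Ak _ _ HBf) Hg))) => [z z1|].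
  by rewrite TE' //; field.
by rewrite le_eqVlt; apply/orP; left; apply/eqP; ring.
Qed.

Variable t : R.
Hypothesis t0 : 0 <= t.

(** Up to a constant factor, the singular inner function with mass at 1. [fr] divides it by 1 - r z
    rather than 1 - z to stay in H^2. *)
Let E z : C := cexp (- ((t%:C)%C / (1 - z))).
Let fr r z : C := E z / (1 - (r%:C)%C * z).

Lemma disk_sub1 z : normc z < 1 -> 1 - z != 0.
Proof. by move=> z1; rewrite -normc_gt0; have := normc_sub_ge 1 z; rewrite normc1; lra. Qed.

Lemma Re_inv z : complex.Re z^-1 = complex.Re z / normc z ^+ 2.
Proof. by rewrite normc_sqr; case: z. Qed.

Lemma E_le1 z : normc z < 1 -> normc (E z) <= 1.
Proof.
move=> z1; rewrite normc_cexp expR_le1 raddfN /= oppr_le0 Re_realM Re_inv.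
rewrite mulr_ge0 // divr_ge0 ?sqr_ge0 // raddfB /=.
have := normc_Re z; have := ler_norm (complex.Re z); lra.
Qed.

(** The second bound follows from the first, as |1 - z| <= |1 - r z| + (1 - r). It does not
    degenerate when r tends to 1, and so gives the estimates that are uniform in r. *)
Lemma fr_den r z : 0 < r < 1 -> normc z < 1 -> 1 - r <= normc (1 - (r%:C)%C * z) /\
  normc (1 - z) / 2 <= normc (1 - (r%:C)%C * z).
Proof.
move=> /andP[r0 r1] z1; have z0 := normc_ge0 z.
have a : 1 - r <= normc (1 - (r%:C)%C * z).
  have := normc_sub_ge 1 ((r%:C)%C * z); rewrite normc1 Normc.normcM normc_real (gtr0_norm r0).
  have : r * normc z <= r * 1 by rewrite ler_wpM2l ?ltW.
  lra.
split => //.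
have b := le_normcD (1 - (r%:C)%C * z) (- ((1 - r)%:C%C * z)).
have e : 1 - (r%:C)%C * z - (1 - r)%:C%C * z = 1 - z by rewrite rmorphB rmorph1 /=; ring.
rewrite e normcN [normc (_ * z)]Normc.normcM normc_real (ger0_norm (_ : 0 <= 1 - r)) in b; last lra.
have : (1 - r) * normc z <= (1 - r) * 1 by rewrite ler_wpM2l; lra.
lra.
Qed.

Lemma E_cara z : normc z < 1 -> cara E z.
Proof.
move=> z1; apply: (cara_comp (f := fun w => - ((t%:C)%C / (1 - w))) _ (cara_cexp _)).
have c1 : cara (fun w : C => 1 + -1 * w) z.
  by apply: caraD; [exact: cara_cst|apply: caraM; [exact: cara_cst|exact: cara_id]].
have := caraM (cara_cst (- (t%:C)%C) z) (cara_inv c1 _).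
have -> : (fun w => - (t%:C)%C * (1 + -1 * w)^-1) = (fun w => - ((t%:C)%C / (1 - w))).
  by apply/funext => w; rewrite mulN1r mulNr.
by apply; rewrite mulN1r; exact: disk_sub1.
Qed.

Lemma fr_Hq r : 0 < r < 1 -> exists q, Hq (fr r) q.
Proof.
move=> r01; exists ((1 - r)^-1 ^+ 2); apply: bounded_Hq => z z1.
  have [a _] := fr_den r01 z1.
  have c1 : cara (fun w : C => 1 + - (r%:C)%C * w) z.
    by apply: caraD; [exact: cara_cst|apply: caraM; [exact: cara_cst|exact: cara_id]].
  have := caraM (E_cara z1) (cara_inv c1 _).
  have -> : (fun w => E w * (1 + - (r%:C)%C * w)^-1) = fr r.
    by apply/funext => w; rewrite /fr mulNr.
  by apply; rewrite mulNr -normc_gt0; lra.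
have [a _] := fr_den r01 z1.
rewrite /fr Normc.normcM Normc.normcV -[leRHS]mul1r; apply: ler_pM.
- exact: normc_ge0.
- by rewrite invr_ge0 normc_ge0.
- exact: E_le1.
- by rewrite lef_pV2 ?posrE //; lra.
Qed.

Section Psi.
Variables (psi : C -> C) (psi1 : C) (qp S : R).
Hypothesis psiH : Hq psi qp.
Hypothesis psiS : forall z, normc z < 1 -> normc (psi z) <= S.
Hypothesis psiL : forall e, 0 < e -> exists2 de, 0 < de &
  forall z, normc z < 1 -> normc (z - 1) < de -> normc (psi z - psi1) < e.

Let e0 := expR (- t / 4).
Let lam := psi1 * (e0%:C)%C.

(** The exponential misses its eigenvalue relation by a factor 1 + O(1 - z), which cancels one
    denominator; the change of denominators involves Phi - z = (1 - z)^2/4, which cancels two. *)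
Lemma fr_Phi : exists2 C1, 0 <= C1 & forall r z, 0 < r < 1 -> normc z < 1 ->
  normc (fr r (ev (Phi (1 / 2 / 2)) z) - (e0%:C)%C * fr r z) <= C1.
Proof.
have t4 : 0 <= t / 4 by rewrite divr_ge0.
have [L L0 HL] := cexp_lip t4.
exists (L * t / 2 + 2); first by have := mulr_ge0 L0 t0; lra.
move=> r z r01 z1; have z0 := normc_ge0 z.
pose P := ev (Phi (1 / 2 / 2)) z.
have PE : P = z + (1 - z) ^+ 2 / 4.
  rewrite /P ev_Phi (_ : 1 / 2 / 2 = 4^-1 :> R); last by field.
  by rewrite fmorphV rmorph_nat mulrC.
have P1 : normc P < 1.
  have a0 : 0 < (1 / 2 / 2 : R) by lra.
  have a1 : (1 / 2 / 2 : R) <= 1 / 4 by lra.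
  apply: (ev_pgf (Phi_pnn a0 a1) (lin_pnn _ _) _ (Phi_1sub _)) => //; try lra.
  by rewrite coefD coefC coefZ coefX /= mulr0 addr0; lra.
rewrite -/P; clearbody P.
have n4 (k : nat) : normc (k%:R : C) = k%:R.
  by rewrite -(rmorph_nat (real_complex R)) normc_real normr_nat.
have z3 : 2 <= normc (3 + z) by have := normc_sub_ge 3 (- z); rewrite opprK normcN n4; lra.
have z30 : 3 + z != 0 by rewrite -normc_gt0; lra.
have d1 := disk_sub1 z1.
have n1 : 0 < normc (1 - z) by rewrite normc_gt0.
have n12 : normc (1 - z) <= 2 by have := le_normcD 1 (- z); rewrite normcN normc1; lra.
have four : (4 : C) != 0 by rewrite pnatr_eq0.
have PF : 1 - P = (1 - z) * (3 + z) / 4 by rewrite PE; field.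
(* Exact remainder: 1/(1 - P) = 1/(1 - z) + 1/(3 + z), and 1/(3 + z) = 1/4 + (1 - z)/(4(3 + z)). *)
pose h := - ((t%:C)%C * (1 - z) / (4 * (3 + z))).
have EP : E P = E z * (e0%:C)%C * cexp h.
  rewrite /E /e0 -cexp_real -!cexpD; congr cexp.
  rewrite PF /h rmorphM rmorphN fmorphV rmorph_nat; field.
  by rewrite d1 z30.
have hn : normc h <= t * normc (1 - z) / 8.
  rewrite /h normcN Normc.normcM [normc ((t%:C)%C * _)]Normc.normcM normc_real (ger0_norm t0) Normc.normcV Normc.normcM n4.
  rewrite ler_pdivrMr; last by rewrite mulr_gt0 //; lra.
  have := ler_wpM2l (mulr_ge0 t0 (ltW n1)) z3; lra.
have hH : normc h <= t / 4.
  by apply: le_trans hn _; have := ler_wpM2l t0 n12; lra.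
have hL := HL _ hH.
have [_ den1] := fr_den r01 z1; have [_ den2] := fr_den r01 P1.
have nP : normc (1 - z) / 2 <= normc (1 - P).
  rewrite PF Normc.normcM [normc (_ * (3 + z))]Normc.normcM Normc.normcV n4.
  have := ler_wpM2l (ltW n1) z3; lra.
have D1 : 1 - (r%:C)%C * z != 0 by rewrite -normc_gt0; lra.
have D2 : 1 - (r%:C)%C * P != 0 by rewrite -normc_gt0; lra.
have -> : fr r P - (e0%:C)%C * fr r z = E z * (e0%:C)%C *
   ((cexp h - 1) / (1 - (r%:C)%C * P) + (r%:C)%C * (P - z) / ((1 - (r%:C)%C * P) * (1 - (r%:C)%C * z))).
  rewrite /fr EP; field; by rewrite D1 D2.
rewrite Normc.normcM [normc (E z * _)]Normc.normcM normc_real.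
have e01 : 0 <= e0 <= 1 by rewrite expR_ge0 expR_le1; lra.
have b1 : normc ((cexp h - 1) / (1 - (r%:C)%C * P)) <= L * t / 2.
  rewrite Normc.normcM Normc.normcV ler_pdivrMr ?normc_gt0 //.
  apply: le_trans hL _; apply: le_trans (ler_wpM2l L0 hn) _.
  have k : normc (1 - z) / 4 <= normc (1 - (r%:C)%C * P) by lra.
  have := ler_wpM2l (mulr_ge0 L0 t0) k; lra.
have b2 : normc ((r%:C)%C * (P - z) / ((1 - (r%:C)%C * P) * (1 - (r%:C)%C * z))) <= 2.
  rewrite Normc.normcM [normc (_ * (P - z))]Normc.normcM Normc.normcV [normc ((1 - _) * _)]Normc.normcM.
  rewrite ler_pdivrMr ?mulr_gt0 ?normc_gt0 //.
  have -> : P - z = (1 - z) ^+ 2 / 4 by rewrite PE; ring.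
  rewrite [normc (_ ^+ 2 / 4)]Normc.normcM normcX Normc.normcV n4 normc_real gtr0_norm; last by case/andP: r01.
  have k1 : normc (1 - z) / 4 <= normc (1 - (r%:C)%C * P) by lra.
  have k2 : normc (1 - z) / 4 * (normc (1 - z) / 2) <= normc (1 - (r%:C)%C * P) * normc (1 - (r%:C)%C * z).
    by apply: ler_pM => //; rewrite divr_ge0 // ltW.
  have k3 : 0 <= normc (1 - z) ^+ 2 := sqr_ge0 _.
  have k4 : r * (normc (1 - z) ^+ 2 / 4) <= 1 * (normc (1 - z) ^+ 2 / 4).
    by apply: ler_wpM2r; [rewrite divr_ge0|lra].
  lra.
apply: le_trans (_ : 1 * (L * t / 2 + 2) <= _); last by rewrite mul1r.
apply: ler_pM; rewrite ?mulr_ge0 ?normc_ge0 ?normr_ge0 //.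
  rewrite -[leRHS]mulr1; apply: ler_pM; rewrite ?normc_ge0 ?normr_ge0 ?E_le1 //.
  by rewrite ger0_norm; lra.
apply: le_trans (le_normcD _ _) _; lra.
Qed.

Lemma tail_small (a : nat -> R) (Q e : R) : (forall k, 0 <= a k) -> (forall n, \sum_(k < n) a k <= Q) -> 0 < e ->
  exists n, forall m, \sum_(n <= k < n + m) a k <= e.
Proof.
move=> a0 aQ ep.
pose U := range (fun n => \sum_(k < n) a k).
have hs : has_sup U by split; [exists (\sum_(k < 0) a k); exists 0%N|exists Q => _ [n _ <-]; exact: aQ].
have [_ [n _ <-] Hn] := sup_adherent ep hs.
exists n => m.
have : \sum_(k < n + m) a k <= sup U by apply: sup_upper_bound => //; exists (n + m)%N.
have -> : \sum_(k < n + m) a k = \sum_(k < n) a k + \sum_(n <= k < n + m) a k.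
  by rewrite -!(big_mkord xpredT a) (big_cat_nat (leq0n n)) ?leq_addr.
move: Hn; lra.
Qed.

(** A function of H^2 is o((1 - |b|^2)^(-1/2)). On the horocycle 1/(1 - b) = 1 + iy, with d = |1 +
    iy|, one has 1 - |b|^2 = 1/d^2, while the function has modulus exp(-t) d. *)
Lemma F_notin_H2 Q : ~ Hq (fun z => E z / (1 - z)) Q.
Proof.
case=> a [aF aQ].
pose m0 := expR (- t); have m00 : 0 < m0 := expR_gt0 _.
have ep : 0 < (m0 / 2) ^+ 2 by rewrite exprn_gt0 // divr_gt0.
have [n Hn] := tail_small (fun k => sqr_ge0 (normc (a k))) aQ ep.
pose An := \sum_(k < n) normc (a k).
have An0 : 0 <= An by rewrite sumr_ge0 // => i _; exact: normc_ge0.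
(* The estimate to come, m0 d <= An + d m0/2 with d >= y, contradicts y m0 > 2 An. *)
pose y := (2 * An + 1) / m0.
have y0 : 0 < y by rewrite divr_gt0 //; lra.
have ym : y * m0 = 2 * An + 1 by rewrite mulfVK // gt_eqF.
pose be : C := (1 +i* y)%C.
pose d := normc be.
have d2 : d ^+ 2 = 1 + y ^+ 2 by rewrite /d normc_sqr /= expr1n.
have dy : y <= d by have := normc_Im be; rewrite /= (gtr0_norm y0).
have d0 : 0 < d by lra.
have be0 : be != 0 by rewrite -normc_gt0.
pose b := 1 - be^-1.
have b1 : 1 - b = be^-1 by rewrite /b; ring.
have nb2 : normc b ^+ 2 = 1 - 1 / d ^+ 2.
  have -> : b = (0 +i* y)%C / be.
    rewrite /b; have -> : (0 +i* y)%C = be - 1 by apply/eqP; rewrite eq_complex /= subrr subr0 !eqxx.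
    by field.
  rewrite Normc.normcM exprMn Normc.normcV exprVn normc_sqr -/d /= expr0n add0r.
  rewrite d2; field; rewrite gt_eqF // -d2 exprn_gt0 //.
have nb : normc b < 1.
  rewrite -(@ltr_pXn2r _ 2) ?nnegrE ?normc_ge0 // nb2 expr1n.
  have : 0 < 1 / d ^+ 2 by rewrite divr_gt0 // exprn_gt0.
  by lra.
have Fb : normc (E b / (1 - b)) = m0 * d.
  rewrite b1 invrK Normc.normcM -/d /E b1 invrK normc_cexp; congr (expR _ * _).
  by rewrite /= mulr1 mul0r subr0.
have : normc (E b / (1 - b)) <= An + d * (m0 / 2).
  apply: (@tay_le R a b _ _ n) (aF _ nb) => N /subnKC <-; move: (N - n)%N => m.
  rewrite psum_split; apply: le_trans (le_normcD _ _) _; apply: lerD.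
    apply: le_trans (normc_sum _ _ _) _; apply: ler_sum => i _.
    by rewrite Normc.normcM normcX ler_piMr ?normc_ge0 // exprn_ile1 ?normc_ge0 // ltW.
  apply: le_trans (normc_sum _ _ _) _.
  pose et := m0 / 2; have et0 : 0 < et by rewrite /et; lra.
  (* Weight that balances the arithmetic-geometric form of Cauchy-Schwarz: c et^2/2 + d^2/(2c) = d
     et. *)
  pose c := d / et; have c0 : 0 < c by rewrite divr_gt0.
  apply: (@le_trans _ _ (\sum_(n <= k < n + m) (c / 2 * normc (a k) ^+ 2 + (c^-1 / 2) * (normc b ^+ 2) ^+ k))).
    apply: ler_sum => i _; rewrite Normc.normcM normcX -exprM mulnC exprM.
    move: (normc (a i)) (normc b ^+ i) => u v.
    have -> : c / 2 * u ^+ 2 + c^-1 / 2 * v ^+ 2 = u * v + c / 2 * (u - c^-1 * v) ^+ 2.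
      by field; rewrite gt_eqF.
    by rewrite lerDl mulr_ge0 ?sqr_ge0 // divr_ge0 // ltW.
  rewrite big_split /= -!mulr_sumr.
  have g : \sum_(n <= k < n + m) (normc b ^+ 2) ^+ k <= d ^+ 2.
    have rb : 0 <= normc b ^+ 2 < 1.
      rewrite sqr_ge0 /= nb2; have : 0 < 1 / d ^+ 2 by rewrite divr_gt0 // exprn_gt0.
      by lra.
    have := geom_tail n m rb => G; apply: le_trans G _.
    have -> : 1 - normc b ^+ 2 = (d ^+ 2)^-1 by rewrite nb2; ring.
    rewrite invrK ler_piMl ?sqr_ge0 // exprn_ile1 //; first exact: sqr_ge0.
    by apply: ltW; case/andP: rb.
  have k1 : c / 2 * \sum_(n <= k < n + m) normc (a k) ^+ 2 <= c / 2 * et ^+ 2.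
    by rewrite ler_wpM2l ?Hn // divr_ge0 // ltW.
  have k2 : c^-1 / 2 * \sum_(n <= k < n + m) (normc b ^+ 2) ^+ k <= c^-1 / 2 * d ^+ 2.
    by rewrite ler_wpM2l // divr_ge0 // invr_ge0 ltW.
  apply: le_trans (lerD k1 k2) _.
  rewrite le_eqVlt; apply/orP; left; apply/eqP; rewrite -/et /c.
  by field; rewrite !gt_eqF.
rewrite Fb.
have : y * m0 <= d * m0 by rewrite ler_wpM2r // ltW.
lra.
Qed.

(** A lower bound would improve any bound q for the squared norm of f_r to q/2 + C3. Iterating frees
    the bound from r, and r can tend to 1. *)
Lemma not_bounded_below : ~ bounded_below (Tw psi (1 / 2)) lam.
Proof.
case=> K K0 HK; have [C1 C10 HC1] := fr_Phi.
have h12 : 0 < (1 / 2 : R) <= 1 by lra.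
have [chiH chiS] := psi_bino psiH psiS h12.
have S0 : 0 <= S.
  by apply: le_trans (normc_ge0 _) (psiS (_ : normc (0 : C) < 1)); rewrite normc0 ltr01.
have [et [et0 etK]] : exists et : R, 0 < et /\ K * (2 * et ^+ 2) <= 1 / 2.
  exists (Num.min 1 (1 / (4 * (K + 1)))).
  have p0 : 0 < 1 / (4 * (K + 1)) by rewrite divr_gt0 // mulr_gt0 //; lra.
  split; first by rewrite lt_min ltr01.
  set u := Num.min _ _.
  have u1 : u <= 1 by rewrite ge_min lexx.
  have u2 : u <= 1 / (4 * (K + 1)) by rewrite ge_min lexx orbT.
  have u0 : 0 < u by rewrite lt_min ltr01.
  have u3 : u * (4 * (K + 1)) <= 1 by rewrite -ler_pdivlMr // mulr_gt0 //; lra.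
  have : K * (u ^+ 2) <= K * u by rewrite ler_wpM2l // expr2 ler_piMr // ltW.
  clearbody u; lra.
have [de de0 Hde] := psiL et0.
pose S2 := S + normc psi1.
have S20 : 0 <= S2 by rewrite addr_ge0 // normc_ge0.
(* The first part pays for the defect in [fr_Phi], the second for the variation of psi away from 1,
   where |f_r| <= 1/de. *)
pose C2 := S * C1 + S2 / de.
have C20 : 0 <= C2 by rewrite addr_ge0 ?mulr_ge0 ?invr_ge0 ?(ltW de0).
have e01 : 0 <= e0 <= 1 by rewrite expR_ge0 expR_le1; move: t0; lra.
have err r z : 0 < r < 1 -> normc z < 1 ->
    normc (Tw psi (1 / 2) (fr r) z - lam * fr r z) ^+ 2 <= 2 * et ^+ 2 * normc (fr r z) ^+ 2 + 2 * C2 ^+ 2.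
  move=> r01 z1; pose chi := psi (ev (bino (1 / 2)) z).
  have n1 : 0 < normc (1 - z) by rewrite normc_gt0 disk_sub1.
  have k0 : normc (Tw psi (1 / 2) (fr r) z - lam * fr r z) <= et * normc (fr r z) + C2.
    have -> : Tw psi (1 / 2) (fr r) z - lam * fr r z =
       chi * (fr r (ev (Phi (1 / 2 / 2)) z) - (e0%:C)%C * fr r z) + (e0%:C)%C * ((chi - psi1) * fr r z).
      by rewrite /Tw /lam /chi; ring.
    apply: le_trans (le_normcD _ _) _.
    rewrite addrC [normc (chi * _)]Normc.normcM [normc ((e0%:C)%C * _)]Normc.normcM.
    rewrite [normc ((chi - psi1) * _)]Normc.normcM normc_real ger0_norm; last by case/andP: e01.
    have a1 : normc chi * normc (fr r (ev (Phi (1 / 2 / 2)) z) - (e0%:C)%C * fr r z) <= S * C1.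
      by apply: ler_pM; rewrite ?normc_ge0 ?chiS ?HC1.
    have a2 : e0 * (normc (chi - psi1) * normc (fr r z)) <= normc (chi - psi1) * normc (fr r z).
      by rewrite ler_piMl ?mulr_ge0 ?normc_ge0 //; lra.
    have a3 : normc (chi - psi1) * normc (fr r z) <= et * normc (fr r z) + S2 / de.
      have f0 := normc_ge0 (fr r z).
      have q0 : 0 <= S2 / de by rewrite divr_ge0 // ltW.
      (* The threshold is 2 de because the map onto the disk of radius 1/2 halves the distance to
         1. *)
      have [near|far] := ltP (normc (1 - z)) (2 * de).
        have : normc (chi - psi1) <= et.
          apply/ltW/Hde; first exact: bino_D.
          have h0 : 0 <= (1 / 2 : R) by rewrite divr_ge0.
          rewrite ev_bino addrAC subrr add0r normcN Normc.normcM normc_real ger0_norm; lra.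
        move=> k; have := ler_wpM2r f0 k; lra.
      have [_ den] := fr_den r01 z1.
      have k1 : normc (fr r z) <= 1 / de.
        rewrite /fr Normc.normcM Normc.normcV ler_pdivrMr; last lra.
        apply: le_trans (E_le1 z1) _.
        rewrite mulrC mulrA mulr1 ler_pdivlMr // mul1r; lra.
      have k2 : normc (chi - psi1) <= S2.
        by apply: le_trans (le_normcD _ _) _; rewrite normcN /S2 lerD2r; exact: chiS.
      have := ler_pM (normc_ge0 _) f0 k2 k1.
      have := mulr_ge0 (ltW et0) f0; lra.
    rewrite /C2; lra.
  have := normc_ge0 (Tw psi (1 / 2) (fr r) z - lam * fr r z).
  move: (normc _) (normc (fr r z)) (normc_ge0 (fr r z)) k0 => u v v0 uv u0.
  apply: (@le_trans _ _ ((et * v + C2) ^+ 2)).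
    by rewrite lerXn2r // nnegrE addr_ge0 // mulr_ge0 // ltW.
  have := sqr_ge0 (et * v - C2); lra.
pose C3 := K * (2 * C2 ^+ 2).
have C30 : 0 <= C3 by rewrite mulr_ge0 // mulr_ge0 // sqr_ge0.
have unif r : 0 < r < 1 -> Hq (fr r) (2 * C3 + 1).
  move=> r01; have [q0 Hq0'] := fr_Hq r01.
  have q00 := Hq_ge0 Hq0'.
  have step q : Hq (fr r) q -> Hq (fr r) (q / 2 + C3).
    move=> Hf; have qq := Hq_ge0 Hf.
    have [_ Ab] := Aop_sq_bounded (R := R) (a := 1 / 2 / 2) ltac:(lra).
    have [_ Bb] := Bop_sq_bounded psiH psiS h12.
    have T1 : Hq (Tw psi (1 / 2) (fr r)) (S ^+ 2 * ((1 - 1 / 2 / 2)^-1 * q)).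
      by apply: Hq_eq (Bb _ _ (Ab _ _ Hf)) => z z1; rewrite Tw_BA //; lra.
    have T2 := HqB T1 (HqZ lam Hf).
    have A0 : 0 <= 2 * et ^+ 2 by rewrite mulr_ge0 // sqr_ge0.
    have T3 := Hq_dom A0 Hf T2 (fun z => @err r z r01).
    apply: Hq_le (HK _ _ _ Hf T3).
    rewrite mulrDr -/C3 lerD2r mulrA.
    have := ler_wpM2r qq etK; lra.
  have it j : Hq (fr r) (q0 * (1 / 2) ^+ j + 2 * C3).
    elim: j => [|j IH]; first by apply: Hq_le Hq0'; rewrite expr0 mulr1; lra.
    apply: Hq_le (step _ IH); rewrite exprS; move: ((1 / 2) ^+ j) => u; lra.
  have hr : 0 <= (1 / 2 : R) < 1 by lra.
  have q1 : 0 < (q0 + 1)^-1 by rewrite invr_gt0; lra.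
  have [N HN] := expr_small hr q1.
  apply: Hq_le (it N).
  have := HN N (leqnn _); rewrite -[(q0 + 1)^-1]mul1r ltr_pdivlMr; last lra.
  have : 0 <= (1 / 2 : R) ^+ N by rewrite exprn_ge0 //; lra.
  move: ((1 / 2) ^+ N) => u; lra.
apply: (@F_notin_H2 (2 * C3 + 1)).
pose r (N : nat) : R := 1 - (1 / 2) ^+ N.+1.
have rr N : 0 < (1 / 2 : R) ^+ N.+1 <= 1 / 2.
  have h2 : 0 < (1 / 2 : R) by lra.
  rewrite exprn_gt0 //= exprS.
  have : (1 / 2 : R) ^+ N <= 1 by apply: exprn_ile1; lra.
  by move: ((1 / 2) ^+ N) => u; lra.
apply: (@Hq_lim R (fun N => fr (r N))) => [N|z z1].
  by apply: unif; have := rr N; rewrite /r; move: (_ ^+ N.+1) => u; lra.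
have d1 := disk_sub1 z1.
have cc : ccont (fun w : C => E z * w^-1) (1 - z).
  by apply: ccontM; [exact: ccont_cst|exact: ccontV].
move=> e ep; have [de' de'0 H] := cc e ep.
have hr : 0 <= (1 / 2 : R) < 1 by lra.
have [N HN] := expr_small hr de'0; exists N => n Nn; apply: H.
have -> : 1 - (r n)%:C%C * z - (1 - z) = ((1 / 2) ^+ n.+1)%:C%C * z.
  by rewrite /r rmorphB rmorph1 /=; ring.
rewrite Normc.normcM normc_real.
have /andP[a b] := rr n; rewrite gtr0_norm //.
have := HN n.+1 (leqW Nn); have := normc_ge0 z.
move: ((1 / 2) ^+ n.+1) a b => u a b z0 ud; nra.
Qed.

End Psi.
End Lower.

(** * From squared-norm estimates to the spectrum *)

Section Glue.
Variable R : realType.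
Local Notation C := R[i].
Implicit Types (x y e t r : R) (z w c lam : C) (f g : C -> C) (T : (C -> C) -> (C -> C)).

Lemma is_taylorP (a : nat -> C) f : is_taylor a f <-> forall z, normc z < 1 -> tay a z (f z).
Proof.
have sE z n : series (fun k => a k * z ^+ k) n = psum a z n.
  by rewrite /series /= big_mkord.
split=> H z z1.
  have z1' : `|z| < 1 by rewrite -normcK -(rmorph1 (real_complex R)) ltcR.
  move=> e e0; have e0' : 0 < (e%:C)%C :> C by rewrite ltcR.
  have /cvgrPdist_lt/(_ _ e0')[N _ HN] := H z z1'.
  exists N => n Nn; have := HN n Nn; rewrite /= sE -normcK ltcR.
  by rewrite normc_distC.
have z1' : normc z < 1 by rewrite -ltcR normcK.
apply/cvgrPdist_lt => e e0; have [e' e'0 ->] := complex_gt0 e0.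
have [N HN] := H z z1' _ e'0; exists N => // n /= Nn.
by rewrite sE -normcK ltcR normc_distC; exact: HN.
Qed.

Lemma sum_norm2 (a : nat -> C) n : \sum_(k < n) `|a k| ^+ 2 = ((\sum_(k < n) normc (a k) ^+ 2)%:C)%C.
Proof. by rewrite rmorph_sum /=; apply: eq_bigr => i _; rewrite rmorphXn. Qed.

Lemma complex_ge0 (M : C) : 0 <= M -> exists2 m, 0 <= m & M = (m%:C)%C.
Proof. by case: M => a b; rewrite lecE /= => /andP[/eqP -> a0]; exists a. Qed.

Lemma H2bound_Hq f (m : R) : H2bound f (m%:C)%C -> Hq f (m ^+ 2).
Proof.
case=> _ [a [/is_taylorP aT aS]]; exists a; split => // n.
by have := aS n; rewrite sum_norm2 -rmorphXn lecR.
Qed.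

Lemma Hq_H2bound f (m : R) : 0 <= m -> Hq f (m ^+ 2) -> H2bound f (m%:C)%C.
Proof.
move=> m0 [a [aT aS]]; split; first by rewrite ler0c.
exists a; split; first exact/is_taylorP.
by move=> n; rewrite sum_norm2 -rmorphXn lecR.
Qed.

Lemma inH2P f : inH2 f <-> exists q, Hq f q.
Proof.
split=> [[M HM]|[q Hf]].
  have [m m0 ME] := complex_ge0 (proj1 HM); rewrite ME in HM.
  by exists (m ^+ 2); exact: H2bound_Hq.
exists ((Num.sqrt q)%:C)%C; apply: Hq_H2bound; first exact: sqrtr_ge0.
by rewrite sqr_sqrtr // (Hq_ge0 Hf).
Qed.

Lemma bounded_opI T k : linear_op T -> sq_bounded T k -> bounded_op T.
Proof.
move=> [E L] [k0 Tk]; split.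
- by move=> f /inH2P[q Hf]; apply/inH2P; exists (k * q); exact: Tk.
- move=> f g c _ _ z z1; apply: L.
  by rewrite -ltcR normcK.
exists ((Num.sqrt k)%:C)%C; split; first by rewrite ler0c sqrtr_ge0.
move=> f M HM; have [m m0 ME] := complex_ge0 (proj1 HM); rewrite ME in HM *.
rewrite -rmorphM; apply: Hq_H2bound; first by rewrite mulr_ge0 ?sqrtr_ge0.
by rewrite exprMn sqr_sqrtr //; apply: Tk; exact: H2bound_Hq.
Qed.

Lemma has_resolvent_invertible T lam k : linear_op T -> sq_bounded T k -> has_resolvent T lam ->
  invertible_op (fun f z => T f z - lam * f z).
Proof.
move=> TL Tk [K K0 HK].
have Tl : linear_op (fun f z => T f z - lam * f z).
  case: TL => E L; split=> [f g fg z z1|c f g z z1]; first by rewrite (E f g) // fg.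
  by rewrite L //; ring.
have To : sq_bounded (fun f z => T f z - lam * f z) (2 * k + 2 * normc lam ^+ 2).
  case: Tk => k0 Tk; split; first by rewrite addr_ge0 // mulr_ge0 // sqr_ge0.
  move=> f q Hf; apply: Hq_le (HqB (Tk _ _ Hf) (HqZ lam Hf)).
  by rewrite le_eqVlt; apply/orP; left; apply/eqP; ring.
split; first exact: bounded_opI Tl To.
(* One solution must serve every bound q of f, so that the inverse has a norm bound; uniqueness
   identifies the solutions found for different q. Outside H^2 the value f is a dummy. *)
have /choice[S HS] : forall f, exists g, forall q, Hq f q ->
    [/\ Hq g (K * q), eqd (fun z => T g z - lam * g z) f
    & forall g' q', Hq g' q' -> eqd (fun z => T g' z - lam * g' z) f -> eqd g' g].
  move=> f; have [[q0 Hf0]|nf] := pselect (exists q, Hq f q); last first.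
    by exists f => q Hf; case: nf; exists q.
  have [g [g1 g2 g3]] := HK _ _ Hf0; exists g => q Hf; split => //.
  have [g' [h1 h2 h3]] := HK _ _ Hf.
  by apply: Hq_eq (h1); exact: (g3 _ _ h1).
have D z : `|z| < 1 -> normc z < 1 by move=> z1; rewrite -ltcR normcK.
exists S; split.
  split.
  - move=> f /inH2P[q Hf]; apply/inH2P; have [h _ _] := HS _ _ Hf.
    by exists (K * q).
  - move=> f g c /inH2P[q1 Hf] /inH2P[q2 Hg] z /D z1.
    have [f1 f2 f3] := HS _ _ Hf; have [g1 g2 g3] := HS _ _ Hg.
    have H := HqD ltr01 (HqZ c Hf) Hg.
    have [h1 h2 h3] := HS _ _ H.
    have H' := HqD ltr01 (HqZ c f1) g1.
    apply/esym; apply: (h3 _ _ H') => // w w1.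
    case: Tl => E L; rewrite (L c (S f) (S g) w w1).
    by rewrite -(f2 w w1) -(g2 w w1).
  exists ((Num.sqrt K)%:C)%C; split; first by rewrite ler0c sqrtr_ge0.
  move=> f M HM; have [m m0 ME] := complex_ge0 (proj1 HM); rewrite ME in HM *.
  rewrite -rmorphM; apply: Hq_H2bound; first by rewrite mulr_ge0 ?sqrtr_ge0.
  rewrite exprMn sqr_sqrtr //.
  by have [h _ _] := HS _ _ (H2bound_Hq HM).
move=> f /inH2P[q Hf]; split => z /D z1.
  have Hg := proj2 To _ _ Hf; have [_ _ h3] := HS _ _ Hg.
  by apply/esym; apply: (h3 _ _ Hf).
by have [_ h2 _] := HS _ _ Hf; exact: h2.
Qed.

Lemma invertible_bounded_below T lam : invertible_op (fun f z => T f z - lam * f z) -> bounded_below T lam.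
Proof.
case=> [[B1 _ _] [S [[_ _ [K [K0 HK]]] HS]]].
have [k k0 KE] := complex_ge0 K0.
exists (k ^+ 2); first exact: sqr_ge0.
move=> f q q' Hf Hg.
have q0 := Hq_ge0 Hg.
have Hm : H2bound (fun z => T f z - lam * f z) ((Num.sqrt q')%:C)%C.
  by apply: Hq_H2bound; [exact: sqrtr_ge0|rewrite sqr_sqrtr].
have := HK _ _ Hm; rewrite KE -rmorphM => /H2bound_Hq; rewrite exprMn sqr_sqrtr // => H.
have /HS[SE _] : inH2 f by apply/inH2P; exists q.
apply: Hq_eq H => z z1; apply: SE.
by rewrite -normcK -(rmorph1 (real_complex R)) ltcR.
Qed.

Lemma bounded_below_eq T T' lam : (forall f, eqd (T f) (T' f)) -> bounded_below T lam -> bounded_below T' lam.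
Proof.
move=> E [K K0 HK]; exists K => // f q q' Hf Hg; apply: HK Hf _.
by apply: Hq_eq Hg => z z1; rewrite E.
Qed.

Lemma has_resolvent_eq T T' lam : (forall f, eqd (T f) (T' f)) -> has_resolvent T lam -> has_resolvent T' lam.
Proof.
move=> E [K K0 HK]; exists K => // f q Hf; have [g [g1 g2 g3]] := HK _ _ Hf.
exists g; split => // [z z1|g' q' Hg' g'E]; first by rewrite -E // g2.
by apply: (g3 _ _ Hg') => z z1; rewrite E // g'E.
Qed.

Lemma Wco_Tw psi f : eqd (Tw psi 1 f) (Wco psi (@phi8 R) f).
Proof.
move=> z z1; rewrite /Tw /Wco /phi8 ev_Phi.
have -> : ev (bino 1) z = z by rewrite ev_bino rmorph1; ring.
congr (_ * f _); rewrite fmorph_div rmorph1 rmorph_nat.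
by field.
Qed.

(* All functions in the range of [Wco psi phi8] are [psi] times an even
   function. *)
Lemma zero_spectrum psi : spectrum (Wco psi (@phi8 R)) 0.
Proof.
move=> [_ [S [_ HS]]].
have H1 : inH2 (fun=> 1 : C).
  by apply/inH2P; exists 1; exact: Hq1.
have HX : inH2 (fun z => z : C).
  have /inH2P[q Hq1] := H1; apply/inH2P; exists q.
  by apply: Hq_eq (Hq_shift Hq1) => z _; rewrite mulr1.
(* Preimages of 1 and of z: the first forces psi to agree at 1/2 and -1/2, and then the second would
   make z agree there too. *)
have [_ e1] := HS _ H1; have [_ e2] := HS _ HX.
pose z : C := ((1 / 2 : R)%:C)%C.
have nz : `|z| < 1.
  by rewrite -normcK normc_real ger0_norm -?(rmorph1 (real_complex R)) ?ltcR; lra.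
have nz' : `|- z| < 1 by rewrite normrN.
have ph : phi8 (- z) = phi8 z by rewrite /phi8 sqrrN.
have := e1 z nz; have := e1 (- z) nz'; have := e2 z nz; have := e2 (- z) nz'.
rewrite /Wco ph !mul0r !subr0.
set g := S _ (phi8 z); set h := S _ (phi8 z) => a1 a2 a3 a4.
have h0 : h != 0 by apply/eqP => h0; move: a4; rewrite h0 mulr0 => /esym/eqP; rewrite oner_eq0.
have pp : psi z = psi (- z) by apply: (mulIf h0); rewrite a3 a4.
have : z = - z by rewrite -{1}a2 -{1}a1 pp.
move/eqP; rewrite -subr_eq0 opprK -mulr2n mulrn_eq0 /= -normc_eq0 normc_real.
by rewrite normr_eq0 mulf_eq0 invr_eq0 oner_eq0 pnatr_eq0.
Qed.

Lemma Hinf_Hq psi : Hinf psi -> exists S, Hq psi (S ^+ 2) /\ forall z, normc z < 1 -> normc (psi z) <= S.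
Proof.
case=> hol [M HM].
have D z : normc z < 1 -> `|z| < 1 by move=> z1; rewrite -normcK -(rmorph1 (real_complex R)) ltcR.
have HS z : normc z < 1 -> normc (psi z) <= complex.Re M.
  by move=> /D /HM; rewrite -normcK lecE /= => /andP[].
exists (complex.Re M); split => //; apply: bounded_Hq => // z z1.
exact/cdiff_cara/derivable_cdiff/hol/D.
Qed.

Lemma cvg_disk psi psi1 : psi @ within (disk (R := R)) (nbhs (1 : C)) --> psi1 ->
  forall e, 0 < e -> exists2 de, 0 < de &
  forall z, normc z < 1 -> normc (z - 1) < de -> normc (psi z - psi1) < e.
Proof.
move=> H e e0; have e0' : 0 < (e%:C)%C :> C by rewrite ltcR.
have /cvgrPdist_lt/(_ _ e0') := H.
rewrite nearE /within /= => /nbhs_ballP[de /= de0 Hd].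
have [de' de'0 deE] := complex_gt0 de0.
exists de' => // z z1 zd; have := Hd z.
rewrite /ball /= deE -normcK ltcR normc_distC => /(_ zd).
rewrite /disk /= -normcK -(rmorph1 (real_complex R)) !ltcR => /(_ z1).
by rewrite normc_distC.
Qed.

End Glue.

Theorem mainTheorem8 (R : realType) (psi : R[i] -> R[i]) (psi1 : R[i]) :
  Hinf psi ->
  psi @ within (disk (R := R)) (nbhs (1 : R[i])) --> psi1 ->
  spectrum (Wco psi (@phi8 R)) =
    [set lam | exists t : R, 0 <= t /\ lam = psi1 * ((expR (- t / 2))%:C)%C] `|` [set 0].
Proof.
move=> /Hinf_Hq[S [psiH psiS]] /cvg_disk psiL.
have one : 0 < (1 : R) <= 1 by rewrite ltr01 lexx.
have half : 0 <= (1 / 2 : R) < 1 by lra.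
have Al := Aop_linear half; have Ab := Aop_sq_bounded half.
have Bl := Bop_linear psi one; have Bb := Bop_sq_bounded psiH psiS one.
have s2 : (1 : R) < 2 by lra.
apply/seteqP; split => lam /=.
  move=> sp; apply: contrapT => nin; apply: sp.
  have l0 : lam != 0 by apply/eqP => l0; apply: nin; right.
  have G : has_resolvent (Tw psi 1) lam.
    by apply: (has_resolvent_Tw1 psiH psiS psiL l0) => t t0 E; apply: nin; left; exists t.
  have Wl : linear_op (Wco psi (@phi8 R)).
    have [E L] := Tw_linear psi one.
    split=> [f g fg z z1|c f g z z1]; first by rewrite -!Wco_Tw //; exact: E.
    by rewrite /Wco; ring.
  have Wb : sq_bounded (Wco psi (@phi8 R)) (S ^+ 2 * (1 - 1 / 2)^-1).
    case: Ab => a0 Ab; case: Bb => b0 Bb; split; first by rewrite mulr_ge0.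
    move=> f q Hf; rewrite -mulrA; apply: Hq_eq (Bb _ _ (Ab _ _ Hf)) => z z1.
    by rewrite -Wco_Tw // (Tw_BA _ _ _ s2).
  exact: has_resolvent_invertible Wl Wb (has_resolvent_eq (Wco_Tw psi) G).
case=> [[t [t0 lE]]|->]; last exact: zero_spectrum.
(* This happens when psi1 = 0; the exchange of factors below divides by lam. *)
have [->|l0] := eqVneq lam 0; first exact: zero_spectrum.
move=> /invertible_bounded_below BW.
have B1 : bounded_below (Tw psi 1) lam by apply: bounded_below_eq BW => f z z1; rewrite Wco_Tw.
have B2 := bounded_below_comm l0 Al Bl Ab Bb (fun f z _ => Tw_BA psi f z s2) (fun f z _ => Tw_AB psi f z s2) B1.
(* At radius 1/2 the translation length is a = 1/4, so the parameter 2t yields the factor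
   exp(-t/2). *)
have t20 : 0 <= 2 * t by rewrite mulr_ge0.
apply: (not_bounded_below t20 psiH psiS psiL).
have <- : (1 * (1 - 1 / 2) : R) = 1 / 2 by field.
have <- : lam = psi1 * ((expR (- (2 * t) / 4))%:C)%C.
  by rewrite lE; congr (_ * (expR _)%:C%C); field.
exact: B2.
Qed.
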